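(* Let $f_1,f_2\in L^1(SE(2))\cap L^2(SE(2))$ be admissible functions such that $\widetilde{f_1}\in L^2(\mathbb{Z}^2\backslash SE(2),\mu)$. Let $\mathbf{k}=(k_1,k_2,k_3)\in\mathbb{Z}^3$. (1) If $\rho(k_1,k_2)\neq0$, then $$\langle\widetilde{f_1}\oslash f_2,\psi_\mathbf{k}\rangle=\sqrt{2\pi}\,e^{-\mathrm{i}k_3\Phi(k_1,k_2)}\sum_{n\in\mathbb{Z}}\sum_{m\in\mathbb{Z}}e^{-\mathrm{i}n\Phi(k_1,k_2)}\,\widehat{f_1}(2\pi\rho(k_1,k_2))_{n,m}\,\widehat{f_2}(2\pi\rho(k_1,k_2))_{m,-k_3},$$ where the series converges absolutely. (2) If $\rho(k_1,k_2)=0$, then $\langle\widetilde{f_1}\oslash f_2,\psi_\mathbf{k}\rangle=\sqrt{2\pi}\,\widehat{f_1}[k_3]\,\widehat{f_2}[k_3]$.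
   Context: $SE(2)=\mathbb{R}^2\rtimes SO(2)$ has elements $g=(\mathbf{x},\mathbf{R})$ with product $(\mathbf{x},\mathbf{R})\circ(\mathbf{x}',\mathbf{R}')=(\mathbf{x}+\mathbf{R}\mathbf{x}',\mathbf{R}\mathbf{R}')$; $g(x,y,\theta):=((x,y),\mathbf{R}_\theta)$ with $\mathbf{R}_\theta$ the rotation by $\theta$. The Haar measure is $dg=\frac{1}{4\pi^2}dx\,dy\,d\theta$ ($\theta\in[0,2\pi)$), and $L^q(SE(2))$ refers to it. $L^2(\mathbb{S}^1)$ carries $\langle u,v\rangle=\frac{1}{2\pi}\int_0^{2\pi}u(\alpha)\overline{v(\alpha)}\,d\alpha$, with orthonormal basis $\mathbf{e}_k(\mathbf{u}_\alpha)=e^{\mathrm{i}k\alpha}$, $\mathbf{u}_\alpha=(\cos\alpha,\sin\alpha)$, $k\in\mathbb{Z}$. For $p>0$, $[U_p(\mathbf{t},\mathbf{R}_\theta)v](\mathbf{u})=e^{\mathrm{i}p\langle\mathbf{u},\mathbf{t}\rangle}v(\mathbf{R}_\theta^T\mathbf{u})$ defines a unitary representation of $SE(2)$ on $L^2(\mathbb{S}^1)$. For $f\in L^1(SE(2))$: $\widehat{f}(p):=\int_{SE(2)}f(g)U_p(g^{-1})\,dg$ (weak sense) for $p>0$; $\widehat{f}(p)_{n,m}:=\langle\widehat{f}(p)\mathbf{e}_n,\mathbf{e}_m\rangle$ for $n,m\in\mathbb{Z}$; $\widehat{f}_{n,m}$ is the function $p\mapsto\widehat{f}(p)_{n,m}$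 on $(0,\infty)$, and $\|\widehat{f}_{n,m}\|_\infty=\sup_{p>0}|\widehat{f}(p)_{n,m}|$; and for $n\in\mathbb{Z}$, $\widehat{f}[n]:=\int_{SE(2)}f(g(x,y,\theta))e^{-\mathrm{i}n\theta}\,dg$. A function $f\in L^1(SE(2))$ is admissible if $\sup_{m\in\mathbb{Z}}\beta_m(f)<\infty$, where $\beta_m(f):=\sum_{n\in\mathbb{Z}}\|\widehat{f}_{n,m}\|_\infty$. $\mathbb{Z}^2$ is identified with the subgroup $\{g(\gamma_1,\gamma_2,0):\gamma_1,\gamma_2\in\mathbb{Z}\}$; $\mathbb{Z}^2\backslash SE(2)=\{\mathbb{Z}^2g\}$ is the right coset space. For $f\in L^1(SE(2))$, $\widetilde{f}(\mathbb{Z}^2g):=\sum_{\gamma\in\mathbb{Z}^2}f(\gamma\circ g)$ (a.e. defined). $\mu$ is the unique finite $SE(2)$-invariant (under right translation) Radon measure on $\mathbb{Z}^2\backslash SE(2)$ with $\int_{\mathbb{Z}^2\backslash SE(2)}\widetilde{f}\,d\mu=\int_{SE(2)}f\,dg$ for all $f\in L^1(SE(2))$; $\langle\psi,\varphi\rangle=\int\psi\overline{\varphi}\,d\mu$. For $f\in L^1(SE(2))$ and $\psi\in L^1(\mathbb{Z}^2\backslash SE(2),\mu)$, the convolution $\psi\oslash f$ on $\mathbb{Z}^2\backslash SE(2)$ is $(\psi\oslash f)(\mathbb{Z}^2g):=\int_{SE(2)}\psi(\mathbb{Z}^2h)f(h^{-1}\circ g)\,dh$. For $\mathbf{k}=(k_1,k_2,k_3)\in\mathbb{Z}^3$,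 $\psi_\mathbf{k}(\mathbb{Z}^2g(x,y,\theta)):=\sqrt{2\pi}\,e^{2\pi\mathrm{i}(k_1x+k_2y)}e^{\mathrm{i}k_3\theta}$. For $(x,y)\in\mathbb{R}^2$, $\rho(x,y)\ge0$ and $\Phi(x,y)\in[0,2\pi)$ are the polar coordinates: $x=\rho(x,y)\cos\Phi(x,y)$, $y=\rho(x,y)\sin\Phi(x,y)$. *)

(* Defs.v *)
From HB Require Import structures.
From mathcomp Require Import all_boot all_order all_algebra.
From mathcomp Require Import all_classical all_reals all_analysis.
From mathcomp Require Import complex ring.
Set Implicit Arguments.
Unset Strict Implicit.
Unset Printing Implicit Defensive.
Import Order.TTheory GRing.Theory Num.Theory.
Import numFieldNormedType.Exports.
Local Open Scope classical_set_scope.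
Local Open Scope ring_scope.
Local Open Scope complex_scope.
Local Open Scope quotient_scope.

Notation normc := ComplexField.Normc.normc.

Section SO2_group.
Variable R : realType.

Definition SO2_set : set 'M[R]_2 := [set A | A *m A^T = 1%:M /\ \det A = 1].
Definition SO2 : Type := set_type SO2_set.
Definition SO2_mx (A : SO2) : 'M[R]_2 := \val A.

HB.instance Definition _ := Topological.copy SO2 (set_type SO2_set).

Definition SO2_of (A : 'M[R]_2) (sA : SO2_set A) : SO2 := exist _ A (mem_set sA).

Lemma SO2P (A : SO2) : SO2_set (SO2_mx A).
Proof. exact: set_mem (valP A). Qed.

Lemma SO2_inj : injective SO2_mx.
Proof. exact: val_inj. Qed.

Lemma SO2_set1 : SO2_set 1%:M.
Proof. by split; rewrite ?trmx1 ?mulmx1 ?det1. Qed.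

Lemma SO2_setV A : SO2_set A -> SO2_set A^T.
Proof. by move=> [AA dA]; split; rewrite ?det_tr// trmxK (mulmx1C AA). Qed.

Lemma SO2_setM A B : SO2_set A -> SO2_set B -> SO2_set (A *m B).
Proof.
move=> [AA dA] [BB dB]; split; last by rewrite det_mulmx dA dB mulr1.
by rewrite trmx_mul mulmxA -(mulmxA A) BB mulmx1.
Qed.

Definition SO2_one : SO2 := SO2_of SO2_set1.
Definition SO2_inv (A : SO2) : SO2 := SO2_of (SO2_setV (SO2P A)).
Definition SO2_mul (A B : SO2) : SO2 := SO2_of (SO2_setM (SO2P A) (SO2P B)).

Lemma SO2_mulA : associative SO2_mul.
Proof. by move=> A B C; apply: SO2_inj; rewrite /SO2_mx /= mulmxA. Qed.
Lemma SO2_mul1 : left_id SO2_one SO2_mul.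
Proof. by move=> A; apply: SO2_inj; rewrite /SO2_mx /= mul1mx. Qed.
Lemma SO2_1mul : right_id SO2_one SO2_mul.
Proof. by move=> A; apply: SO2_inj; rewrite /SO2_mx /= mulmx1. Qed.
Lemma SO2_mulV : right_inverse SO2_one SO2_inv SO2_mul.
Proof. by move=> A; apply: SO2_inj; rewrite /SO2_mx /=; case: (SO2P A). Qed.
Lemma SO2_Vmul : left_inverse SO2_one SO2_inv SO2_mul.
Proof.
by move=> A; apply: SO2_inj; rewrite /SO2_mx /=; apply: mulmx1C; case: (SO2P A).
Qed.

HB.instance Definition _ :=
  isGroup.Build SO2 SO2_mulA SO2_mul1 SO2_1mul SO2_Vmul SO2_mulV.

Definition rot_mx (t : R) : 'M[R]_2 :=
  \matrix_(i, j) (if i == 0 then (if j == 0 then cos t else - sin t)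
                  else (if j == 0 then sin t else cos t)).

Lemma rot_mxP t : SO2_set (rot_mx t).
Proof.
split.
  apply/matrixP => i j; rewrite !mxE !big_ord_recl big_ord0 addr0 !mxE /=.
  case: i => -[|[|//]] ?; case: j => -[|[|//]] ? /=.
  - by rewrite mulrNN -!expr2 cos2Dsin2.
  - by rewrite mulNr mulrC subrr.
  - by rewrite mulrN mulrC subrr.
  - by rewrite -!expr2 addrC cos2Dsin2.
rewrite (expand_det_row _ ord0) !big_ord_recl big_ord0 addr0 /cofactor !det_mx11.
by rewrite !mxE /= !expr1 expr0 mul1r mulN1r mulrNN -!expr2 cos2Dsin2.
Qed.

Definition rot (t : R) : SO2 := SO2_of (rot_mxP t).

End SO2_group.
Coercion SO2_mx : SO2 >-> matrix.

Section SE2_group.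
Variable R : realType.

Definition SE2 : Type := ('cV[R]_2 * SO2 R)%type.

HB.instance Definition _ := Topological.copy SE2 ('cV[R]_2 * SO2 R)%type.

Definition SE2_one : SE2 := (0, 1%g).
Definition SE2_mul (g h : SE2) : SE2 := (g.1 + g.2 *m h.1, (g.2 * h.2)%g).
Definition SE2_inv (g : SE2) : SE2 := (- (SO2_mx (g.2)^-1%g *m g.1), (g.2)^-1%g).

Lemma SE2_mulA : associative SE2_mul.
Proof.
by move=> g h k; rewrite /SE2_mul /= mulgA mulmxDr addrA mulmxA.
Qed.
Lemma SE2_mul1 : left_id SE2_one SE2_mul.
Proof. by case=> x A; rewrite /SE2_mul /= mul1g add0r mul1mx. Qed.
Lemma SE2_1mul : right_id SE2_one SE2_mul.
Proof. by case=> x A; rewrite /SE2_mul /= mulg1 mulmx0 addr0. Qed.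
Lemma SE2_Vmul : left_inverse SE2_one SE2_inv SE2_mul.
Proof. by case=> x A; rewrite /SE2_mul /= mulVg addNr. Qed.
Lemma SE2_mulV : right_inverse SE2_one SE2_inv SE2_mul.
Proof.
case=> x A; rewrite /SE2_mul /= mulgV mulmxN mulmxA.
by rewrite (proj1 (SO2P A)) mul1mx subrr.
Qed.

HB.instance Definition _ :=
  isGroup.Build SE2 SE2_mulA SE2_mul1 SE2_1mul SE2_Vmul SE2_mulV.
HB.instance Definition _ := isPointed.Build SE2 1%g.
(* measurable sets of SE2 are the Borel sets of its topology *)
HB.instance Definition _ :=
  Measurable.copy SE2 (g_sigma_algebraType (@open SE2)).

Definition vec2 (x y : R) : 'cV[R]_2 := \col_i (if i == 0 then x else y).

Definition gSE2 (x y t : R) : SE2 := (vec2 x y, rot t).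

End SE2_group.

Section haar_measure.
Variable R : realType.

Lemma mx_continuous (T : topologicalType) m n (F : T -> 'M[R]_(m, n)) :
  (forall i j, continuous (fun x => F x i j)) -> continuous F.
Proof.
move=> cF x U [P Px PU]; rewrite nbhs_simpl.
suff: \forall y \near x, forall i j, P i j (F y i j).
  by apply: filterS => y Py; exact: PU.
apply: filter_forall => i; apply: filter_forall => j.
by apply: cF; exact: Px.
Qed.

Definition gSE2_tuple (u : R * R * R) : SE2 R := gSE2 u.1.1 u.1.2 u.2.

Lemma continuous_gSE2 : continuous gSE2_tuple.
Proof.
have c1 : continuous (fun u : R * R * R => u.1.1).
  by move=> u; apply: (continuous_comp cvg_fst cvg_fst).
have c2 : continuous (fun u : R * R * R => u.1.2).
  by move=> u; apply: (continuous_comp cvg_fst cvg_snd).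
have c3 : continuous (fun u : R * R * R => u.2) by move=> u; exact: cvg_snd.
have crot : continuous (fun u : R * R * R => rot u.2).
  apply: continuous_comp_initial.
  apply: mx_continuous => i j; under eq_fun => u do rewrite /= mxE.
  have cc : continuous (fun u : R * R * R => cos u.2).
    by move=> u; apply: (continuous_comp (c3 u)); exact: continuous_cos.
  have cs : continuous (fun u : R * R * R => sin u.2).
    by move=> u; apply: (continuous_comp (c3 u)); exact: continuous_sin.
  have cNs : continuous (fun u : R * R * R => - sin u.2).
    by move=> u; apply: continuousN; exact: cs.
  by have [_|_] := eqVneq i 0; have [_|_] := eqVneq j 0.
have cvec : continuous (fun u : R * R * R => vec2 u.1.1 u.1.2).
  apply: mx_continuous => i j; under eq_fun => v do rewrite mxE.
  by have [_|_] := eqVneq i 0.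
move=> u; have H := cvg_pair (cvec u) (crot u); exact: H.
Qed.

Lemma open_measurable3 (U : set (R * R * R)) : open U -> measurable U.
Proof.
move=> oU.
pose B (z : rat * rat * rat * rat) : set (R * R * R) :=
  (ball (ratr z.1.1.1 : R) (ratr z.2) `*` ball (ratr z.1.1.2 : R) (ratr z.2))
    `*` ball (ratr z.1.2 : R) (ratr z.2).
pose F z := if `[< B z `<=` U >] then B z else set0.
suff -> : U = \bigcup_z F z.
  apply: countable_bigcupT_measurable => // z; rewrite /F; case: ifP => // _.
  by rewrite /B; apply: measurableX; [apply: measurableX|];
    exact: (measurable_realfun.open_measurable (ball_open _ _)).
apply/seteqP; split=> [u Uu|u [z _]]; last first.
  by rewrite /F; case: asboolP => // sB /sB.
have [e /= e0 eU] : exists2 e : R, 0 < e & ball u e `<=` U.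
  by move: oU; rewrite openE => /(_ _ Uu) /nbhs_ballP[e e0 ?]; exists e.
have e20 : 0 < e / 2 by rewrite divr_gt0.
have [r] := rat_in_itvoo e20; rewrite in_itv/= => /andP[r0 re].
have Q (x : R) : exists q : rat, ball (ratr q : R) (ratr r) x.
  have /rat_in_itvoo[q] : x < x + ratr r by rewrite ltrDl.
  rewrite in_itv/= => /andP[xq qx]; exists q.
  by rewrite /ball/= ger0_norm ?subr_ge0 ?ltW// ltrBlDl.
have [[[q1 q1u] [q2 q2u]] [q3 q3u]] := (Q u.1.1, Q u.1.2, Q u.2).
exists (q1, q2, q3, r) => //; rewrite /F asboolT//= => v [[v1 v2] v3].
apply: eU; rewrite /B/= in v1 v2 v3.
have H (q x y : R) : ball q (ratr r) x -> ball q (ratr r) y -> ball x e y.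
  move=> qx qy; rewrite (splitr e); apply: (@ball_triangle _ _ q).
    by apply: le_ball (ltW re) _ _; exact: ball_sym.
  exact: le_ball (ltW re) _ qy.
by split; [split|]; [exact: H q1u v1|exact: H q2u v2|exact: H q3u v3].
Qed.

Lemma measurable_gSE2 : measurable_fun setT gSE2_tuple.
Proof.
apply: (measurability (@open (SE2 R))) => //.
move=> _ [U oU <-]; rewrite setTI; apply: open_measurable3.
by move/continuousP: continuous_gSE2; exact.
Qed.

Local Notation mR := (measurableTypeR R).

(* The normalized Haar measure (4 pi^2)^-1 dx dy dt, t in [0, 2 pi[, is the
   image under g(x, y, t) of the scaled Lebesgue measure on
   R x R x [0, 2 pi[. *)
Definition haar_domain : set (mR * mR * mR) := [set u | 0 <= u.2 < 2 * pi].

Lemma measurable_haar_domain : measurable haar_domain.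
Proof.
have -> : haar_domain = setT `*` `[0, 2 * pi[%classic.
  by apply/seteqP; split=> -[u t]; rewrite /haar_domain /= in_itv/=; tauto.
exact: measurableX.
Qed.

Lemma haar_scale_ge0 : 0 <= (4 * pi ^+ 2)^-1 :> R.
Proof. by rewrite invr_ge0 mulr_ge0// sqr_ge0. Qed.

Definition haar_box : {measure set (mR * mR * mR) -> \bar R} :=
  mscale (NngNum haar_scale_ge0)
    (mrestr ((lebesgue_measure \x lebesgue_measure) \x lebesgue_measure)%E
       measurable_haar_domain).

Definition haar_fun : set (SE2 R) -> \bar R :=
  pushforward haar_box (gSE2_tuple : mR * mR * mR -> SE2 R).

Lemma measurable_gSE2_mR :
  measurable_fun setT (gSE2_tuple : mR * mR * mR -> SE2 R).
Proof. exact: measurable_gSE2. Qed.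

HB.instance Definition _ := Measure.copy haar_fun
  (measure_function_pushforward__canonical__measure_function_Measure
     haar_box measurable_gSE2_mR).

Definition haar : {measure set (SE2 R) -> \bar R} := haar_fun.

End haar_measure.

Section complex_integration.
Variable R : realType.

Definition expi (t : R) : R[i] := cos t +i* sin t.

(* As with Rintegral, the value is meaningful when the real and imaginary parts
   are integrable; otherwise it is a default value. *)
Definition Cintegral d (T : measurableType d) (mu : {measure set T -> \bar R})
    (D : set T) (f : T -> R[i]) : R[i] :=
  (\int[mu]_(x in D) complex.Re (f x)) +i* (\int[mu]_(x in D) complex.Im (f x)).

Definition Cmeasurable d (T : measurableType d) (f : T -> R[i]) : Prop :=
  measurable_fun setT (fun x => complex.Re (f x)) /\
  measurable_fun setT (fun x => complex.Im (f x)).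

Definition in_L d (T : measurableType d) (mu : {measure set T -> \bar R}) (q : R)
    (f : T -> R[i]) : Prop :=
  Cmeasurable f /\ ('N[mu]_(q%:E)[EFin \o (@normc R) \o f] < +oo)%E.

(* Unconditional sum over an arbitrary index type: difference of the sums of
   the positive and negative parts, with a default value when it diverges. *)
Definition rsum (I : choiceType) (a : I -> R) : R :=
  fine (\esum_(i in [set: I]) (EFin \o a)^\+ i
        - \esum_(i in [set: I]) (EFin \o a)^\- i)%E.

Definition Csum (I : choiceType) (a : I -> R[i]) : R[i] :=
  rsum (fun i => complex.Re (a i)) +i* rsum (fun i => complex.Im (a i)).

Lemma expiD (s t : R) : expi (s + t) = expi s * expi t.
Proof.
rewrite /expi cosD sinD; apply/eqP; rewrite eq_complex /= eqxx /=.
by rewrite addrC [X in _ + X]mulrC [cos t * sin s]mulrC.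
Qed.
Lemma expi0 : expi 0 = 1 :> R[i].
Proof. by rewrite /expi cos0 sin0. Qed.
Lemma expiN (t : R) : expi (- t) = (expi t)^-1.
Proof. by apply/esym/mulr1_eq; rewrite -expiD subrr expi0. Qed.
Lemma expi_int (k : int) (t : R) : expi (k%:~R * t) = expi t ^ k.
Proof.
have H (n : nat) : expi (n%:R * t) = expi t ^+ n.
  elim: n => [|n IH]; first by rewrite mul0r expi0.
  by rewrite -natr1 mulrDl mul1r expiD IH exprSr.
case: k => n; first exact: H.
by rewrite NegzE mulrNz mulNr expiN -exprnN H.
Qed.
Lemma expi2pi (k : int) : expi (k%:~R * (2 * pi)) = 1 :> R[i].
Proof.
rewrite expi_int /expi mulr_natl cos2pi sin2pi.
by rewrite [_ +i* _](_ : _ = 1)// exp1rz.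
Qed.
End complex_integration.

Section fourier.
Variable R : realType.
Implicit Types (f : SE2 R -> R[i]) (p : R) (k n m : int).

Definition polar_rho (x y : R) : R := Num.sqrt (x ^+ 2 + y ^+ 2).

(* polar_phi 0 0 is some unspecified angle; elsewhere the angle is unique. *)
Definition polar_phi (x y : R) : R :=
  xget 0 [set t | [/\ 0 <= t < 2 * pi, x = polar_rho x y * cos t
                    & y = polar_rho x y * sin t]].

Definition S1_set : set 'cV[R]_2 := [set u | u^T *m u = 1%:M].
Definition S1 : Type := set_type S1_set.
Definition S1_vec (u : S1) : 'cV[R]_2 := \val u.

Lemma S1_rot_subproof (A : SO2 R) (u : S1) : S1_set (A *m S1_vec u).
Proof.
have uu : S1_set (S1_vec u) := set_mem (valP u).
have AA : A^T *m A = 1%:M by apply: mulmx1C; case: (SO2P A).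
by rewrite /S1_set /= trmx_mul mulmxA -(mulmxA _ A^T) AA mulmx1.
Qed.

Definition S1_rot (A : SO2 R) (u : S1) : S1 :=
  exist _ (A *m S1_vec u) (mem_set (S1_rot_subproof A u)).

Lemma S1_pt_subproof (a : R) : S1_set (vec2 (cos a) (sin a)).
Proof.
apply/matrixP => i j; rewrite !ord1 !mxE !big_ord_recl big_ord0 addr0 !mxE /=.
by rewrite -!expr2 cos2Dsin2.
Qed.

Definition S1_pt (a : R) : S1 := exist _ (vec2 (cos a) (sin a)) (mem_set (S1_pt_subproof a)).

Definition S1_dot (u v : S1 -> R[i]) : R[i] :=
  ((2 * pi)^-1)%:C * Cintegral (@lebesgue_measure R) `[0, 2 * pi]
    (fun a => u (S1_pt a) * (v (S1_pt a))^*).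

Definition S1_basis k (u : S1) : R[i] :=
  expi (k%:~R * polar_phi (S1_vec u 0 0) (S1_vec u 1 0)).

Lemma polar_phi_expi (a : R) : expi (polar_phi (cos a) (sin a)) = expi a.
Proof.
have pi2 : 0 < 2 * pi :> R by rewrite mulr_gt0// pi_gt0.
have r1 : polar_rho (cos a) (sin a) = 1 by rewrite /polar_rho cos2Dsin2 sqrtr1.
rewrite /polar_phi r1; case: xgetP => [t _ [_ ca sa]|].
  by rewrite /expi ca sa !mul1r.
pose k := Num.floor (a / (2 * pi)).
have ta : expi (a - k%:~R * (2 * pi)) = expi a by rewrite expiD expiN expi2pi invr1 mulr1.
move=> /(_ (a - k%:~R * (2 * pi))) []; split; last 2 first.
- by rewrite mul1r; case: ta.
- by rewrite mul1r; case: ta.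
have /andP[ka ak] := real_floor_itv (num_real (a / (2 * pi))).
apply/andP; split; first by rewrite subr_ge0 -ler_pdivlMr.
by rewrite ltrBlDr -[X in X + _]mul1r -mulrDl addrC -intrD1 -ltr_pdivrMr.
Qed.

Lemma S1_basisE k a : S1_basis k (S1_pt a) = expi (k%:~R * a) :> R[i].
Proof.
by rewrite /S1_basis expi_int /S1_vec /S1_pt /= !mxE /= polar_phi_expi -expi_int.
Qed.

Definition dotv (u v : 'cV[R]_2) : R := (u^T *m v) 0 0.

Definition U_rep p (g : SE2 R) (v : S1 -> R[i]) (u : S1) : R[i] :=
  expi (p * dotv (S1_vec u) g.1) * v (S1_rot (SO2_inv g.2) u).

(* Weak definition of the operator fhat(p): fourier_form f p u v is the inner
   product of fhat(p) u with v. *)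
Definition fourier_form f p (u v : S1 -> R[i]) : R[i] :=
  Cintegral (haar R) setT (fun g => f g * S1_dot (U_rep p (g^-1)%g u) v).

Definition fourier_coef f p n m : R[i] :=
  fourier_form f p (S1_basis n) (S1_basis m).

Definition fourier_coef_sup f n m : \bar R :=
  ereal_sup [set (normc (fourier_coef f p n m))%:E | p in [set p : R | 0 < p]].

Definition fourier_beta f m : \bar R :=
  (\esum_(n in [set: int]) fourier_coef_sup f n m)%E.

Definition admissible f : Prop :=
  in_L (haar R) 1 f /\
  (ereal_sup [set fourier_beta f m | m in [set: int]] < +oo)%E.

Definition SE2_angle (g : SE2 R) : R := polar_phi (g.2 0 0) (g.2 1 0).

Definition fourier_theta f n : R[i] :=
  Cintegral (haar R) setT (fun g => f g * expi (- (n%:~R * SE2_angle g))).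

End fourier.

Section quotient.
Variable R : realType.

Definition Z2_SE2 (c : int * int) : SE2 R := gSE2 c.1%:~R c.2%:~R 0.

(* The classes of this relation are the right cosets Z^2 g. *)
Definition Z2_rel (g h : SE2 R) : bool := `[< exists c, h = (Z2_SE2 c * g)%g >].

Lemma Z2_SE2D c d : Z2_SE2 (c.1 + d.1, c.2 + d.2) = (Z2_SE2 c * Z2_SE2 d)%g.
Proof.
rewrite /Z2_SE2 /gSE2; congr pair.
  apply/matrixP => i j; rewrite !mxE !big_ord_recl big_ord0 addr0 !mxE /=.
  rewrite cos0 sin0 oppr0 !intrD.
  by case: i => -[|[|//]] ?; rewrite /= !mul0r !mul1r ?addr0 ?add0r.
apply: SO2_inj; apply/matrixP => i j.
rewrite /SO2_mx /= !mxE !big_ord_recl big_ord0 addr0 !mxE /= cos0 sin0 oppr0.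
by case: i => -[|[|//]] ?; case: j => -[|[|//]] ?;
  rewrite /= ?(mul0r, mulr0, mul1r, addr0, add0r).
Qed.

Lemma Z2_SE20 : Z2_SE2 (0, 0) = 1%g.
Proof.
rewrite /Z2_SE2 /gSE2; congr pair.
  by apply/matrixP => i j; rewrite !mxE mulr0z; case: ifP.
apply: SO2_inj; apply/matrixP => i j; rewrite !mxE cos0 sin0 oppr0.
by case: i => -[|[|//]] ?; case: j => -[|[|//]] ?.
Qed.

Lemma Z2_rel_equiv : equiv_class_of Z2_rel.
Proof.
have sub g h : Z2_rel g h -> Z2_rel h g.
  move=> /asboolP[c ->]; apply/asboolP; exists (- c.1, - c.2).
  by rewrite mulgA -Z2_SE2D /= !addNr Z2_SE20 mul1g.
split=> [g|g h|h g k].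
- by apply/asboolP; exists (0, 0); rewrite Z2_SE20 mul1g.
- by apply/idP/idP => /sub.
- move=> /asboolP[c ->] /asboolP[d ->]; apply/asboolP.
  by exists (d.1 + c.1, d.2 + c.2); rewrite Z2_SE2D mulgA.
Qed.

Canonical Z2_equiv := EquivRelPack Z2_rel_equiv.
Canonical Z2_equiv_direct := defaultEncModRel Z2_rel.

Definition Z2SE2 : Type := quotient_topology {eq_quot Z2_rel}.

HB.instance Definition _ :=
  Topological.copy Z2SE2 (quotient_topology {eq_quot Z2_rel}).
HB.instance Definition _ :=
  Quotient.copy Z2SE2 (quotient_topology {eq_quot Z2_rel}).
HB.instance Definition _ := isPointed.Build Z2SE2 (\pi_Z2SE2 1%g).
(* measurable sets of the coset space are the Borel sets of the quotient topology *)
HB.instance Definition _ :=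
  Measurable.copy Z2SE2 (g_sigma_algebraType (@open Z2SE2)).

Definition coset (g : SE2 R) : Z2SE2 := \pi_Z2SE2 g.

Definition coset_mulr (h : SE2 R) (q : Z2SE2) : Z2SE2 := coset (repr q * h)%g.

(* The sum does not depend on the representative; for f in L^1 it converges
   absolutely for almost every coset, and takes a default value elsewhere. *)
Definition periodize (f : SE2 R -> R[i]) (q : Z2SE2) : R[i] :=
  Csum (fun c : int * int => f (Z2_SE2 c * repr q)%g).

(* A finite Borel measure that is inner regular on compact sets is Radon. *)
Record quotient_haar (mu : {measure set Z2SE2 -> \bar R}) : Prop := QuotientHaar {
  quotient_haar_finite : (mu setT < +oo)%E;
  quotient_haar_regular : forall B, measurable B ->
    mu B = ereal_sup [set mu K | K in [set K | compact K /\ K `<=` B]];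
  quotient_haar_invariant : forall h B, measurable B ->
    mu (coset_mulr h @^-1` B) = mu B;
  quotient_haar_weil : forall f, in_L (haar R) 1 f ->
    Cintegral mu setT (periodize f) = Cintegral (haar R) setT f }.

Definition coset_dot (mu : {measure set Z2SE2 -> \bar R}) (psi phi : Z2SE2 -> R[i]) :
  R[i] := Cintegral mu setT (fun q => psi q * (phi q)^*).

(* By left invariance of the Haar measure under Z^2, the value does not depend
   on the representative of q. *)
Definition coset_conv (psi : Z2SE2 -> R[i]) (f : SE2 R -> R[i]) (q : Z2SE2) : R[i] :=
  Cintegral (haar R) setT (fun h => psi (coset h) * f (h^-1 * repr q)%g).

Definition psi_ (k : int * int * int) (q : Z2SE2) : R[i] :=
  let g := repr q in
  (Num.sqrt (2 * pi))%:C
  * expi (2 * pi * (k.1.1%:~R * g.1 0 0 + k.1.2%:~R * g.1 1 0))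
  * expi (k.2%:~R * SE2_angle g).

Lemma psi_E k1 k2 k3 x y t : psi_ (k1, k2, k3) (coset (gSE2 x y t)) =
  (Num.sqrt (2 * pi))%:C * expi (2 * pi * (k1%:~R * x + k2%:~R * y))
  * expi (k3%:~R * t) :> R[i].
Proof.
have : Z2_rel (gSE2 x y t) (repr (coset (gSE2 x y t))).
  by apply/eqmodP; rewrite [RHS]reprK.
move=> /asboolP[[c1 c2]]; rewrite /psi_ /= => ->.
rewrite !mxE /= !big_ord_recl !big_ord0 !addr0 !mxE /= cos0 sin0 oppr0.
rewrite !mul1r !mul0r !addr0 !add0r; congr (_ * _ * _).
  rewrite (_ : 2 * pi * _ = (k1 * c1 + k2 * c2)%:~R * (2 * pi)
     + 2 * pi * (k1%:~R * x + k2%:~R * y)); last by rewrite intrD !intrM; ring.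
  by rewrite expiD expi2pi mul1r.
rewrite !expi_int /SE2_angle /= !mxE /= !big_ord_recl !big_ord0 !addr0 !mxE /=.
by rewrite cos0 sin0 oppr0 !mul1r !mul0r !addr0 !add0r polar_phi_expi.
Qed.
End quotient.

(* Main.v *)
(* Unfolding the coset space turns <periodize f1 (/) f2, psi_k> into the integral
   over SE(2) of (f1 * f2) times conjc psi_k, that is, by left invariance, into
   the integral over h of f1(h) times the integral over g of
   f2(g) conjc psi_k(h g). Since psi_k is a character in x and in theta, the inner
   integral is a phase times F2(phi - theta_h), where
     F_m(a) = int f(g) exp(i m theta) exp(- i p <u_a, x>) dg,  p = 2 pi rho,
   is a continuous function on the circle (case k1 = k2 = 0: F is not needed).
   The Fourier coefficients of F_m are the matrix coefficients fhat(p)_(n, m), so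
   that admissibility means that its Fourier series converges absolutely, hence to
   F_m everywhere. Expanding F2 and then the resulting F1_m(phi) gives the double
   series. *)
Require Import Defs.
From HB Require Import structures.
From mathcomp Require Import all_boot all_order all_algebra.
From mathcomp Require Import all_classical all_reals all_analysis.
From mathcomp Require Import complex ring lra measurable_realfun.
Set Implicit Arguments.
Unset Strict Implicit.
Unset Printing Implicit Defensive.
Import Order.TTheory GRing.Theory Num.Theory.
Import numFieldNormedType.Exports.
Local Open Scope classical_set_scope.
Local Open Scope ring_scope.
Local Open Scope complex_scope.

(** Two obstacles shape the proof. First, [mu] is known only through Weil's formula, and a coset
    comes with an arbitrary representative [repr]. Applied to indicator functions of parts of a
    single lattice cell, the formula shows that the Haar measure is the image of the counting
    measure times [mu] under translation of a measurable section; unfolding is then Fubini's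
    theorem. Since integrals take default values outside their domain, the convolution is unfolded
    at almost every coset only, where absolute convergence is available. Second, the Fourier series
    must equal F_m at one prescribed angle, so equality almost everywhere is not enough: both F_m
    and the sum of the series are bounded and continuous with the same coefficients, and testing the
    difference against powers of b + cos t shows that it vanishes. Sums over the lattice and over
    frequencies are integrals for the counting measure along an enumeration, so that Fubini's
    theorem and dominated convergence serve for series as well. For the double series, admissibility
    bounds the coefficients of f1 uniformly in m, while f2 enters with the single index -k3. *)

Local Notation Re := complex.Re.
Local Notation Im := complex.Im.

(** * Complex-valued integrals *)

Section complex_functions.
Context (R : realType).
Local Notation C := R[i].

Lemma ReM (z w : C) : Re (z * w) = Re z * Re w - Im z * Im w.
Proof. by case: z w => a b [c d]. Qed.

Lemma ImM (z w : C) : Im (z * w) = Re z * Im w + Im z * Re w.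
Proof. by case: z w => a b [c d]. Qed.

Lemma normc_ge0 (z : C) : 0 <= normc z.
Proof. by case: z => a b; rewrite /normc sqrtr_ge0. Qed.

Lemma normc_sqrt (z : C) : normc z = Num.sqrt (Re z ^+ 2 + Im z ^+ 2).
Proof. by case: z. Qed.

Lemma normc_conj (z : C) : normc (conjc z) = normc z.
Proof. by case: z => a b /=; rewrite sqrrN. Qed.

Lemma normc_expi (t : R) : normc (expi t) = 1.
Proof. by rewrite /expi /= cos2Dsin2 sqrtr1. Qed.

Lemma normc_real (x : R) : normc x%:C = `|x|.
Proof. by rewrite /= expr0n /= addr0 sqrtr_sqr. Qed.

Lemma Re_le_normc (z : C) : `|Re z| <= normc z.
Proof. by rewrite normc_sqrt -sqrtr_sqr ler_wsqrtr// lerDl sqr_ge0. Qed.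

Lemma Im_le_normc (z : C) : `|Im z| <= normc z.
Proof. by rewrite normc_sqrt -sqrtr_sqr ler_wsqrtr// lerDr sqr_ge0. Qed.

Lemma normc_le (z : C) : normc z <= `|Re z| + `|Im z|.
Proof.
rewrite normc_sqrt -[leRHS]ger0_norm ?addr_ge0// -sqrtr_sqr ler_wsqrtr//.
by rewrite sqrrD !real_normK ?num_real// addrAC lerDl mulrn_wge0// mulr_ge0.
Qed.

Lemma normc_add_le (z w : C) : normc (z + w) <= normc z + normc w.
Proof. exact: (@le_normcD R z w). Qed.

Lemma normc_sub_le (z w : C) : normc (z - w) <= normc z + normc w.
Proof. by rewrite -(normcN w); exact: normc_add_le. Qed.

Lemma conj_expi (t : R) : conjc (expi t) = expi (- t).
Proof. by rewrite /expi /= cosN sinN. Qed.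

Section measurable.
Context d (T : measurableType d).
Implicit Types f g : T -> C.

Lemma CmeasurableM f g : Cmeasurable f -> Cmeasurable g ->
  Cmeasurable (fun x => f x * g x).
Proof.
move=> [mf1 mf2] [mg1 mg2]; split.
- under eq_fun do rewrite ReM.
  by apply: measurable_funB; exact: measurable_funM.
- under eq_fun do rewrite ImM.
  by apply: measurable_funD; exact: measurable_funM.
Qed.

Lemma CmeasurableB f g : Cmeasurable f -> Cmeasurable g ->
  Cmeasurable (fun x => f x - g x).
Proof.
move=> [mf1 mf2] [mg1 mg2]; split.
- rewrite (_ : (fun x => _) = (fun x => Re (f x)) \- (fun x => Re (g x))).
    exact: measurable_funB.
  by apply/funext => x /=; case: (f x) (g x) => a b [].
- rewrite (_ : (fun x => _) = (fun x => Im (f x)) \- (fun x => Im (g x))).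
    exact: measurable_funB.
  by apply/funext => x /=; case: (f x) (g x) => a b [].
Qed.

Lemma Cmeasurable_cst (z : C) : Cmeasurable (fun _ : T => z).
Proof. by split; exact: measurable_cst. Qed.

Lemma measurable_normc f : Cmeasurable f -> measurable_fun setT (fun x => normc (f x)).
Proof.
move=> [mf1 mf2]; under eq_fun do rewrite normc_sqrt.
have ms : measurable_fun setT (Num.sqrt : R -> R).
  by apply: continuous_measurable_fun; exact: sqrt_continuous.
apply: (measurableT_comp ms).
by apply: measurable_funD; exact: measurable_funX.
Qed.

Lemma Cmeasurable_expi (h : T -> R) : measurable_fun setT h ->
  Cmeasurable (fun x => expi (h x)).
Proof.
move=> mh; split.
- apply: (measurableT_comp _ mh); apply: continuous_measurable_fun.
  exact: continuous_cos.
- apply: (measurableT_comp _ mh); apply: continuous_measurable_fun.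
  exact: continuous_sin.
Qed.

Lemma Cmeasurable_comp d' (T' : measurableType d') f (h : T' -> T) :
  Cmeasurable f -> measurable_fun setT h -> Cmeasurable (fun x => f (h x)).
Proof.
move=> [mf1 mf2] mh; split.
- exact: (measurableT_comp mf1 mh).
- exact: (measurableT_comp mf2 mh).
Qed.

End measurable.

Section integrable.
Context d (T : measurableType d) (mu : {measure set T -> \bar R}).
Implicit Types f g : T -> C.

Definition Cintegrable f : Prop :=
  mu.-integrable setT (fun x => (Re (f x))%:E) /\
  mu.-integrable setT (fun x => (Im (f x))%:E).

Lemma Cintegrable_measurable f : Cintegrable f -> Cmeasurable f.
Proof. by move=> [/measurable_int/measurable_EFinP ? /measurable_int/measurable_EFinP]. Qed.

(** Both directions come from |Re z|, |Im z| <= |z| <= |Re z| + |Im z|. *)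
Lemma CintegrableP f : Cintegrable f <->
  Cmeasurable f /\ (\int[mu]_x (normc (f x))%:E < +oo)%E.
Proof.
split=> [if_|[[mf1 mf2] foo]].
  split; first exact: Cintegrable_measurable.
  have mn := measurable_normc (Cintegrable_measurable if_).
  case: if_ => if1 if2.
  have : mu.-integrable setT (fun x => (`|Re (f x)| + `|Im (f x)|)%:E).
    apply: eq_integrable (integrableD _ (integrable_abse if1) (integrable_abse if2)) => //.
  move=> /integrableP[_]; apply: le_lt_trans.
  apply: ge0_le_integral => //=.
  - by move=> x _; rewrite lee_fin normc_ge0.
  - exact/measurable_EFinP.
  - apply/measurable_EFinP; apply: measurableT_comp => //; apply: measurable_funD;
      apply: measurableT_comp => //; apply/measurable_EFinP; [exact: measurable_int if1|exact: measurable_int if2].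
  - by move=> x _; rewrite lee_fin ger0_norm ?addr_ge0// normc_le.
have mn : measurable_fun setT (fun x => normc (f x)) by exact: measurable_normc.
split; apply/integrableP; split; try exact/measurable_EFinP;
  apply: le_lt_trans foo; apply: ge0_le_integral => //=;
  try (apply/measurable_EFinP => //; exact: measurableT_comp).
- by move=> x _; rewrite lee_fin Re_le_normc.
- by move=> x _; rewrite lee_fin Im_le_normc.
Qed.

Lemma CintegrableZ z f : Cintegrable f -> Cintegrable (fun x => z * f x).
Proof.
move=> [if1 if2]; split.
- apply: eq_integrable (integrableB _ (integrableZl _ (Re z) if1)
    (integrableZl _ (Im z) if2)) => //.
  by move=> x _ /=; rewrite ReM.
- apply: eq_integrable (integrableD _ (integrableZl _ (Re z) if2)
    (integrableZl _ (Im z) if1)) => //.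
  by move=> x _ /=; rewrite ImM.
Qed.

Lemma CintegrableD f g : Cintegrable f -> Cintegrable g ->
  Cintegrable (fun x => f x + g x).
Proof.
move=> [if1 if2] [ig1 ig2]; split.
- apply: eq_integrable (integrableD _ if1 ig1) => //.
  by move=> x _ /=; case: (f x) (g x) => a b [].
- apply: eq_integrable (integrableD _ if2 ig2) => //.
  by move=> x _ /=; case: (f x) (g x) => a b [].
Qed.

Lemma CintegralD f g : Cintegrable f -> Cintegrable g ->
  Cintegral mu setT (fun x => f x + g x) =
  Cintegral mu setT f + Cintegral mu setT g.
Proof.
move=> [if1 if2] [ig1 ig2]; apply/eqP; rewrite eq_complex /=; apply/andP; split; apply/eqP.
- rewrite -[RHS]RintegralD//.
  by apply: eq_Rintegral => x _; case: (f x) (g x) => a b [].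
- rewrite -[RHS]RintegralD//.
  by apply: eq_Rintegral => x _; case: (f x) (g x) => a b [].
Qed.

Lemma CintegralZ z f : Cintegrable f ->
  Cintegral mu setT (fun x => z * f x) = z * Cintegral mu setT f.
Proof.
move=> [if1 if2]; apply/eqP; rewrite eq_complex ReM ImM /=.
have iZ k h : mu.-integrable setT (fun x => (h x)%:E) ->
    mu.-integrable setT (EFin \o (fun x => k * h x)).
  by move=> ih; exact: (integrableZl measurableT k ih).
apply/andP; split; apply/eqP.
- rewrite -!RintegralZl// -RintegralB//; last 2 first.
  + exact: iZ.
  + exact: iZ.
  by apply: eq_Rintegral => x _; rewrite ReM.
- rewrite -!RintegralZl// -RintegralD//; last 2 first.
  + exact: iZ.
  + exact: iZ.
  by apply: eq_Rintegral => x _; rewrite ImM.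
Qed.

Lemma CintegralB f g : Cintegrable f -> Cintegrable g ->
  Cintegral mu setT (fun x => f x - g x) =
  Cintegral mu setT f - Cintegral mu setT g.
Proof.
move=> if_ ig; under eq_fun do rewrite -mulN1r.
by rewrite CintegralD ?CintegralZ ?mulN1r//; exact: CintegrableZ.
Qed.

(** The factor 2 comes from bounding the real and imaginary parts separately; it is harmless, as the
    lemma only serves to obtain uniform bounds. *)
Lemma Cintegral_norm_le f : Cintegrable f ->
  normc (Cintegral mu setT f) <= 2 * fine (\int[mu]_x (normc (f x))%:E).
Proof.
move=> if_; have /CintegrableP[mf foo] := if_; case: if_ => if1 if2.
have fin : (\int[mu]_x (normc (f x))%:E)%E \is a fin_num.
  by rewrite ge0_fin_numE// integral_ge0// => x _; rewrite lee_fin normc_ge0.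
have mn : measurable_fun setT (fun x => (normc (f x))%:E).
  by apply/measurable_EFinP; exact: measurable_normc.
apply: le_trans (normc_le _) _; rewrite mulr_natl mulr2n; apply: lerD.
- apply: le_trans (le_normr_Rintegral _ if1) _ => //.
  apply: fine_le => //; last first.
    apply: ge0_le_integral => //; [|by move=> x _; rewrite lee_fin Re_le_normc].
    by apply/measurable_EFinP; apply: measurableT_comp => //; case: mf.
  exact: (integrable_fin_num measurableT (integrable_norm if1)).
- apply: le_trans (le_normr_Rintegral _ if2) _ => //.
  apply: fine_le => //; last first.
    apply: ge0_le_integral => //; [|by move=> x _; rewrite lee_fin Im_le_normc].
    by apply/measurable_EFinP; apply: measurableT_comp => //; case: mf.
  exact: (integrable_fin_num measurableT (integrable_norm if2)).
Qed.

Lemma eq_Cintegral f g : f =1 g -> Cintegral mu setT f = Cintegral mu setT g.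
Proof. by move=> /funext ->. Qed.

Lemma ae_eq_Cintegral f g : Cmeasurable f -> Cmeasurable g ->
  {ae mu, forall x, f x = g x} -> Cintegral mu setT f = Cintegral mu setT g.
Proof.
move=> [mf1 mf2] [mg1 mg2] fg; rewrite /Cintegral /Rintegral.
by congr (fine _ +i* fine _); apply: ae_eq_integral => //;
  try exact/measurable_EFinP; apply: filterS fg => x /= ->.
Qed.

End integrable.

(** The nonnegative case is applied to the positive and negative parts, so that both sides agree
    even when f is not integrable. *)
Lemma integral_pushforwardT d1 d2 (X : measurableType d1) (Y : measurableType d2)
    (phi : X -> Y) (mu : {measure set X -> \bar R}) (f : Y -> \bar R) :
  measurable_fun setT phi -> measurable_fun setT f ->
  (\int[pushforward mu phi]_y f y = \int[mu]_x f (phi x))%E.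
Proof.
move=> mphi mf.
have H (g : Y -> \bar R) : measurable_fun setT g -> (forall y, 0 <= g y)%E ->
    (\int[pushforward mu phi]_y g y = \int[mu]_x g (phi x))%E.
  by move=> mg g0; rewrite ge0_integral_pushforward// preimage_setT.
rewrite (integralE (pushforward _ _)) (integralE mu).
rewrite (H _ (measurable_funepos mf))// (H _ (measurable_funeneg mf))//.
by congr (_ - _)%E; apply: eq_integral => x _; rewrite ?funeposE ?funenegE.
Qed.

Lemma Cintegral_pushforward d1 d2 (X : measurableType d1) (Y : measurableType d2)
    (phi : X -> Y) (mu : {measure set X -> \bar R}) (nu : {measure set Y -> \bar R})
    (f : Y -> C) :
  measurable_fun setT phi -> Cmeasurable f ->
  (forall A, measurable A -> nu A = mu (phi @^-1` A)) ->
  Cintegral nu setT f = Cintegral mu setT (fun x => f (phi x)).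
Proof.
move=> mphi [mf1 mf2] numu; rewrite /Cintegral /Rintegral.
rewrite !(@eq_measure_integral _ _ _ _ (pushforward mu phi) nu); last 2 first.
- by move=> A mA _; rewrite numu.
- by move=> A mA _; rewrite numu.
congr (fine _ +i* fine _).
- by apply: integral_pushforwardT => //; exact/measurable_EFinP.
- by apply: integral_pushforwardT => //; exact/measurable_EFinP.
Qed.

(** * Fubini's theorem for complex-valued functions *)

Section fubini.
Context d1 d2 (T1 : measurableType d1) (T2 : measurableType d2).
Variable m1 : {sigma_finite_measure set T1 -> \bar R}.
Variable m2 : {sigma_finite_measure set T2 -> \bar R}.
Implicit Types f : T1 * T2 -> C.

Lemma measurable_Rintegral1 (f : T1 * T2 -> R) : measurable_fun setT f ->
  measurable_fun setT (fun x => \int[m2]_y f (x, y)).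
Proof.
move=> /measurable_EFinP mf; apply: (measurableT_comp (fine_measurable _)) => //.
rewrite (_ : (fun x => _) = (fun x => (\int[m2]_y (EFin \o f)^\+ (x, y))) \-
    (fun x => (\int[m2]_y (EFin \o f)^\- (x, y))))%E; last first.
  apply/funext => x; rewrite integralE; congr (_ - _)%E;
    by apply: eq_integral => y _; rewrite ?funeposE ?funenegE.
apply: emeasurable_funB.
- apply: (measurable_fun_fubini_tonelli_F ((EFin \o f)^\+)%E) => //.
  exact: measurable_funepos.
- apply: (measurable_fun_fubini_tonelli_F ((EFin \o f)^\-)%E) => //.
  exact: measurable_funeneg.
Qed.

Lemma Cmeasurable_Cintegral f : Cmeasurable f ->
  Cmeasurable (fun x => Cintegral m2 setT (fun y => f (x, y))).
Proof.
by move=> [mf1 mf2]; split; [exact: measurable_Rintegral1 mf1|exact: measurable_Rintegral1 mf2].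
Qed.

Lemma Cintegrable12P f : Cmeasurable f ->
  Cintegrable (m1 \x m2)%E f <-> (\int[m1]_x \int[m2]_y (normc (f (x, y)))%:E < +oo)%E.
Proof.
move=> mf; rewrite CintegrableP.
have mn : measurable_fun setT (fun xy => (normc (f xy))%:E).
  by apply/measurable_EFinP; exact: measurable_normc.
rewrite (fubini_tonelli1 _ mn) => //; last by move=> x; rewrite lee_fin normc_ge0.
by split=> [[]|].
Qed.

Lemma Cintegrable21P f : Cmeasurable f ->
  Cintegrable (m1 \x m2)%E f <-> (\int[m2]_y \int[m1]_x (normc (f (x, y)))%:E < +oo)%E.
Proof.
move=> mf; rewrite CintegrableP.
have mn : measurable_fun setT (fun xy => (normc (f xy))%:E).
  by apply/measurable_EFinP; exact: measurable_normc.
rewrite (fubini_tonelli2 _ mn) => //; last by move=> x; rewrite lee_fin normc_ge0.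
by split=> [[]|].
Qed.

Lemma ae_Cintegrable2 f : Cintegrable (m1 \x m2)%E f ->
  {ae m2, forall y, Cintegrable m1 (fun x => f (x, y))}.
Proof.
move=> [/ae_integrable2 if1 /ae_integrable2 if2].
by apply: filterS2 if1 if2 => x; split.
Qed.

(** [fine] alters the inner integral only where it is infinite, which is a null set. *)
Let fine_int1 (f : T1 * T2 -> \bar R) : (m1 \x m2)%E.-integrable setT f ->
  (\int[m1]_x (fine (\int[m2]_y f (x, y)))%:E = \int[(m1 \x m2)%E]_z f z)%E.
Proof.
move=> if_; rewrite -integral12_prod_meas1//.
have iF := integrable_fubini_F if_.
apply: ae_eq_integral => //; [|exact: measurable_int iF|].
  apply/measurable_EFinP; apply: measurableT_comp; last exact: measurable_int iF.
  exact: fine_measurable.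
have := integrable_ae measurableT iF.
by apply: filterS => x /(_ Logic.I) fx _; rewrite fineK.
Qed.

Let fine_int2 (f : T1 * T2 -> \bar R) : (m1 \x m2)%E.-integrable setT f ->
  (\int[m2]_y (fine (\int[m1]_x f (x, y)))%:E = \int[(m1 \x m2)%E]_z f z)%E.
Proof.
move=> if_; rewrite -integral21_prod_meas1//.
have mf := measurable_int _ if_.
(* The coordinates are swapped because [integrable_fubini_F] concerns the integral over the second
   one. *)
have msw : measurable_fun setT (fun yx : T2 * T1 => f (yx.2, yx.1)).
  by apply: (measurableT_comp mf); exact: measurable_fun_pair.
have isw : (m2 \x m1)%E.-integrable setT (fun yx => f (yx.2, yx.1)).
  by apply/(integrable12ltyP _ _ msw); exact/(integrable21ltyP _ _ mf).
have iF := integrable_fubini_F isw.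
apply: ae_eq_integral => //; [|exact: measurable_int iF|].
  apply/measurable_EFinP; apply: measurableT_comp; last exact: measurable_int iF.
  exact: fine_measurable.
have := integrable_ae measurableT iF.
by apply: filterS => x /(_ Logic.I) fx _; rewrite fineK.
Qed.

Lemma Cintegral12 f : Cintegrable (m1 \x m2)%E f ->
  Cintegral m1 setT (fun x => Cintegral m2 setT (fun y => f (x, y))) =
  Cintegral (m1 \x m2)%E setT f.
Proof.
move=> [if1 if2]; rewrite /Cintegral /Rintegral /=.
by rewrite (fine_int1 if1) (fine_int1 if2).
Qed.

Lemma Cintegral21 f : Cintegrable (m1 \x m2)%E f ->
  Cintegral m2 setT (fun y => Cintegral m1 setT (fun x => f (x, y))) =
  Cintegral (m1 \x m2)%E setT f.
Proof.
move=> [if1 if2]; rewrite /Cintegral /Rintegral /=.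
by rewrite (fine_int2 if1) (fine_int2 if2).
Qed.

Lemma CFubini f : Cintegrable (m1 \x m2)%E f ->
  Cintegral m1 setT (fun x => Cintegral m2 setT (fun y => f (x, y))) =
  Cintegral m2 setT (fun y => Cintegral m1 setT (fun x => f (x, y))).
Proof. by move=> if_; rewrite Cintegral12// Cintegral21. Qed.

End fubini.

(** Serves where one term survives: in orthogonality relations, and in the periodization of a set
    inside one lattice cell. *)
Lemma rsum_single (I : choiceType) (k : I) (a : I -> R) :
  (forall i, i != k -> a i = 0) -> rsum a = a k.
Proof.
move=> ak; have H (b : I -> \bar R) : (forall i, 0 <= b i)%E ->
    (forall i, i != k -> b i = 0%E) -> (\esum_(i in [set: I]) b i = b k)%E.
  move=> b0 bk; rewrite -(esum_set1 (b0 k)) esum_mkcond [RHS]esum_mkcond.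
  by apply: eq_esum => i _; rewrite in_setT !in_set1; case: eqVneq => // /bk.
rewrite /rsum !H//.
- by have /(congr1 (fun h => fine (h k)))/= := funeposneg (EFin \o a).
- by move=> i /ak /= ai; rewrite funenegE /= ai oppr0 maxxx.
- by move=> i /ak /= ai; rewrite funeposE /= ai maxxx.
Qed.

Lemma Csum_single (I : choiceType) (k : I) (a : I -> C) :
  (forall i, i != k -> a i = 0) -> Csum a = a k.
Proof.
move=> ak; rewrite /Csum !(@rsum_single _ k)//; last 2 first.
- by move=> i /ak ->.
- by move=> i /ak ->.
by case: (a k).
Qed.

Lemma Cintegrable_bounded d (T : measurableType d)
    (mu : {finite_measure set T -> \bar R}) (f : T -> C) (M : R) :
  Cmeasurable f -> (forall x, normc (f x) <= M) -> Cintegrable mu f.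
Proof.
move=> mf fM; apply/CintegrableP; split => //.
apply: (@le_lt_trans _ _ (\int[mu]_x M%:E)%E).
  apply: ge0_le_integral => //.
  - by move=> x _; rewrite lee_fin normc_ge0.
  - by apply/measurable_EFinP; exact: measurable_normc.
  - by move=> x _; rewrite lee_fin.
rewrite integral_cst//.
by rewrite ltey_eq fin_numM// fin_num_measure.
Qed.

Section countable_sums.
Context (I : choiceType) (e : nat -> I) (be : bijective e).

(** Once sums are integrals for the counting measure, exchanging them with integrals is an instance
    of Fubini's theorem. *)
Lemma esum_counting (a : I -> \bar R) : (forall i, 0 <= a i)%E ->
  (\esum_(i in [set: I]) a i = \int[counting]_n a (e n))%E.
Proof.
move=> a0; rewrite ge0_integral_count; last by move=> k; exact: a0.
rewrite nneseries_esumT//; apply: reindex_esum => //.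
by split=> [//|i j _ _ /(bij_inj be)//|i _]; case: be => g _ ge; exists (g i).
Qed.

(* Both sides have the same default value when the series diverges, so that no
   summability is assumed. *)
Lemma Csum_counting (a : I -> C) :
  Csum a = Cintegral (@counting _ R) setT (fun n => a (e n)).
Proof.
rewrite /Csum /Cintegral /Rintegral /rsum !esum_counting//.
rewrite (integralE _ _ (fun n => (Re (a (e n)))%:E)).
rewrite (integralE _ _ (fun n => (Im (a (e n)))%:E)).
by congr (fine (_ - _)%E +i* fine (_ - _)%E); apply: eq_integral => n _;
  rewrite ?funeposE ?funenegE.
Qed.

End countable_sums.

End complex_functions.

(** * Lebesgue measure on the circle *)

Section restriction.
Context d (T : measurableType d) (R : realType).
Variables (mu : {measure set T -> \bar R}) (D : set T) (mD : measurable D).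

(** The space is cut into D, where both measures agree, and its complement, where the restricted
    measure is zero. *)
Lemma ge0_integral_mrestr (f : T -> \bar R) : measurable_fun setT f ->
  (forall x, 0 <= f x)%E ->
  (\int[mrestr mu mD]_x f x = \int[mu]_(x in D) f x)%E.
Proof.
move=> mf f0.
rewrite -[in LHS](setvU D) ge0_integral_setU//; last 3 first.
- exact: measurableC.
- by rewrite setvU.
- by apply/disj_setPLR.
rewrite [X in (X + _)%E](_ : _ = 0%E) ?add0e; last first.
  rewrite (@eq_measure_integral _ _ _ _ mzero) ?integral_measure_zero// => A mA AD.
  transitivity (mu (A `&` D)); first by [].
  by rewrite (_ : A `&` D = set0) ?measure0//; apply/disj_set2P/disj_setPLR.
apply: eq_measure_integral => A mA AD.
by transitivity (mu (A `&` D)); [|rewrite setIidl].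
Qed.

End restriction.

Section lebesgue_translation.
Context (R : realType).
Local Notation leb := (@lebesgue_measure R).
Local Notation mR := (measurableTypeR R).

Lemma measurable_translation (a : R) : measurable_fun setT (fun x : mR => x + a : mR).
Proof. by apply: measurable_funD => //; exact: measurable_cst. Qed.

(** The translated measure gives half-open intervals their length, which characterizes the Lebesgue
    measure. *)
Lemma lebesgue_measure_translation (a : R) (A : set mR) : measurable A ->
  leb ((fun x => x + a) @^-1` A) = leb A.
Proof.
move=> mA.
have -> : leb ((fun x => x + a) @^-1` A) =
    pushforward leb ((fun x => x + a : mR) : mR -> mR) A by [].
apply/esym/lebesgue_measure_unique => //=.
  exact: measurable_translation.
move=> _ _ [[x y]] _ <-.
rewrite /pushforward (_ : _ @^-1` _ = `]x - a, y - a]%classic); last first.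
  by apply/seteqP; split=> t /=; rewrite !in_itv/= ltrBlDr lerBrDr.
rewrite !lebesgue_measure_itv/= !lte_fin ltrD2r.
by case: ifP => // _; rewrite -!EFinB opprB addrA subrK.
Qed.

Lemma ge0_integral_translation (a : R) (D : set mR) (f : mR -> \bar R) :
  measurable D -> measurable_fun setT f -> (forall x, 0 <= f x)%E ->
  (\int[leb]_(x in D) f x = \int[leb]_(x in (fun x => (x + a)%R) @^-1` D) f (x + a)%R)%E.
Proof.
move=> mD mf f0.
have mt := measurable_translation a.
have := @ge0_integral_pushforward _ _ _ _ _ _ mt leb D f mD (measurable_funTS mf) (fun x _ => f0 x).
move=> <-; apply: eq_measure_integral => A mA _.
by apply/esym; exact: lebesgue_measure_translation.
Qed.

End lebesgue_translation.

Section arc_measure.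
Context (R : realType).
Local Notation leb := (@lebesgue_measure R).
Local Notation mR := (measurableTypeR R).

Lemma measurable_arc : measurable (`[0, 2 * pi[%classic : set mR).
Proof. exact: measurable_itv. Qed.

(** The circle, as one half-open period. Restricting the measure and not the domain yields integrals
    over [setT], the form in which Fubini's theorem is stated above. *)
Definition arc_measure : set mR -> \bar R := mrestr leb measurable_arc.

HB.instance Definition _ := Measure.on arc_measure.

Lemma pi2_gt0 : 0 < 2 * pi :> R.
Proof. by rewrite mulr_gt0// pi_gt0. Qed.

Lemma arcT : arc_measure setT = (2 * pi)%:E.
Proof.
rewrite /arc_measure /mrestr setTI lebesgue_measure_itv/= lte_fin pi2_gt0.
by rewrite -EFinB subr0.
Qed.

Let arc_fin : fin_num_fun arc_measure.
Proof.
apply: lty_fin_num_fun; rewrite [X in (X < _)%E](_ : _ = (2 * pi)%:E) ?ltry//.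
exact: arcT.
Qed.

HB.instance Definition _ := Measure_isFinite.Build _ _ _ arc_measure arc_fin.

Lemma ge0_integral_arc (f : mR -> \bar R) : measurable_fun setT f ->
  (forall x, 0 <= f x)%E -> (\int[arc_measure]_x f x = \int[leb]_(x in `[0%R, (2 * pi)%R[) f x)%E.
Proof. by move=> mf f0; rewrite ge0_integral_mrestr. Qed.

(** Periodicity first replaces a by its residue r modulo 2 pi; the integral then runs over the
    period that starts at r. *)
Lemma ge0_integral_arc_shift (a : R) (f : mR -> \bar R) : measurable_fun setT f ->
  (forall x, 0 <= f x)%E -> (forall x, f (x + 2 * pi)%R = f x) ->
  (\int[arc_measure]_x f (x + a)%R = \int[arc_measure]_x f x)%E.
Proof.
move=> mf f0 fp.
have fpZ (k : int) x : f (x + k%:~R * (2 * pi)) = f x.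
  have fpn (n : nat) y : f (y + n%:R * (2 * pi)) = f y.
    elim: n => [|n IH]; first by rewrite mul0r addr0.
    by rewrite -natr1 mulrDl mul1r addrA fp.
  case: k => n; first exact: fpn.
  by rewrite -(fpn n.+1) NegzE mulrNz mulNr subrK.
have mfa b : measurable_fun setT (fun x : mR => f (x + b)).
  by apply: (measurableT_comp mf); exact: measurable_translation.
pose k := Num.floor (a / (2 * pi)).
pose r := a - k%:~R * (2 * pi).
have rE x : f (x + a) = f (x + r) by rewrite -(fpZ k (x + r)) -addrA subrK.
have /andP[ka ak] := real_floor_itv (num_real (a / (2 * pi))).
have r0 : 0 <= r by rewrite subr_ge0 -ler_pdivlMr// pi2_gt0.
have r2 : r <= 2 * pi.
  by rewrite ltW// ltrBlDr -[X in X + _]mul1r -mulrDl addrC -intrD1 -ltr_pdivrMr// pi2_gt0.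
under eq_integral do rewrite rE.
rewrite !ge0_integral_arc//.
have -> : (\int[leb]_(x in `[0%R, (2 * pi)%R[) f (x + r)%R =
    \int[leb]_(x in `[r, (r + 2 * pi)%R[) f x)%E.
  rewrite [RHS](ge0_integral_translation r)//.
  congr (integral _ _ _); apply/seteqP; split=> x /=; rewrite !in_itv/=;
    by rewrite lerDr [r + _]addrC ltrD2r.
(* The two periods share [r, 2 pi[; what remains of one is what remains of the other moved by 2
   pi. *)
have i1 : `[r, (r + 2 * pi)%R[%classic = `[r, (2 * pi)%R[ `|` `[(2 * pi)%R, (r + 2 * pi)%R[ :> set R.
  apply/seteqP; split=> x /=; rewrite !in_itv/=.
    by move=> /andP[rx ->]; rewrite rx andbT/=; case: ltP => _; [left|right].
  move=> [/andP[-> xp]|/andP[px ->]]/=; first by rewrite (lt_le_trans xp)// lerDr.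
  by rewrite andbT (le_trans r2).
have i2 : `[0%R, (2 * pi)%R[%classic = `[r, (2 * pi)%R[ `|` `[0%R, r[ :> set R.
  apply/seteqP; split=> x /=; rewrite !in_itv/=.
    by move=> /andP[rx ->]; rewrite rx andbT/=; case: ltP => _; [right|left].
  move=> [/andP[rx ->]|/andP[-> xr]]/=; first by rewrite andbT (le_trans r0).
  exact: lt_le_trans xr r2.
rewrite i1 i2 !ge0_integral_setU//=; last first.
- by apply/disj_setPS => x /= []; rewrite !in_itv/= => /andP[_ h1] /andP[h2 _]; move: (lt_le_trans h1 h2); rewrite ltxx.
- by apply: measurable_funTS.
- by apply/disj_setPS => x /= []; rewrite !in_itv/= => /andP[h1 _] /andP[_ h2]; move: (lt_le_trans h2 h1); rewrite ltxx.
- by apply: measurable_funTS.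
congr (_ + _)%E; rewrite (ge0_integral_translation (2 * pi))//.
transitivity (\int[leb]_(x in `[0%R, r[) f (x + 2 * pi)%R)%E.
  congr (integral _ _ _); apply/seteqP; split=> x /=; rewrite !in_itv/=;
    by rewrite lerDr ltrD2r.
by apply: eq_integral => x _.
Qed.

End arc_measure.

HB.instance Definition _ (R : realType) :=
  @Measure_isSigmaFinite.Build _ nat R (@counting nat R) (sigma_finite_counting R).

Lemma countably_infinite_bijective (I : Type) :
  countable [set: I] -> infinite_set [set: I] -> exists e : nat -> I, bijective e.
Proof.
move=> cI iI; have /card_set_bijP[f] := eq_card_nat cI iI.
by rewrite setTT_bijective => -[g fg gf]; exists g, f.
Qed.

Lemma int_enum : exists e : nat -> int, bijective e.
Proof.
apply: countably_infinite_bijective; first exact: countableP.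
move=> /(finite_image (fun z : int => `|z|%N)).
rewrite (_ : _ @` _ = setT); first exact: infinite_nat.
by apply/seteqP; split=> // n _; exists (Posz n).
Qed.

Lemma int2_enum : exists e : nat -> int * int, bijective e.
Proof.
apply: countably_infinite_bijective; first exact: countableP.
move=> /(finite_image (fun z : int * int => `|z.1|%N)).
rewrite (_ : _ @` _ = setT); first exact: infinite_nat.
by apply/seteqP; split=> // n _; exists (Posz n, 0).
Qed.

(** * Absolutely convergent Fourier series *)

Section fourier_series.
Context (R : realType).
Local Notation C := R[i].
Local Notation mR := (measurableTypeR R).
Local Notation arc := (@arc_measure R).

Lemma expi_cos (t : R) : (cos t)%:C = (2^-1)%:C * (expi t + expi (- t)).
Proof.
by apply/eqP; rewrite eq_complex ReM ImM /expi /= cosN sinN;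
  apply/andP; split; apply/eqP; field.
Qed.

Lemma Cintegral_arc_shift (a : R) (f : mR -> C) : Cmeasurable f ->
  (forall x, f (x + 2 * pi) = f x) ->
  Cintegral arc setT (fun x => f (x + a)) = Cintegral arc setT f.
Proof.
move=> [mf1 mf2] fp.
have H (g : mR -> R) : measurable_fun setT g -> (forall x, g (x + 2 * pi) = g x) ->
    \int[arc]_x g (x + a) = \int[arc]_x g x.
  move=> mg gp; congr fine; rewrite integralE [RHS]integralE.
  have mg' : measurable_fun setT (EFin \o g) by exact/measurable_EFinP.
  rewrite -(ge0_integral_arc_shift a (measurable_funepos mg'))//; last first.
    by move=> x; rewrite !funeposE /= gp.
  rewrite -(ge0_integral_arc_shift a (measurable_funeneg mg'))//; last first.
    by move=> x; rewrite !funenegE /= gp.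
  by congr (_ - _)%E; apply: eq_integral => x _; rewrite ?funeposE ?funenegE.
by rewrite /Cintegral; congr (_ +i* _); apply: H => // x; rewrite fp.
Qed.

Lemma expi_period (j : int) (t : R) : expi (j%:~R * (t + 2 * pi)) = expi (j%:~R * t).
Proof. by rewrite mulrDr expiD expi2pi mulr1. Qed.

Lemma Cintegral_arc_cst (z : C) : Cintegral arc setT (fun=> z) = (2 * pi)%:C * z.
Proof.
rewrite /Cintegral !Rintegral_cst//.
have -> : fine ((arc : set mR -> \bar R) setT) = 2 * pi by rewrite arcT.
by case: z => a b /=; apply/eqP; rewrite eq_complex /= !mul0r addr0 subr0 ![_ * (2 * pi)]mulrC !eqxx.
Qed.

Lemma Cmeasurable_expiM (j : R) : Cmeasurable (fun t : mR => expi (j * t)).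
Proof. by apply: Cmeasurable_expi; exact: mulrl_measurable. Qed.

(** For j nonzero, a shift by pi / j preserves the integral and changes the sign of the integrand,
    so that the integral equals its opposite. *)
Lemma Cintegral_arc_expi (j : int) :
  Cintegral arc setT (fun t => expi (j%:~R * t)) = if j == 0 then (2 * pi)%:C else 0.
Proof.
case: eqVneq => [->|j0].
  rewrite (_ : (fun t => _) = fun=> 1) ?Cintegral_arc_cst ?mulr1//.
  by apply/funext => t; rewrite mul0r expi0.
have mj := Cmeasurable_expiM j%:~R.
have := Cintegral_arc_shift (pi / j%:~R) mj (expi_period j).
rewrite (_ : (fun t => expi _) = fun t => -1 * expi (j%:~R * t)); last first.
  apply/funext => t; rewrite mulrDr expiD mulrC; congr (_ * _).
  rewrite mulrCA divff ?intr_eq0// mulr1 /expi cospi sinpi.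
  by apply/eqP; rewrite eq_complex /= oppr0 !eqxx.
rewrite CintegralZ; last first.
  by apply: (@Cintegrable_bounded _ _ _ _ _ 1) => // x; rewrite normc_expi.
set I := Cintegral _ _ _ => /eqP; rewrite mulN1r -subr_eq0 -opprD oppr_eq0 -mulr2n.
by rewrite mulrn_eq0/= => /eqP.
Qed.

Definition Ccontinuous (D : R -> C) : Prop :=
  continuous (fun t => Re (D t)) /\ continuous (fun t => Im (D t)).

Lemma Ccontinuous_measurable (D : mR -> C) : Ccontinuous D -> Cmeasurable D.
Proof. by move=> [c1 c2]; split; exact: continuous_measurable_fun. Qed.

(* If D 0 were nonzero, the powers of a trigonometric polynomial exceeding 1 near 0
   only, multiplied by Re (conjc (D 0) * D), would have unbounded integrals. *)
Section trigonometric_uniqueness.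
Variables (D : mR -> C) (M : R).
Hypotheses (cD : Ccontinuous D) (DM : forall t, normc (D t) <= M)
  (Dp : forall t, D (t + 2 * pi) = D t)
  (D0 : forall j : int, Cintegral arc setT (fun t => D t * expi (j%:~R * t)) = 0).

Let normcM (z w : C) : normc (z * w) = normc z * normc w := ComplexField.Normc.normcM z w.

Let M0 : 0 <= M. Proof. exact: le_trans (normc_ge0 _) (DM 0). Qed.

Let mcos : measurable_fun setT (cos : mR -> R).
Proof. by apply: continuous_measurable_fun; exact: continuous_cos. Qed.

Let mK (b : R) N : measurable_fun setT (fun t : mR => (b + cos t) ^+ N : R).
Proof.
by apply: measurable_funX; apply: measurable_funD => //; exact: measurable_cst.
Qed.

Let Cmeasurable_real (h : mR -> R) : measurable_fun setT h -> Cmeasurable (fun t => (h t)%:C).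
Proof. by move=> mh; split => //; exact: measurable_cst. Qed.

Let iDK (b : R) N (j : int) :
  Cintegrable arc (fun t => D t * ((b + cos t) ^+ N)%:C * expi (j%:~R * t)).
Proof.
apply: (@Cintegrable_bounded _ _ _ _ _ (M * (`|b| + 1) ^+ N)) => [|t].
  apply: CmeasurableM; last exact: Cmeasurable_expiM.
  apply: CmeasurableM; first exact: Ccontinuous_measurable.
  exact: Cmeasurable_real.
rewrite !normcM normc_expi mulr1 normc_real ler_pM ?normc_ge0// normrX.
by rewrite lerXn2r ?nnegrE ?addr_ge0//; apply: le_trans (ler_normD _ _) _; rewrite lerD2l cos_max.
Qed.

(* The kernel (b + cos t)^N is a trigonometric polynomial. *)
Let DK0 (b : R) N (j : int) :
  Cintegral arc setT (fun t => D t * ((b + cos t) ^+ N)%:C * expi (j%:~R * t)) = 0.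
Proof.
(* The induction is over all frequencies at once, since a factor cos t moves j to j + 1 and j -
   1. *)
elim: N j => [|N IH] j.
  by rewrite -[RHS](D0 j); apply: eq_Cintegral => t; rewrite expr0 mulr1.
rewrite (_ : (fun t => _) = fun t =>
   b%:C * (D t * ((b + cos t) ^+ N)%:C * expi (j%:~R * t)) +
   ((2^-1)%:C * (D t * ((b + cos t) ^+ N)%:C * expi ((j + 1)%:~R * t)) +
    (2^-1)%:C * (D t * ((b + cos t) ^+ N)%:C * expi ((j - 1)%:~R * t)))); last first.
  apply/funext => t; rewrite exprSr rmorphM rmorphD /= expi_cos.
  rewrite !intrD mulrN1z !mulrDl mul1r mulN1r !expiD.
  ring.
rewrite !CintegralD ?CintegralZ ?IH ?mulr0 ?addr0//; try exact: iDK;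
  try exact: CintegrableZ.
by apply: CintegrableD; exact: CintegrableZ.
Qed.

Lemma trigonometric_uniqueness_at0 : D 0 = 0.
Proof.
apply/eqP/negPn/negP => D0n0.
pose z := conjc (D 0).
(* With this z, [H 0] is the square of the modulus of [D 0]. *)
pose H t := Re (z * D t).
have H0 : 0 < H 0.
  rewrite /H /z; case: (D 0) D0n0 => a b; rewrite eq_complex negb_and /= => /orP ab.
  by rewrite mulNr opprK -!expr2; case: ab => ?; [apply: ltr_wpDr|apply: ltr_wpDl];
    rewrite ?sqr_ge0// exprn_even_gt0.
have cH : continuous H.
  move=> t; rewrite /H; under eq_fun do rewrite ReM.
  by apply: cvgB; apply: cvgM; (try exact: cvg_cst); [exact: cD.1|exact: cD.2].
have Hp t : H (t + 2 * pi) = H t by rewrite /H Dp.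
pose ep := H 0 / 2.
have ep0 : 0 < ep by rewrite divr_gt0.
have [dl dl0 Hdl] : exists2 dl : R, 0 < dl & forall t, `|t| < dl -> ep <= H t.
  have /cvgrPdist_lt/(_ _ ep0) := cH 0.
  move=> /nbhs_ballP[d /= d0 dH]; exists d => // t td.
  have := dH t; rewrite /ball /= sub0r normrN => /(_ td); rewrite ltr_norml => /andP[_].
  by rewrite ltrBlDr -ltrBlDl => h; rewrite ltW// (le_lt_trans _ h)// /ep; lra.
(* The bound by [dl] keeps H above [ep] near 0; the bound by 1/2 stays in [0, pi], where cos is
   decreasing. *)
pose d := Num.min (dl / 2) (1 / 2).
have d0 : 0 < d by rewrite lt_min !divr_gt0/=.
have d1 : d <= 1 / 2 by rewrite ge_min lexx orbT.
have ddl : d < dl by rewrite gt_min; apply/orP; left; rewrite gtr_pMr ?invf_lt1 ?ltr1n.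
have pi1 := pihalf_ge1 R.
have pi0 := pi_gt0 R.
(* With this b, the kernel base b + cos t exceeds 1 exactly where cos t > cos d, and elsewhere lies
   in [-1, 1]. The value r at d / 2 is a lower bound of the base on the set [A] below. *)
pose b := 1 - cos d.
pose r := b + cos (d / 2).
have r1 : 1 < r.
  by rewrite /r /b -addrA ltrDl addrC subr_gt0 ltr_cos ?in_itv/=; lra.
have cosdd : cos d < cos (d / 2) by rewrite ltr_cos ?in_itv/=; lra.
(* After reduction of t to s in [0, 2 pi[, the condition says that s or 2 pi - s is less than d. *)
have Hep t : cos d < cos t -> ep <= H t.
  pose k := Num.floor (t / (2 * pi)).
  pose s := t - k%:~R * (2 * pi).
  have HpZ (f : R -> R) (m : int) x : (forall t, f (t + 2 * pi) = f t) ->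
      f (x + m%:~R * (2 * pi)) = f x.
    move=> fp; have fpn (n : nat) y : f (y + n%:R * (2 * pi)) = f y.
      elim: n => [|n IH]; first by rewrite mul0r addr0.
      by rewrite -natr1 mulrDl mul1r addrA fp.
    case: m => n; first exact: fpn.
    by rewrite -(fpn n.+1) NegzE mulrNz mulNr subrK.
  have cosp u : cos (u + 2 * pi) = cos u :> R by rewrite mulr_natl cosD2pi.
  have -> : t = s + k%:~R * (2 * pi) by rewrite subrK.
  rewrite !HpZ//.
  have /andP[ka ak] := real_floor_itv (num_real (t / (2 * pi))).
  have s0 : 0 <= s by rewrite subr_ge0 -ler_pdivlMr// pi2_gt0.
  have s2 : s < 2 * pi.
    by rewrite ltrBlDr -[X in X + _]mul1r -mulrDl addrC -intrD1 -ltr_pdivrMr// pi2_gt0.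
  have [spi|spi] := leP s pi.
    rewrite ltr_cos ?in_itv/=; [|lra..].
    by move=> sd; apply: Hdl; rewrite ger0_norm// (lt_trans sd).
  rewrite -(cosN s) -(cosp (- s)) ltr_cos ?in_itv/=; [|lra..].
  move=> sd; rewrite -[s](subrK (2 * pi)) Hp; apply: Hdl.
  by rewrite ler0_norm; [rewrite opprB|]; lra.
pose A : set mR := [set t | cos (d / 2) <= cos t].
have mA : measurable A.
  rewrite (_ : A = setT `&` cos @^-1` `[cos (d / 2), +oo[%classic); last first.
    by rewrite setTI; apply/seteqP; split=> t; rewrite /A /= in_itv/= andbT.
  by apply: mcos => //; exact: measurable_itv.
(* Three regions: on [A] the kernel is at least r^N and H at least [ep]; where cos t > cos d outside
   [A], the right-hand side is nonnegative; elsewhere the kernel is at most 1 and H at most M^2 in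
   absolute value. *)
have key N t : ep * r ^+ N * \1_A t - M ^+ 2 <= H t * (b + cos t) ^+ N.
  have [ct|ct] := ltP (cos d) (cos t).
    have K1 : 1 <= b + cos t by rewrite /b; lra.
    have KN0 : 0 <= (b + cos t) ^+ N by rewrite exprn_ge0//; lra.
    apply: (@le_trans _ _ (ep * (b + cos t) ^+ N)); last by rewrite ler_wpM2r// Hep.
    rewrite indicE; case: (boolP (t \in A)) => [|_]; last first.
      by rewrite mulr0 sub0r (@le_trans _ _ 0) ?oppr_le0 ?sqr_ge0// mulr_ge0// ltW.
    rewrite inE /A /= => cd; rewrite mulr1 lerBlDr.
    rewrite (@le_trans _ _ (ep * (b + cos t) ^+ N))// ?lerDl ?sqr_ge0//.
    have rE : r = b + cos (d / 2) by [].
    by rewrite ler_wpM2l ?(ltW ep0)// lerXn2r ?nnegrE; lra.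
  rewrite indicE memNset ?mulr0 ?sub0r; last first.
    by rewrite /A /= => cd; move: (le_trans cd ct); rewrite leNgt cosdd.
  have KN1 : `|b + cos t| ^+ N <= 1.
    have ct1 := cos_geN1 t; have cd1 := cos_le1 d.
    apply: exprn_ile1 => //; rewrite ler_norml /b; lra.
  have : `|H t * (b + cos t) ^+ N| <= M ^+ 2.
    rewrite normrM normrX -[leRHS]mulr1 ler_pM//.
    rewrite (le_trans (Re_le_normc _))// normcM expr2 ler_pM ?normc_ge0//.
    by rewrite /z normc_conj.
  by rewrite ler_norml => /andP[].
have intH N : \int[arc]_t (H t * (b + cos t) ^+ N) = 0.
  have := DK0 b N 0; rewrite (_ : (fun t => _) = fun t => D t * ((b + cos t) ^+ N)%:C); last first.
    by apply/funext => t; rewrite mul0r expi0 mulr1.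
  have iD := iDK b N 0; rewrite (_ : (fun t => _) = fun t => D t * ((b + cos t) ^+ N)%:C) in iD; last first.
    by apply/funext => t; rewrite mul0r expi0 mulr1.
  move=> /(congr1 (fun w => z * w)); rewrite mulr0 -CintegralZ// => /(congr1 (@complex.Re R)) /= <-.
  by apply: eq_Rintegral => t _; rewrite mulrA ReM /= mulr0 subr0.
have iH N : arc.-integrable setT (EFin \o (fun t => H t * (b + cos t) ^+ N)).
  have := CintegrableZ z (iDK b N 0) => -[i _].
  apply: eq_integrable i => // t _ /=; congr EFin.
  by rewrite mul0r expi0 mulr1 mulrA ReM /= mulr0 subr0.
have arcA : 0 < fine (arc A).
  rewrite fine_gt0//; apply/andP; split; last first.
    by rewrite -ge0_fin_numE// fin_num_measure.
  pose J : set mR := `[0, d / 2]%classic.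
  have : (arc J <= arc A)%E.
    apply: le_measure; rewrite ?inE//; first exact: measurable_itv.
    move=> t; rewrite /J /= in_itv/= /A /= => /andP[t0 td].
    by rewrite leNgt ltr_cos ?in_itv/= -?leNgt//; lra.
  apply: lt_le_trans.
  rewrite [X in (_ < X)%E](_ : _ = (d / 2)%:E) ?lte_fin ?divr_gt0//.
  transitivity (lebesgue_measure (J `&` `[0, 2 * pi[%classic)) => //.
  rewrite setIidl /J; last by move=> t; rewrite /= !in_itv/=; lra.
  by rewrite lebesgue_measure_itv/= lte_fin divr_gt0//= -EFinB subr0.
have ii : arc.-integrable setT (EFin \o (\1_A : mR -> R)).
  exact: integrable_indic.
have bound N : ep * r ^+ N * fine (arc A) <= M ^+ 2 * (2 * pi).
  have i1 : arc.-integrable setT (EFin \o (fun t => ep * r ^+ N * \1_A t)).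
    exact: (integrableZl measurableT (ep * r ^+ N) ii).
  have i2 : arc.-integrable setT (EFin \o (fun=> M ^+ 2 : R)).
    exact: finite_measure_integrable_cst.
  have : \int[arc]_t (ep * r ^+ N * \1_A t - M ^+ 2) <= \int[arc]_t (H t * (b + cos t) ^+ N).
    apply: le_Rintegral => //; exact: (integrableB measurableT i1 i2).
  rewrite intH RintegralB// RintegralZl//.
  rewrite Rintegral_cst// subr_le0.
  have -> : fine ((arc : set mR -> \bar R) setT) = 2 * pi by rewrite arcT.
  by rewrite /Rintegral integral_indic// setIT.
have bern N : 1 + N%:R * (r - 1) <= r ^+ N.
  elim: N => [|N IH]; first by rewrite mul0r addr0 expr0.
  rewrite exprS (@le_trans _ _ (r * (1 + N%:R * (r - 1))))//; last first.
    by rewrite ler_wpM2l//; lra.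
  have : 0 <= N%:R * (r - 1) ^+ 2 by rewrite mulr_ge0// sqr_ge0.
  rewrite -natr1; lra.
(* By Bernoulli's inequality, any N > Q makes r^N too large for [bound]. *)
pose Q := M ^+ 2 * (2 * pi) / (ep * fine (arc A)) / (r - 1).
have := bound (Num.truncn Q).+1.
have := truncnS_gt Q.
set N := (Num.truncn Q).+1 => QN.
have : r ^+ N * (ep * fine (arc A)) <= M ^+ 2 * (2 * pi) -> False; last first.
  by move=> h h'; apply: h; rewrite mulrCA mulrA.
rewrite -ler_pdivlMr ?mulr_gt0// => h.
have := le_trans (bern N) h; apply/negP; rewrite -ltNge.
move: QN; rewrite /Q ltr_pdivrMr ?subr_gt0// => /lt_le_trans; apply.
by rewrite lerDr.
Qed.

End trigonometric_uniqueness.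

End fourier_series.

Section fourier_inversion.
Context (R : realType).
Local Notation C := R[i].
Local Notation mR := (measurableTypeR R).
Local Notation arc := (@arc_measure R).

Let normcM (z w : C) : normc (z * w) = normc z * normc w := ComplexField.Normc.normcM z w.

Section parameter.
Context d (T : measurableType d) (mu : {measure set T -> \bar R}).
Variables (a : T -> C) (th : R -> T -> R).
Hypotheses (ia : Cintegrable mu a) (mth : forall t, measurable_fun setT (th t))
  (cth : forall y, continuous (th ^~ y)).

Lemma Cmeasurable_mul_expi (t : R) : Cmeasurable (fun y => a y * expi (th t y)).
Proof.
by apply: CmeasurableM; [exact: Cintegrable_measurable ia|exact: Cmeasurable_expi].
Qed.

Lemma Cintegrable_mul_expi (t : R) : Cintegrable mu (fun y => a y * expi (th t y)).
Proof.
apply/CintegrableP; split; first exact: Cmeasurable_mul_expi.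
under eq_integral do rewrite normcM normc_expi mulr1.
by have /CintegrableP[] := ia.
Qed.

(** Dominated convergence with majorant |a|. It is used with the counting measure for sums of
    Fourier series and with the Haar measure for [radial_transform]. *)
Lemma Ccontinuous_Cintegral :
  Ccontinuous (fun t => Cintegral mu setT (fun y => a y * expi (th t y))).
Proof.
have in0 : mu.-integrable setT (EFin \o (fun y => normc (a y))).
  have /CintegrableP[ma aoo] := ia.
  apply/integrableP; split; first by apply/measurable_EFinP; exact: measurable_normc.
  by under eq_integral do rewrite /= ger0_norm ?normc_ge0//.
have H (h : R -> T -> R) :
    (forall t, mu.-integrable setT (EFin \o h t)) ->
    (forall y, continuous (h ^~ y)) -> (forall t y, `|h t y| <= normc (a y)) ->
    continuous (fun t => \int[mu]_y h t y).
  move=> ih ch hb t.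
  have := @continuity_under_integral R _ T mu h setT measurableT (t - 1) (t + 1)
    (fun t _ => ih t) _ (fun y => normc (a y)) in0 _.
  apply.
  - by apply/aeW => y _ x _; exact: ch.
  - by move=> x _; apply/aeW => y _; exact: hb.
  - by rewrite inE /= in_itv/= ltrBlDr ltrDl ltr01.
have ccos y : continuous (fun t => cos (th t y)).
  by move=> t; apply: (@continuous_comp _ _ _ (th ^~ y) cos); [exact: cth|exact: continuous_cos].
have csin y : continuous (fun t => sin (th t y)).
  by move=> t; apply: (@continuous_comp _ _ _ (th ^~ y) sin); [exact: cth|exact: continuous_sin].
split.
- apply: (H (fun t y => Re (a y * expi (th t y)))) => [t|y t|t y].
  + by case: (Cintegrable_mul_expi t).
  + under eq_fun do rewrite ReM /=.
    by apply: cvgB; apply: cvgM; (try exact: cvg_cst); [exact: ccos|exact: csin].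
  + by rewrite (le_trans (Re_le_normc _))// normcM normc_expi mulr1.
- apply: (H (fun t y => Im (a y * expi (th t y)))) => [t|y t|t y].
  + by case: (Cintegrable_mul_expi t).
  + under eq_fun do rewrite ImM /=.
    by apply: cvgD; apply: cvgM; (try exact: cvg_cst); [exact: csin|exact: ccos].
  + by rewrite (le_trans (Im_le_normc _))// normcM normc_expi mulr1.
Qed.

Lemma Cintegral_mul_expi_bounded : exists M, forall t,
  normc (Cintegral mu setT (fun y => a y * expi (th t y))) <= M.
Proof.
exists (2 * fine (\int[mu]_y (normc (a y))%:E)) => t.
apply: le_trans (Cintegral_norm_le (Cintegrable_mul_expi t)) _.
by under eq_integral do rewrite normcM normc_expi mulr1.
Qed.

End parameter.

(** The sum S of the series is continuous and periodic with the same coefficients as F, so that the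
    uniqueness lemma applies to F - S. *)
Lemma fourier_inversion (F : mR -> C) (M : R) (c : int -> C) :
  Ccontinuous F -> (forall t, normc (F t) <= M) -> (forall t, F (t + 2 * pi) = F t) ->
  (forall j, c j = ((2 * pi)^-1)%:C *
     Cintegral arc setT (fun t => F t * expi (- (j%:~R * t)))) ->
  (\esum_(j in [set: int]) (normc (c j))%:E < +oo)%E ->
  forall t, F t = Csum (fun j => c j * expi (j%:~R * t)).
Proof.
move=> cF FM Fp cE coo t0.
have [e be] := int_enum.
pose a n := c (e n); pose th (t : R) (n : nat) : R := (e n)%:~R * t.
have ia : Cintegrable (@counting _ R) a.
  apply/CintegrableP; split; first by [].
  by rewrite -(esum_counting be (a := fun j => (normc (c j))%:E))// => j; rewrite lee_fin normc_ge0.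
have mth t : measurable_fun setT (th t) by [].
have cth n : continuous (th ^~ n) by move=> t; exact: mulrl_continuous.
pose S (t : R) := Cintegral (@counting _ R) setT (fun n => a n * expi (th t n)).
rewrite (Csum_counting be) -/(S t0).
have cS : Ccontinuous S by exact: Ccontinuous_Cintegral.
have [M' SM'] : exists M', forall t, normc (S t) <= M' by exact: Cintegral_mul_expi_bounded.
have Sp t : S (t + 2 * pi) = S t.
  by apply: eq_Cintegral => n; rewrite /th expi_period.
have mS : Cmeasurable (S : mR -> C) by exact: Ccontinuous_measurable.
have mF : Cmeasurable F by exact: Ccontinuous_measurable.
(* The test function is exp(i j t) without conjugation, hence the index -j. *)
have Scoef j : Cintegral arc setT (fun t => S t * expi (j%:~R * t)) = (2 * pi)%:C * c (- j).
  pose f (nt : nat * mR) := a nt.1 * expi (th nt.2 nt.1) * expi (j%:~R * nt.2).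
  have mf : Cmeasurable f.
    apply: CmeasurableM; [apply: CmeasurableM|].
    - exact: (Cmeasurable_comp (Cintegrable_measurable ia) measurable_fst).
    - apply: Cmeasurable_expi; apply: measurable_funM => //.
      by apply: (measurableT_comp (f := fun n : nat => (e n)%:~R : R)).
    - by apply: Cmeasurable_expi; apply: measurable_funM => //; exact: measurable_cst.
  have foo : (\int[@counting nat R]_n \int[arc]_t (normc (f (n, t)))%:E < +oo)%E.
    under eq_integral => n _.
      under eq_integral do rewrite /f /= !normcM !normc_expi !mulr1.
      rewrite integral_cst// [X in (_ * X)%E](_ : _ = (2 * pi)%:E); last exact: arcT.
      over.
    rewrite ge0_integralZr//; last 2 first.
    - by move=> n _; rewrite lee_fin normc_ge0.
    - by rewrite lee_fin ltW// pi2_gt0.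
    have /CintegrableP[_ aoo] := ia.
    by rewrite muleC lte_mul_pinfty// lee_fin ltW// pi2_gt0.
  have if_ := proj2 (Cintegrable12P (@counting nat R) arc mf) foo.
  transitivity (Cintegral arc setT (fun t => Cintegral (@counting _ R) setT (fun n => f (n, t)))).
    apply: eq_Cintegral => t; rewrite /f /= mulrC -CintegralZ//; last exact: Cintegrable_mul_expi.
    by apply: eq_Cintegral => n; rewrite mulrC.
  rewrite -(CFubini if_) /f /=.
  transitivity (Csum (fun k : int => c k * if k == - j then (2 * pi)%:C else 0)).
    rewrite (Csum_counting be); apply: eq_Cintegral => n.
    rewrite -/(a n) -addr_eq0 -Cintegral_arc_expi -CintegralZ; last first.
      by apply: (@Cintegrable_bounded _ _ _ _ _ 1) => [|x]; [exact: Cmeasurable_expiM|rewrite normc_expi].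
    by apply: eq_Cintegral => t; rewrite /th intrD mulrDl expiD mulrA.
  rewrite (@Csum_single _ _ (- j)); first by rewrite eqxx mulrC.
  by move=> k /negbTE ->; rewrite mulr0.
have bb (G : mR -> C) N j : Cmeasurable G -> (forall t, normc (G t) <= N) ->
    Cintegrable arc (fun t => G t * expi (j%:~R * t)).
  move=> mG GN; apply: (@Cintegrable_bounded _ _ _ _ _ N) => [|t].
    by apply: CmeasurableM => //; exact: Cmeasurable_expiM.
  by rewrite normcM normc_expi mulr1.
(* Uniqueness is stated at 0; the translation by t0 only multiplies each coefficient by a phase. *)
pose D t := F (t + t0) - S (t + t0).
suff : D 0 = 0 by rewrite /D add0r => /eqP; rewrite subr_eq0 => /eqP.
have cc (h : R -> R) : continuous h -> continuous (fun t => h (t + t0)).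
  move=> ch t; apply: (@continuous_comp _ _ _ (fun t => t + t0) h); last exact: ch.
  by apply: cvgD; [exact: cvg_id|exact: cvg_cst].
apply: (@trigonometric_uniqueness_at0 _ D (M + M')).
- split.
  + rewrite (_ : (fun t => _) = (fun t => Re (F (t + t0)) - Re (S (t + t0)))); last first.
      by apply/funext => t; rewrite /D; case: (F _) (S _) => x y [].
    by move=> t; apply: cvgB; [exact: (cc _ cF.1)|exact: (cc _ cS.1)].
  + rewrite (_ : (fun t => _) = (fun t => Im (F (t + t0)) - Im (S (t + t0)))); last first.
      by apply/funext => t; rewrite /D; case: (F _) (S _) => x y [].
    by move=> t; apply: cvgB; [exact: (cc _ cF.2)|exact: (cc _ cS.2)].
- move=> t; rewrite /D; by apply: le_trans (normc_sub_le _ _) _; rewrite lerD.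
- by move=> t; rewrite /D addrAC Fp Sp.
move=> j.
pose G t := (F t - S t) * expi (j%:~R * t).
have mG : Cmeasurable (G : mR -> C).
  by apply: CmeasurableM; [exact: CmeasurableB|exact: Cmeasurable_expiM].
have Gp t : G (t + 2 * pi) = G t by rewrite /G expi_period Fp Sp.
have Gint : Cintegral arc setT G = 0.
  rewrite /G; under eq_fun do rewrite mulrBl.
  rewrite CintegralB; [|exact: bb mF FM|exact: bb mS SM'].
  rewrite Scoef cE mulrA -rmorphM/= divff ?gt_eqF ?pi2_gt0// mul1r.
  under [X in _ - Cintegral _ _ X]eq_fun do rewrite intrN mulNr opprK.
  by rewrite subrr.
have iG : Cintegrable arc (fun t => G (t + t0)).
  apply: (@Cintegrable_bounded _ _ _ _ _ (M + M')) => [|t].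
    by apply: (Cmeasurable_comp mG); exact: measurable_translation.
  rewrite /G normcM normc_expi mulr1; by apply: le_trans (normc_sub_le _ _) _; rewrite lerD.
rewrite (_ : (fun t => _) = fun t => expi (- (j%:~R * t0)) * G (t + t0)); last first.
  apply/funext => t; rewrite /D /G mulrDr expiD mulrCA; congr (_ * _).
  by rewrite mulrCA -expiD addNr expi0 mulr1.
by rewrite CintegralZ// Cintegral_arc_shift// Gint mulr0.
Qed.

End fourier_inversion.

(** * Coordinates and measurability on SE(2) *)

Lemma sum_ord2 (R : nmodType) (F : 'I_2 -> R) : \sum_(i < 2) F i = F 0 + F 1.
Proof.
by rewrite !big_ord_recl big_ord0 addr0; congr (F _ + F _); exact: val_inj.
Qed.

Section SE2_coordinates.
Context (R : realType).
Local Notation C := R[i].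
Local Notation mR := (measurableTypeR R).
Implicit Types (g h : SE2 R).

Definition SE2_x g : R := g.1 0 0.
Definition SE2_y g : R := g.1 1 0.
Definition SE2_cos g : R := g.2 0 0.
Definition SE2_sin g : R := g.2 1 0.

Lemma SO2_entries (A : SO2 R) : [/\ SO2_mx A 1 1 = SO2_mx A 0 0,
  SO2_mx A 0 1 = - SO2_mx A 1 0 & SO2_mx A 0 0 ^+ 2 + SO2_mx A 1 0 ^+ 2 = 1].
Proof.
have [AA dA] := SO2P A.
have e00 := congr1 (fun M : 'M[R]_2 => M 0 0) AA.
have e01 := congr1 (fun M : 'M[R]_2 => M 0 1) AA.
have e11 := congr1 (fun M : 'M[R]_2 => M 1 1) AA.
move: dA e00 e01 e11.
rewrite (expand_det_row _ ord0) !mxE !big_ord_recl !big_ord0 !addr0 /cofactor !det_mx11 !mxE /=.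
set d' := (X in _ * ((-1) ^+ (0 + 0) * X)).
set c' := (X in _ * ((-1) ^+ (0 + bump 0 0) * X)).
have -> : lift ord0 ord0 = 1 :> 'I_2 by exact: val_inj.
have -> : ord0 = 0 :> 'I_2 by exact: val_inj.
have -> : d' = A 1 1 by congr (SO2_mx A _ _); exact: val_inj.
have -> : c' = A 1 0 by congr (SO2_mx A _ _); exact: val_inj.
rewrite /bump/= expr0 expr1 mul1r mulN1r mulrN.
set a := A 0 0; set b := A 0 1; set c := A 1 0; set d := A 1 1 => hd h00 h01 h11.
(* These products make the conclusion linear: d(a^2 + b^2) = a(ad - bc) + b(ac + bd) gives d = a,
   and c(a^2 + b^2) = a(ac + bd) - b(ad - bc) gives c = -b. *)
have e1 : d * (a * a + b * b) = d by rewrite h00 mulr1.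
have e2 : a * (a * d - b * c) = a by rewrite hd mulr1.
have e3 : b * (a * c + b * d) = 0.
  by rewrite (_ : a * c + b * d = 0) ?mulr0//; move: h01; lra.
have e4 : c * (a * a + b * b) = c by rewrite h00 mulr1.
have e5 : b * (a * d - b * c) = b by rewrite hd mulr1.
have e6 : a * (a * c + b * d) = 0.
  by rewrite (_ : a * c + b * d = 0) ?mulr0//; move: h01; lra.
have dE : d = a by lra.
have bE : b = - c by lra.
by split; [exact: dE|exact: bE|move: h00; rewrite bE mulrNN !expr2].
Qed.

Lemma SE2_ext g h : SE2_x g = SE2_x h -> SE2_y g = SE2_y h ->
  SE2_cos g = SE2_cos h -> SE2_sin g = SE2_sin h -> g = h.
Proof.
case: g h => v A [w B]; rewrite /SE2_x /SE2_y /SE2_cos /SE2_sin /= => xE yE cE sE.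
congr pair.
  by apply/matrixP => i j; rewrite ord1; case: i => -[|[|//]] i2;
    [move: xE|move: yE]; congr (v _ _ = w _ _); exact: val_inj.
apply: SO2_inj.
have [A11 A01 _] := SO2_entries A; have [B11 B01 _] := SO2_entries B.
apply/matrixP => i j.
have [-> | ->] : i = 0 \/ i = 1.
  by case: i => -[|[|//]] ?; [left|right]; exact: val_inj.
- have [-> | ->] : j = 0 \/ j = 1.
    by case: j => -[|[|//]] ?; [left|right]; exact: val_inj.
  + exact: cE.
  + by rewrite A01 B01; congr (- _).
- have [-> | ->] : j = 0 \/ j = 1.
    by case: j => -[|[|//]] ?; [left|right]; exact: val_inj.
  + exact: sE.
  + by rewrite A11 B11.
Qed.

Lemma SE2_cos2Dsin2 g : SE2_cos g ^+ 2 + SE2_sin g ^+ 2 = 1.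
Proof. by have [] := SO2_entries g.2. Qed.

Lemma SE2_xE (x y t : R) : SE2_x (gSE2 x y t) = x.
Proof. by rewrite /SE2_x /= mxE. Qed.
Lemma SE2_yE (x y t : R) : SE2_y (gSE2 x y t) = y.
Proof. by rewrite /SE2_y /= mxE. Qed.
Lemma SE2_cosE (x y t : R) : SE2_cos (gSE2 x y t) = cos t.
Proof. by rewrite /SE2_cos /SO2_mx /= mxE. Qed.
Lemma SE2_sinE (x y t : R) : SE2_sin (gSE2 x y t) = sin t.
Proof. by rewrite /SE2_sin /SO2_mx /= mxE. Qed.

Lemma SE2_xM g h : SE2_x (g * h)%g = SE2_x g + (SE2_cos g * SE2_x h - SE2_sin g * SE2_y h).
Proof.
have [_ A01 _] := SO2_entries g.2.
by rewrite /SE2_x /= !mxE sum_ord2 A01 mulNr.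
Qed.

Lemma SE2_yM g h : SE2_y (g * h)%g = SE2_y g + (SE2_sin g * SE2_x h + SE2_cos g * SE2_y h).
Proof.
have [A11 _ _] := SO2_entries g.2.
by rewrite /SE2_y /= !mxE sum_ord2 A11.
Qed.

Lemma SE2_cosM g h : SE2_cos (g * h)%g = SE2_cos g * SE2_cos h - SE2_sin g * SE2_sin h.
Proof.
have [_ A01 _] := SO2_entries g.2.
by rewrite /SE2_cos /= [SO2_mx _ _ _]mxE sum_ord2 A01 mulNr.
Qed.

Lemma SE2_sinM g h : SE2_sin (g * h)%g = SE2_sin g * SE2_cos h + SE2_cos g * SE2_sin h.
Proof.
have [A11 _ _] := SO2_entries g.2.
by rewrite /SE2_sin /= [SO2_mx _ _ _]mxE sum_ord2 A11.
Qed.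

Lemma SE2_cosV g : SE2_cos (g^-1)%g = SE2_cos g.
Proof. by rewrite /SE2_cos /= [SO2_mx _ _ _]mxE. Qed.

Lemma SE2_sinV g : SE2_sin (g^-1)%g = - SE2_sin g.
Proof.
have [_ A01 _] := SO2_entries g.2.
by rewrite /SE2_sin /= [SO2_mx _ _ _]mxE A01.
Qed.

Lemma SE2_xV g : SE2_x (g^-1)%g = - (SE2_cos g * SE2_x g + SE2_sin g * SE2_y g).
Proof. by rewrite /SE2_x /= !mxE sum_ord2 !mxE. Qed.

Lemma SE2_yV g : SE2_y (g^-1)%g = - (SE2_cos g * SE2_y g - SE2_sin g * SE2_x g).
Proof.
have [A11 A01 _] := SO2_entries g.2.
by rewrite /SE2_y /= !mxE sum_ord2 !mxE A11 A01; congr (- _); rewrite mulNr addrC.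
Qed.

Lemma gSE2M (x y t x' y' t' : R) : (gSE2 x y t * gSE2 x' y' t')%g =
  gSE2 (x + (cos t * x' - sin t * y')) (y + (sin t * x' + cos t * y')) (t + t').
Proof.
by apply: SE2_ext; rewrite ?SE2_xM ?SE2_yM ?SE2_cosM ?SE2_sinM
  ?SE2_xE ?SE2_yE ?SE2_cosE ?SE2_sinE ?cosD ?sinD.
Qed.

End SE2_coordinates.

Section SE2_measurability.
Context (R : realType).
Local Notation C := R[i].
Local Notation mR := (measurableTypeR R).
Implicit Types (g h : SE2 R).

Lemma continuous_measurable_SE2 (f : SE2 R -> R) : continuous f ->
  measurable_fun setT f.
Proof.
move=> /continuousP cf; apply: (measurability _ (RGenOpens.measurableE R)).
move=> _ [_ [a [b ->] <-]]; rewrite setTI; apply: sub_sigma_algebra.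
exact/cf/interval_open.
Qed.

Lemma continuous_SE2_trans i : continuous (fun g : SE2 R => g.1 i 0).
Proof.
move=> g; apply: (@continuous_comp _ _ _ fst (fun v : 'cV[R]_2 => v i 0)).
  exact: cvg_fst.
exact: coord_continuous.
Qed.

Lemma continuous_SE2_rot i j : continuous (fun g : SE2 R => SO2_mx g.2 i j).
Proof.
move=> g; apply: (@continuous_comp _ _ _ snd (fun A : SO2 R => SO2_mx A i j)).
  exact: cvg_snd.
apply: (@continuous_comp _ _ _ (@SO2_mx R) (fun A : 'M[R]_2 => A i j)).
  exact: initial_continuous.
exact: coord_continuous.
Qed.

Lemma measurable_SE2_x : measurable_fun setT (@SE2_x R : SE2 R -> R).
Proof. apply: continuous_measurable_SE2; exact: (@continuous_SE2_trans _). Qed.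
Lemma measurable_SE2_y : measurable_fun setT (@SE2_y R : SE2 R -> R).
Proof. apply: continuous_measurable_SE2; exact: (@continuous_SE2_trans _). Qed.
Lemma measurable_SE2_cos : measurable_fun setT (@SE2_cos R : SE2 R -> R).
Proof. apply: continuous_measurable_SE2; exact: (@continuous_SE2_rot _ _). Qed.
Lemma measurable_SE2_sin : measurable_fun setT (@SE2_sin R : SE2 R -> R).
Proof. apply: continuous_measurable_SE2; exact: (@continuous_SE2_rot _ _). Qed.

(* acos is known to be continuous on ]-1, 1[ only, hence the separate endpoints. *)
Definition circle_arg (c s : R) : R :=
  if 0 <= s then (if -1 < c < 1 then acos c else if 0 <= c then 0 else pi)
  else - (if -1 < c < 1 then acos c else if 0 <= c then 0 else pi).

Lemma circle_argP (c s : R) : c ^+ 2 + s ^+ 2 = 1 ->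
  cos (circle_arg c s) = c /\ sin (circle_arg c s) = s.
Proof.
move=> cs.
have c2 : c ^+ 2 <= 1 by rewrite -cs lerDl sqr_ge0.
have cN : -1 <= c <= 1.
  by rewrite -ler_norml -(@ler_pXn2r _ 2)// ?nnegrE// expr1n real_normK ?num_real.
pose a := if -1 < c < 1 then acos c else if 0 <= c then 0 else pi.
have [ca sa] : cos a = c /\ sin a = `|s|.
  have sE : `|s| = Num.sqrt (1 - c ^+ 2).
    by rewrite -cs addrAC subrr add0r sqrtr_sqr.
  rewrite /a; case: ifPn => cI.
    by rewrite acosK ?in_itv// sin_acos.
  case: ifPn => c0.
    have c1 : c = 1 by move: cN cI c0; lra.
    by rewrite cos0 sin0 sE c1 expr1n subrr sqrtr0.
  have c1 : c = -1 by move: cN cI c0; lra.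
  by rewrite cospi sinpi sE c1 sqrrN expr1n subrr sqrtr0.
rewrite /circle_arg -/a; case: ifPn => s0; rewrite ?cosN ?sinN ca sa.
  by rewrite ger0_norm.
by rewrite ltr0_norm ?opprK// ltNge.
Qed.

Let arg0 (c : mR) : R := if -1 < c < 1 then acos c else if 0 <= c then 0 else pi.

Let measurable_arg0 : measurable_fun setT arg0.
Proof.
apply: measurable_fun_if => //.
- apply: measurable_and; apply: measurable_fun_ltr => //; exact: measurable_cst.
- rewrite setTI (_ : _ @^-1` _ = `]-1, 1[%classic); last first.
    by apply/seteqP; split=> x; rewrite /= in_itv.
  apply: open_continuous_measurable_fun; first exact: interval_open.
  by move=> x; rewrite inE /= in_itv /=; exact: continuous_acos.
- apply: measurable_funTS; apply: measurable_fun_ifT.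
  + by apply: measurable_fun_ler => //; exact: measurable_cst.
  + exact: measurable_cst.
  + exact: measurable_cst.
Qed.

Lemma measurable_circle_arg d (T : measurableType d) (c s : T -> R) :
  measurable_fun setT c -> measurable_fun setT s ->
  measurable_fun setT (fun x => circle_arg (c x) (s x) : mR).
Proof.
move=> mc ms; have mac : measurable_fun setT (fun x => arg0 (c x)).
  exact: (measurableT_comp measurable_arg0 mc).
apply: measurable_fun_ifT => //.
- by apply: measurable_fun_ler => //; exact: measurable_cst.
- exact: measurable_funN.
Qed.

(** Another angle than [SE2_angle], with values in ]-pi, pi]. Its explicit formula gives
    measurability, and the characters exp(i k theta) do not distinguish the two. *)
Definition SE2_arg g : R := circle_arg (SE2_cos g) (SE2_sin g).

Lemma SE2_argK g : gSE2 (SE2_x g) (SE2_y g) (SE2_arg g) = g.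
Proof.
have [cE sE] := circle_argP (SE2_cos2Dsin2 g).
by apply: SE2_ext; rewrite ?SE2_xE ?SE2_yE ?SE2_cosE ?SE2_sinE.
Qed.

(** By [SE2_argK], f is the measurable parametrization [gSE2_tuple] composed with the coordinates
    and the angle of f. *)
Lemma measurable_to_SE2 d (T : measurableType d) (f : T -> SE2 R) :
  measurable_fun setT (fun t => SE2_x (f t)) ->
  measurable_fun setT (fun t => SE2_y (f t)) ->
  measurable_fun setT (fun t => SE2_cos (f t)) ->
  measurable_fun setT (fun t => SE2_sin (f t)) -> measurable_fun setT f.
Proof.
move=> mx my mc ms.
pose u t : mR * mR * mR := (SE2_x (f t), SE2_y (f t), SE2_arg (f t)).
have mu : measurable_fun setT u.
  apply: measurable_fun_pair; first exact: measurable_fun_pair.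
  exact: measurable_circle_arg.
have := measurableT_comp (@measurable_gSE2_mR R) mu.
rewrite (_ : _ \o u = f)//.
by apply/funext => t; rewrite /= /gSE2_tuple /= SE2_argK.
Qed.

Lemma measurable_SE2_mulg d (T : measurableType d) (f h : T -> SE2 R) :
  measurable_fun setT f -> measurable_fun setT h ->
  measurable_fun setT (fun t => (f t * h t)%g).
Proof.
move=> mf mh.
have fx := measurableT_comp measurable_SE2_x mf.
have fy := measurableT_comp measurable_SE2_y mf.
have fc := measurableT_comp measurable_SE2_cos mf.
have fs := measurableT_comp measurable_SE2_sin mf.
have hx := measurableT_comp measurable_SE2_x mh.
have hy := measurableT_comp measurable_SE2_y mh.
have hc := measurableT_comp measurable_SE2_cos mh.
have hs := measurableT_comp measurable_SE2_sin mh.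
apply: measurable_to_SE2.
- under eq_fun do rewrite SE2_xM.
  by apply: measurable_funD => //; apply: measurable_funB; exact: measurable_funM.
- under eq_fun do rewrite SE2_yM.
  by apply: measurable_funD => //; apply: measurable_funD; exact: measurable_funM.
- under eq_fun do rewrite SE2_cosM.
  by apply: measurable_funB; exact: measurable_funM.
- under eq_fun do rewrite SE2_sinM.
  by apply: measurable_funD; exact: measurable_funM.
Qed.

Lemma measurable_SE2_invg d (T : measurableType d) (f : T -> SE2 R) :
  measurable_fun setT f -> measurable_fun setT (fun t => (f t)^-1%g).
Proof.
move=> mf.
have fx := measurableT_comp measurable_SE2_x mf.
have fy := measurableT_comp measurable_SE2_y mf.
have fc := measurableT_comp measurable_SE2_cos mf.
have fs := measurableT_comp measurable_SE2_sin mf.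
apply: measurable_to_SE2.
- under eq_fun do rewrite SE2_xV.
  by apply: measurable_funN; apply: measurable_funD; exact: measurable_funM.
- under eq_fun do rewrite SE2_yV.
  by apply: measurable_funN; apply: measurable_funB; exact: measurable_funM.
- by under eq_fun do rewrite SE2_cosV.
- under eq_fun do rewrite SE2_sinV.
  exact: measurable_funN.
Qed.

End SE2_measurability.

(** * Invariance of the Haar measure *)

Section plane_isometries.
Context (R : realType).
Local Notation mR := (measurableTypeR R).
Local Notation leb := (@lebesgue_measure R).

(* For products, the inferred sigma-finite structure is the one of products of
   subprobabilities, which does not apply here. *)
Definition lebesgue_plane : set (mR * mR) -> \bar R := (leb \x leb)%E.

HB.instance Definition _ := Measure.on lebesgue_plane.

Let lebesgue_plane_sigma_finite : sigma_finite setT lebesgue_plane.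
Proof.
pose I (n : nat) : set mR := `[- n%:R, n%:R]%classic.
exists (fun n => I n `*` I n) => [|n].
  apply/esym/seteqP; split=> // -[x y] _.
  pose n := (Num.truncn (Num.max `|x| `|y|)).+1.
  have : Num.max `|x| `|y| <= n%:R by rewrite ltW// truncnS_gt.
  rewrite ge_max => /andP[xn yn]; exists n => //.
  by split; rewrite /I /= in_itv/= -ler_norml.
split; first by apply: measurableX; exact: measurable_itv.
have lI : leb (I n) \is a fin_num by rewrite /I lebesgue_measure_itv/=; case: ifP.
have mI : measurable (I n) by exact: measurable_itv.
rewrite [X in (X < _)%E](_ : _ = leb (I n) * leb (I n))%E; last exact: product_measure1E.
by rewrite ltey_eq fin_numM.
Qed.

HB.instance Definition _ :=
  Measure_isSigmaFinite.Build _ _ _ lebesgue_plane lebesgue_plane_sigma_finite.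

Definition leb2 : {sigma_finite_measure set (mR * mR)%type -> \bar R} := lebesgue_plane.

Definition arc_sfinite : {sigma_finite_measure set mR -> \bar R} := @arc_measure R.

Lemma leb2_int12 (phi : mR * mR -> \bar R) : measurable_fun setT phi ->
  (forall z, 0 <= phi z)%E ->
  (\int[leb2]_z phi z = \int[leb]_x \int[leb]_y phi (x, y))%E.
Proof. by move=> mphi phi0; exact: (@fubini_tonelli1 _ _ _ _ _ leb leb phi mphi phi0). Qed.

Lemma leb2_int21 (phi : mR * mR -> \bar R) : measurable_fun setT phi ->
  (forall z, 0 <= phi z)%E ->
  (\int[leb2]_z phi z = \int[leb]_y \int[leb]_x phi (x, y))%E.
Proof. by move=> mphi phi0; exact: (@fubini_tonelli2 _ _ _ _ _ leb leb phi mphi phi0). Qed.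

(** Invariance is expressed by integrals and not by measures of sets, so that Tonelli's theorem and
    composition apply directly. *)
Definition plane_preserving (T : mR * mR -> mR * mR) : Prop :=
  measurable_fun setT T /\ forall phi : mR * mR -> \bar R, measurable_fun setT phi ->
    (forall z, 0 <= phi z)%E ->
    (\int[leb2]_z phi (T z) = \int[leb2]_z phi z)%E.

Lemma plane_preserving_comp (S T : mR * mR -> mR * mR) :
  plane_preserving S -> plane_preserving T -> plane_preserving (S \o T).
Proof.
move=> [mS pS] [mT pT]; split; first exact: measurableT_comp.
move=> phi mphi phi0; rewrite -[RHS](pS phi)//.
exact: (pT (phi \o S) (measurableT_comp mphi mS) (fun z => phi0 (S z))).
Qed.

(** A shear translates each horizontal line, so Tonelli's theorem reduces the claim to the real
    line. A constant [al] gives the translations of the plane. *)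
Lemma plane_preserving_shear1 (al : mR -> mR) : measurable_fun setT al ->
  plane_preserving (fun z => (z.1 + al z.2, z.2)).
Proof.
move=> mal.
have mT : measurable_fun setT (fun z : mR * mR => (z.1 + al z.2 : mR, z.2)).
  apply: measurable_fun_pair => //; apply: measurable_funD => //.
  exact: (measurableT_comp mal).
split=> // phi mphi phi0.
pose phiT (z : mR * mR) := phi (z.1 + al z.2, z.2).
have mphiT : measurable_fun setT phiT by exact: (measurableT_comp mphi mT).
rewrite (leb2_int21 mphiT (fun z => phi0 _)).
rewrite (leb2_int21 mphi phi0); apply: eq_integral => y _.
have mphiy : measurable_fun setT (fun x : mR => phi (x, y)).
  by apply: (measurableT_comp mphi); exact: measurable_fun_pair.
by rewrite [RHS](ge0_integral_translation (al y))// preimage_setT.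
Qed.

Lemma plane_preserving_shear2 (al : mR -> mR) : measurable_fun setT al ->
  plane_preserving (fun z => (z.1, z.2 + al z.1)).
Proof.
move=> mal.
have mT : measurable_fun setT (fun z : mR * mR => (z.1, z.2 + al z.1 : mR)).
  apply: measurable_fun_pair => //; apply: measurable_funD => //.
  exact: (measurableT_comp mal).
split=> // phi mphi phi0.
pose phiT (z : mR * mR) := phi (z.1, z.2 + al z.1).
have mphiT : measurable_fun setT phiT by exact: (measurableT_comp mphi mT).
rewrite (leb2_int12 mphiT (fun z => phi0 _)).
rewrite (leb2_int12 mphi phi0); apply: eq_integral => x _.
have mphix : measurable_fun setT (fun y : mR => phi (x, y)).
  by apply: (measurableT_comp mphi); exact: measurable_fun_pair.
by rewrite [RHS](ge0_integral_translation (al x))// preimage_setT.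
Qed.

(* A rotation is a product of three shears, unless it is the half-turn, which is
   the square of a quarter-turn. *)
Lemma plane_preserving_rotation (c s : R) : c ^+ 2 + s ^+ 2 = 1 ->
  plane_preserving (fun z => (c * z.1 - s * z.2, s * z.1 + c * z.2)).
Proof.
have main c' s' : c' ^+ 2 + s' ^+ 2 = 1 -> 1 + c' != 0 ->
    plane_preserving (fun z => (c' * z.1 - s' * z.2, s' * z.1 + c' * z.2)).
  (* The tangent of half the angle; the shears have slopes -t, s', -t. *)
  move=> cs c1; pose t := s' / (1 + c').
  have mt : measurable_fun setT (fun y : mR => - t * y : mR) by exact: mulrl_measurable.
  have ms : measurable_fun setT (fun y : mR => s' * y : mR) by exact: mulrl_measurable.
  have := plane_preserving_comp (plane_preserving_shear1 mt)
    (plane_preserving_comp (plane_preserving_shear2 ms) (plane_preserving_shear1 mt)).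
  congr plane_preserving; apply/funext => -[x y] /=.
  have st : 1 - s' * t = c'.
    have -> : s' * t = (1 - c' ^+ 2) / (1 + c').
      have -> : 1 - c' ^+ 2 = s' ^+ 2 by rewrite -cs addrAC subrr add0r.
      by rewrite /t expr2 mulrA.
    by field.
  have tc : t * (1 + c') = s' by rewrite /t divfK.
  congr pair.
    transitivity ((1 - s' * t) * x - t * (1 + (1 - s' * t)) * y); first by ring.
    by rewrite st tc.
  transitivity (s' * x + (1 - s' * t) * y); first by ring.
  by rewrite st.
move=> cs; have [c1|c1] := eqVneq (1 + c) 0; last exact: main.
have cE : c = -1 by lra.
have s0 : s = 0.
  by apply/eqP; rewrite -sqrf_eq0 -(addrK (c ^+ 2) (s ^+ 2)) addrC [s ^+ 2 + _]addrC cs cE sqrrN expr1n addNr.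
have q := @main 0 1; rewrite expr0n expr1n add0r addr0 in q.
have {}q := q erefl (oner_neq0 R).
have := plane_preserving_comp q q.
by congr plane_preserving; apply/funext => -[x y] /=; rewrite cE s0; congr pair; ring.
Qed.

Lemma plane_preserving_isometry (a b c s : R) : c ^+ 2 + s ^+ 2 = 1 ->
  plane_preserving (fun z => (a + (c * z.1 - s * z.2), b + (s * z.1 + c * z.2))).
Proof.
move=> cs.
have ma (k : R) : measurable_fun setT (fun _ : mR => k : mR) by exact: measurable_cst.
have := plane_preserving_comp (plane_preserving_shear1 (ma a))
  (plane_preserving_comp (plane_preserving_shear2 (ma b)) (plane_preserving_rotation cs)).
by congr plane_preserving; apply/funext => -[x y] /=; congr pair; rewrite addrC.
Qed.

End plane_isometries.

Section haar_measure_theory.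
Context (R : realType).
Local Notation C := R[i].
Local Notation mR := (measurableTypeR R).
Local Notation leb := (@lebesgue_measure R).
Local Notation arc := (arc_sfinite R).
Local Notation leb2 := (leb2 R).
Local Notation haar := (@haar R).

(** Moves the restriction of the angle from the triple product to its last factor, which makes the
    measure a product of the plane and the circle. *)
Lemma haarE (E : set (SE2 R)) : measurable E ->
  haar E = ((4 * pi ^+ 2)^-1%:E *
    (leb2 \x arc) ((@gSE2_tuple R : mR * mR * mR -> SE2 R) @^-1` E))%E.
Proof.
move=> mE.
transitivity ((4 * pi ^+ 2)^-1%:E * ((leb \x leb) \x leb)
  (((@gSE2_tuple R : mR * mR * mR -> SE2 R) @^-1` E) `&` @haar_domain R))%E; first by [].
congr (_ * _)%E; apply: eq_integral => z _ /=.
transitivity (leb (xsection (gSE2_tuple (R:=R) @^-1` E) z `&` `[0, 2 * pi[%classic)) => //.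
congr (leb _); apply/seteqP; split=> t; rewrite /xsection /haar_domain /= in_itv/= !inE /=.
- by case.
- by case.
Qed.

(** In coordinates, multiplication by h shifts the angle and moves the plane by an isometry
    independent of the angle. Integrating over the plane first separates the two effects. *)
Lemma haar_left_invariant (h : SE2 R) (E : set (SE2 R)) : measurable E ->
  haar ((fun g => (h * g)%g) @^-1` E) = haar E.
Proof.
move=> mE.
have mh : measurable_fun setT (fun g : SE2 R => (h * g)%g).
  by apply: measurable_SE2_mulg => //; exact: measurable_cst.
have mG := @measurable_gSE2_mR R.
have mEh : measurable ((fun g => (h * g)%g) @^-1` E).
  by rewrite -[X in measurable X]setTI; exact: mh.
rewrite (haarE mEh) (haarE mE); congr (_ * _)%E.
have ME F : measurable F -> ((leb2 \x arc) ((@gSE2_tuple R : mR * mR * mR -> SE2 R) @^-1` F) =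
   \int[arc]_t \int[leb2]_z (\1_F (gSE2 z.1 z.2 t))%:E)%E.
  move=> mF.
  have mGF : measurable ((@gSE2_tuple R : mR * mR * mR -> SE2 R) @^-1` F).
    by rewrite -[X in measurable X]setTI; exact: mG.
  pose f (u : mR * mR * mR) : \bar R := (\1_F (gSE2_tuple u))%:E.
  have mf : measurable_fun setT f.
    have mi : measurable_fun setT (\1_F : SE2 R -> R) by exact: measurable_indic.
    by have /measurable_EFinP := measurableT_comp mi mG.
  have f0 u : (0 <= f u)%E by rewrite lee_fin.
  transitivity (\int[(leb2 \x arc)%E]_u f u)%E.
    by have := integral_indic (leb2 \x arc)%E measurableT mGF; rewrite setIT => <-.
  exact: (fubini_tonelli2 f mf f0).
rewrite (ME _ mEh) (ME _ mE).
pose Psi t := (\int[leb2]_z (\1_E (gSE2 z.1 z.2 t))%:E)%E.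
have mE3 : measurable_fun setT (fun u : mR * mR * mR => (\1_E (gSE2_tuple u) : R)%:E).
  have mi : measurable_fun setT (\1_E : SE2 R -> R) by exact: measurable_indic.
  by have /measurable_EFinP := measurableT_comp mi mG.
have mPsi : measurable_fun setT (Psi : mR -> \bar R).
  have f0 (u : mR * mR * mR) : (0 <= (\1_E (gSE2_tuple u) : R)%:E)%E by rewrite lee_fin.
  exact: (measurable_fun_fubini_tonelli_G (m1 := leb2) _ mE3 f0).
transitivity (\int[arc]_t Psi (t + SE2_arg h)%R)%E; last first.
  apply: ge0_integral_arc_shift => // t; first by apply: integral_ge0.
  rewrite /Psi; apply: eq_integral => z _.
  by congr (\1_E _)%:E; apply: SE2_ext; rewrite ?SE2_xE ?SE2_yE ?SE2_cosE ?SE2_sinE// mulr_natl ?cosD2pi ?sinD2pi.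
apply: eq_integral => t _; rewrite /Psi.
have mz : measurable_fun setT (fun z : mR * mR => (\1_E (gSE2 z.1 z.2 (t + SE2_arg h)) : R)%:E).
  have mzt : measurable_fun setT (fun z : mR * mR => (z, t + SE2_arg h : mR)).
    by apply: measurable_fun_pair => //; exact: measurable_cst.
  exact: (measurableT_comp mE3 mzt).
rewrite -((plane_preserving_isometry (SE2_x h) (SE2_y h) (SE2_cos2Dsin2 h)).2 _ mz)//.
apply: eq_integral => z _; congr EFin.
transitivity (\1_E (h * gSE2 z.1 z.2 t)%g : R).
  by rewrite !indicE; congr (_%:R); congr nat_of_bool; apply/idP/idP; rewrite !inE.
congr (\1_E _).
have [cE sE] := circle_argP (SE2_cos2Dsin2 h).
have := gSE2M (SE2_x h) (SE2_y h) (SE2_arg h) z.1 z.2 t.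
rewrite SE2_argK => ->; rewrite -/(SE2_arg h) in cE sE.
by rewrite cE sE [SE2_arg h + t]addrC.
Qed.

End haar_measure_theory.

(** * Fundamental cells of the lattice *)

Section lattice_cells.
Context (R : realType).
Local Notation mR := (measurableTypeR R).
Local Notation haar := (@haar R).
Implicit Types (g h : SE2 R) (c : int * int).

Definition SE2_cell c : set (SE2 R) :=
  [set g | Num.floor (SE2_x g) = c.1 /\ Num.floor (SE2_y g) = c.2].

Lemma measurable_floor : measurable_fun setT (fun x : mR => (Num.floor x)%:~R : R).
Proof.
apply: (measurability _ (RGenOInfty.measurableE R)) => _ [_ [a ->] <-].
rewrite setTI; apply: is_interval_measurable => x y /=.
rewrite !in_itv/= !andbT => ax _ z /andP[xz _].
by rewrite /= in_itv/= andbT (lt_le_trans ax)// ler_int le_floor.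
Qed.

Lemma measurable_SE2_cell c : measurable (SE2_cell c).
Proof.
have H (f : SE2 R -> R) (k : int) : measurable_fun setT f ->
    measurable [set g | Num.floor (f g) = k].
  move=> mf; have := measurableT_comp measurable_floor mf => /(_ measurableT [set k%:~R : R]).
  rewrite setTI => /(_ (measurable_set1 _)).
  rewrite (_ : _ @^-1` _ = [set g | Num.floor (f g) = k])//.
  by apply/seteqP; split=> g /= => [/eqP|->//]; rewrite eqr_int => /eqP.
rewrite (_ : SE2_cell c = [set g | Num.floor (SE2_x g) = c.1] `&` [set g | Num.floor (SE2_y g) = c.2])//.
by apply: measurableI; apply: H; [exact: measurable_SE2_x|exact: measurable_SE2_y].
Qed.

Lemma haar_SE2_cell c : (haar (SE2_cell c) < +oo)%E.
Proof.
rewrite haarE; last exact: measurable_SE2_cell.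
pose I (k : int) : set mR := `[k%:~R, (k + 1)%:~R[%classic.
rewrite (_ : _ @^-1` _ = (I c.1 `*` I c.2) `*` setT); last first.
  apply/seteqP; split=> -[[x y] t]; rewrite /SE2_cell /I /= !in_itv/= ?SE2_xE ?SE2_yE.
    by move=> [<- <-]; rewrite !real_floor_itv ?num_real.
  by move=> [[xI yI] _]; split; apply: floor_def.
rewrite ltey_eq fin_numM//.
rewrite (_ : (_ \x _)%E _ = (leb2 R (I c.1 `*` I c.2) * arc_sfinite R setT)%E); last first.
  apply: product_measure1E => //; apply: measurableX; exact: measurable_itv.
have mI k : measurable (I k) by exact: measurable_itv.
have fI k : lebesgue_measure (I k) \is a fin_num by rewrite /I lebesgue_measure_itv/=; case: ifP.
rewrite fin_numM//.
  rewrite (_ : leb2 R _ = (lebesgue_measure (I c.1) * lebesgue_measure (I c.2))%E) ?fin_numM//.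
  exact: product_measure1E.
by rewrite (_ : arc_sfinite R setT = (2 * pi)%:E)//; exact: arcT.
Qed.

Lemma haar_sigma_finite : sigma_finite setT (haar_fun (R:=R)).
Proof.
have [e be] := int2_enum; have [e' _ ee'] := be.
exists (fun n => SE2_cell (e n)) => [|n].
  apply/esym/seteqP; split=> // g _.
  by exists (e' (Num.floor (SE2_x g), Num.floor (SE2_y g))) => //; rewrite ee'.
by split; [exact: measurable_SE2_cell|exact: haar_SE2_cell].
Qed.

HB.instance Definition _ :=
  Measure_isSigmaFinite.Build _ _ _ (haar_fun (R:=R)) haar_sigma_finite.

Definition haar_sfinite : {sigma_finite_measure set (SE2 R) -> \bar R} := haar_fun (R:=R).

Lemma SE2_xZ c g : SE2_x (Z2_SE2 R c * g)%g = c.1%:~R + SE2_x g.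
Proof. by rewrite SE2_xM SE2_xE SE2_cosE SE2_sinE cos0 sin0 mul1r mul0r subr0. Qed.

Lemma SE2_yZ c g : SE2_y (Z2_SE2 R c * g)%g = c.2%:~R + SE2_y g.
Proof. by rewrite SE2_yM SE2_yE SE2_cosE SE2_sinE cos0 sin0 mul1r mul0r add0r. Qed.

Lemma SE2_cosZ c g : SE2_cos (Z2_SE2 R c * g)%g = SE2_cos g.
Proof. by rewrite SE2_cosM SE2_cosE SE2_sinE cos0 sin0 mul1r mul0r subr0. Qed.

Lemma SE2_sinZ c g : SE2_sin (Z2_SE2 R c * g)%g = SE2_sin g.
Proof. by rewrite SE2_sinM SE2_cosE SE2_sinE cos0 sin0 mul1r mul0r add0r. Qed.

End lattice_cells.

(** * The quotient by the lattice *)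

Section coset_section.
Local Open Scope quotient_scope.
Context (R : realType).
Local Notation mR := (measurableTypeR R).
Local Notation Z2_SE2 := (Z2_SE2 R).
Local Notation Q := (Z2SE2 R).
Implicit Types (g h : SE2 R) (c a : int * int) (q : Q).

Lemma eq_cosetP g h : reflect (exists c, h = (Z2_SE2 c * g)%g) (coset g == coset h).
Proof.
apply: (iffP eqP) => [gh|cgh].
- have /eqmodP : \pi_(Z2SE2 R) g = \pi_(Z2SE2 R) h by [].
  by move=> /asboolP.
- by apply/eqmodP/asboolP.
Qed.

Lemma coset_Z2 c g : coset (Z2_SE2 c * g)%g = coset g.
Proof. by apply/esym/eqP/eq_cosetP; exists c. Qed.

Lemma reprcosetK q : coset (repr q) = q.
Proof. exact: reprK. Qed.

Lemma continuous_Z2_mulg c : continuous (fun g => (Z2_SE2 c * g)%g).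
Proof.
have -> : (fun g => (Z2_SE2 c * g)%g) = (fun g => (vec2 c.1%:~R c.2%:~R + g.1, g.2)).
  apply/funext => g; apply: SE2_ext.
  - by rewrite SE2_xZ /SE2_x /= !mxE.
  - by rewrite SE2_yZ /SE2_y /= !mxE.
  - by rewrite SE2_cosZ.
  - by rewrite SE2_sinZ.
move=> g.
have c1 : continuous (fun g : SE2 R => vec2 c.1%:~R c.2%:~R + g.1).
  apply: mx_continuous => i j; under eq_fun => v do rewrite mxE.
  move=> v; apply: cvgD; first exact: cvg_cst.
  by rewrite ord1; exact: continuous_SE2_trans.
have c2 : continuous (fun g : SE2 R => g.2) by move=> v; exact: cvg_snd.
have := cvg_pair (c1 g) (c2 g); exact.
Qed.

(** In the quotient topology this concerns the preimage of the image, which is the union of the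
    lattice translates of U. *)
Lemma open_coset_image (U : set (SE2 R)) : open U -> open (@coset R @` U).
Proof.
move=> oU.
suff : open (@coset R @^-1` (@coset R @` U)) by [].
rewrite (_ : _ @^-1` _ = \bigcup_(c in [set: int * int]) (fun g => (Z2_SE2 c * g)%g) @^-1` U).
  by apply: bigcup_open => c _; move/continuousP: (@continuous_Z2_mulg c); exact.
apply/seteqP; split=> [g [h Uh /esym/eqP/eq_cosetP[c hE]]|g [c _ /= Ug]].
  by exists c => //=; rewrite -hE.
by exists (Z2_SE2 c * g)%g => //; exact: coset_Z2.
Qed.

(** Open unit squares centred at the points a / 2: small enough for the projection to be injective,
    and overlapping so as to cover the plane. *)
Let V a : set (SE2 R) :=
  [set g | (a.1%:~R - 1) / 2 < SE2_x g < (a.1%:~R + 1) / 2 /\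
           (a.2%:~R - 1) / 2 < SE2_y g < (a.2%:~R + 1) / 2].

Let open_V a : open (V a).
Proof.
have H (f : SE2 R -> R) (x y : R) : continuous f -> open [set g | x < f g < y].
  move=> /continuousP cf; rewrite (_ : [set g | _] = f @^-1` `]x, y[%classic).
    exact/cf/interval_open.
  by apply/seteqP; split=> g; rewrite /= in_itv.
apply: openI; apply: H; exact: (@continuous_SE2_trans R).
Qed.

Let V_cover g : exists a, V a g.
Proof.
exists (Num.floor (2 * SE2_x g), Num.floor (2 * SE2_y g)).
have /andP[x1 x2] := real_floor_itv (num_real (2 * SE2_x g)).
have /andP[y1 y2] := real_floor_itv (num_real (2 * SE2_y g)).
by move: x1 x2 y1 y2; rewrite !intrD /V /=; lra.
Qed.

Let V_inj a g h : V a g -> V a h -> coset g = coset h -> g = h.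
Proof.
move=> [gx gy] [hx hy] /eqP/eq_cosetP[c hE].
have intr0 (k : int) : -1 < (k%:~R : R) < 1 -> k = 0.
  by rewrite -[-1]/(-1%:~R) -mulrN1z -[X in _ && (_ < X)]/(1%:~R) !ltr_int; case: k => [[|]|].
have c1 : c.1 = 0 by apply: intr0; move: gx hx; rewrite hE SE2_xZ; lra.
have c2 : c.2 = 0 by apply: intr0; move: gy hy; rewrite hE SE2_yZ; lra.
by rewrite hE (_ : c = (0, 0)) ?Z2_SE20 ?mul1g//; move: c1 c2; case: c {hE} => ? ? /= -> ->.
Qed.

(* The open sets V a cover SE(2), and the projection is a homeomorphism from
   each of them onto its open image. *)
Lemma measurable_coset_preimage (B : set Q) :
  measurable (@coset R @^-1` B) -> measurable B.
Proof.
have mV a (A : set (SE2 R)) : measurable A -> measurable (@coset R @` (A `&` V a)).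
  pose S := [set A : set (SE2 R) | measurable (@coset R @` (A `&` V a))].
  suff : <<s @open (SE2 R) >> `<=` S by exact.
  apply: smallest_sub => [|U oU]; last first.
    by apply: sub_sigma_algebra; apply: open_coset_image; apply: openI => //; exact: open_V.
  split=> [|A' mA'|F mF].
  - by rewrite /S /= set0I image_set0.
  (* Images commute with relative complements because the projection is injective on [V a]. *)
  - rewrite /S /= (_ : _ @` _ = @coset R @` (V a) `\` @coset R @` (A' `&` V a)).
      by apply: measurableD => //; apply: sub_sigma_algebra; exact: open_coset_image.
    apply/seteqP; split=> [_ [g [[_ nA'g] Vg] <-]|_ [[g Vg <-] nq]].
      split; first by exists g.
      by move=> [h [A'h Vh] /(V_inj Vh Vg) hg]; apply: nA'g; rewrite -hg.
    exists g => //; split=> //; split=> // A'g; apply: nq; by exists g.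
  - rewrite /S /= setI_bigcupl image_bigcup; apply: bigcupT_measurable => n.
    exact: mF.
move=> mB; have [e be] := int2_enum; have [e' _ ee'] := be.
rewrite (_ : B = \bigcup_n (@coset R @` ((@coset R @^-1` B) `&` V (e n)))).
  by apply: bigcupT_measurable => n; exact: mV.
apply/seteqP; split=> [q Bq|q [n _ [g [Bg _] <-]]//].
have [a Va] := V_cover (repr q).
by exists (e' a) => //; exists (repr q); rewrite ?ee' ?reprcosetK//; split=> //=; rewrite reprcosetK.
Qed.

Definition SE2_reduce g : SE2 R :=
  (Z2_SE2 (- Num.floor (SE2_x g), - Num.floor (SE2_y g)) * g)%g.

(** [repr] is an arbitrary choice; moving it into the cell of (0, 0) removes the choice and gives a
    measurable section. *)
Definition coset_section q : SE2 R := SE2_reduce (repr q).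

Lemma SE2_reduceZ c g : SE2_reduce (Z2_SE2 c * g)%g = SE2_reduce g.
Proof.
have fE (k : int) (x : R) : Num.floor (k%:~R + x) = k + Num.floor x.
  by rewrite floorDzr ?intr_int// intrKfloor.
apply: SE2_ext; rewrite /SE2_reduce ?(SE2_xZ, SE2_yZ, SE2_cosZ, SE2_sinZ)//=;
  by rewrite fE opprD intrD !mulrNz; ring.
Qed.

Lemma coset_sectionK g : coset_section (coset g) = SE2_reduce g.
Proof.
have /eqP/eq_cosetP[c gE] := reprcosetK (coset g).
by rewrite [in RHS]gE SE2_reduceZ.
Qed.

Lemma coset_sectionP q : coset (coset_section q) = q.
Proof. by rewrite /coset_section coset_Z2 reprcosetK. Qed.

Lemma measurable_SE2_reduce : measurable_fun setT SE2_reduce.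
Proof.
have H (f : SE2 R -> R) : measurable_fun setT f ->
    measurable_fun setT (fun g => (- Num.floor (f g))%:~R + f g).
  move=> mf; apply: measurable_funD => //; under eq_fun do rewrite mulrNz.
  by apply: measurable_funN; exact: (measurableT_comp (@measurable_floor R) mf).
apply: measurable_to_SE2; rewrite /SE2_reduce.
- under eq_fun do rewrite SE2_xZ; exact: (H _ (@measurable_SE2_x R)).
- under eq_fun do rewrite SE2_yZ; exact: (H _ (@measurable_SE2_y R)).
- under eq_fun do rewrite SE2_cosZ; exact: measurable_SE2_cos.
- under eq_fun do rewrite SE2_sinZ; exact: measurable_SE2_sin.
Qed.

(** Measurability may be tested after composition with the projection, where the section becomes the
    explicit map [SE2_reduce]. *)
Lemma measurable_coset_section : measurable_fun setT coset_section.
Proof.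
move=> _ B mB; rewrite setTI; apply: measurable_coset_preimage.
rewrite (_ : _ @^-1` _ = SE2_reduce @^-1` B).
  by rewrite -[X in measurable X]setTI; exact: measurable_SE2_reduce.
by apply/seteqP; split=> g /=; rewrite coset_sectionK.
Qed.

Lemma coset_section_cell c q : SE2_cell c (Z2_SE2 c * coset_section q)%g.
Proof.
have fl0 (x : R) : Num.floor ((- Num.floor x)%:~R + x) = 0.
  by rewrite floorDzr ?intr_int// intrKfloor addNr.
have fE (k : int) (x : R) : Num.floor (k%:~R + x) = k + Num.floor x.
  by rewrite floorDzr ?intr_int// intrKfloor.
by split; rewrite ?SE2_xZ ?SE2_yZ fE fl0 addr0.
Qed.

End coset_section.

Section integrable_L1.
Context d (T : measurableType d) (R : realType) (mu : {measure set T -> \bar R}).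

Lemma in_L1_integrable (f : T -> R[i]) : in_L mu 1 f <-> Cintegrable mu f.
Proof.
rewrite CintegrableP /in_L.
suff -> : 'N[mu]_1[EFin \o (@normc R) \o f]%E = (\int[mu]_x (normc (f x))%:E)%E by [].
rewrite Lnorm1; apply: eq_integral => x _.
by rewrite /= ger0_norm// normc_ge0.
Qed.

End integrable_L1.

(** * The Haar measure as lattice times quotient *)

Section quotient_measure.
Context (R : realType) (mu : {measure set (Z2SE2 R) -> \bar R})
  (mu_haar : quotient_haar mu).
Local Notation Z2_SE2 := (Z2_SE2 R).
Local Notation haar := (@haar R).

Lemma measurable_Z2_section c :
  measurable_fun setT (fun q => (Z2_SE2 c * coset_section q)%g).
Proof.
apply: measurable_SE2_mulg; first exact: measurable_cst.
exact: measurable_coset_section.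
Qed.

(* Weil's formula for the indicator function of a part of a lattice cell, whose
   periodization is again an indicator function. *)
Lemma quotient_measureE c (E : set (SE2 R)) : measurable E ->
  mu ((fun q => (Z2_SE2 c * coset_section q)%g) @^-1` E) = haar (E `&` SE2_cell c).
Proof.
move=> mE; pose E' := E `&` SE2_cell c.
set A := _ @^-1` E.
have mE' : measurable E' by apply: measurableI => //; exact: measurable_SE2_cell.
have mA : measurable A.
  by rewrite -[A]setTI; exact: measurable_Z2_section.
have fE' : (haar E' < +oo)%E.
  apply: le_lt_trans (haar_SE2_cell R c); apply: le_measure; rewrite ?inE//.
    exact: measurable_SE2_cell.
  exact: subIsetr.
pose f (g : SE2 R) : R[i] := (\1_E' g)%:C.
have if1 : haar.-integrable setT (EFin \o (\1_E' : SE2 R -> R)).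
  apply/integrableP; split; first by apply/measurable_EFinP; exact: measurable_indic.
  rewrite (eq_integral (fun g => (\1_E' g)%:E)); last first.
    by move=> g _; rewrite /= ger0_norm.
  have -> := integral_indic haar measurableT mE'; rewrite setIT. exact: fE'.
have if_ : Cintegrable haar f.
  by split => //=; exact: integrable0.
have := quotient_haar_weil mu_haar (proj2 (in_L1_integrable _ _) if_).
have pfE q : periodize f q = (\1_A q)%:C.
  (* The only lattice element that takes [repr q] into the cell c, hence the only term of the
     periodization that can be nonzero. *)
  pose c0 := (c.1 - Num.floor (SE2_x (repr q)), c.2 - Num.floor (SE2_y (repr q))).
  have c0E : (Z2_SE2 c0 * repr q)%g = (Z2_SE2 c * coset_section q)%g.
    by rewrite /coset_section /SE2_reduce mulgA -Z2_SE2D.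
  rewrite /periodize (@Csum_single _ _ c0).
    rewrite /f c0E /E' /A; congr (_%:C); rewrite !indicE; congr (_%:R); congr nat_of_bool.
    apply/idP/idP; rewrite !inE /=; first by case.
    by split => //; exact: coset_section_cell.
  move=> i ic; rewrite /f indicE memNset// => -[_ [xE yE]]; case/negP: ic; apply/eqP.
  have fE (k : int) (x : R) : Num.floor (k%:~R + x) = k + Num.floor x.
    by rewrite floorDzr ?intr_int// intrKfloor.
  rewrite SE2_xZ fE in xE; rewrite SE2_yZ fE in yE.
  by rewrite /c0 -xE -yE !addrK; case: i {xE yE}.
rewrite (_ : periodize f = fun q => (\1_A q)%:C); last exact/funext.
move=> /(congr1 (@complex.Re R)) /=; rewrite /Rintegral !integral_indic// !setIT.
move=> fineE.
(* Weil's formula is an equality of real values under [fine]; finiteness of both measures lifts it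
   to the extended reals. *)
have muA : (mu A < +oo)%E.
  apply: le_lt_trans (quotient_haar_finite mu_haar).
  by apply: le_measure; rewrite ?inE.
rewrite -(@fineK _ (mu A)) ?ge0_fin_numE// -(@fineK _ (haar E')) ?ge0_fin_numE//.
by rewrite fineE.
Qed.

(** This alias of mu carries the proof of [quotient_haar], from which the finite measure structure
    is declared that Fubini's theorem requires. *)
Definition quotient_finite of quotient_haar mu : set (Z2SE2 R) -> \bar R := mu.

HB.instance Definition _ := Measure.copy (quotient_finite mu_haar) mu.

Let quotient_fin_num : fin_num_fun (quotient_finite mu_haar).
Proof. by apply: lty_fin_num_fun; exact: quotient_haar_finite mu_haar. Qed.

HB.instance Definition _ :=
  Measure_isFinite.Build _ _ _ (quotient_finite mu_haar) quotient_fin_num.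

Variables (e : nat -> int * int) (be : bijective e).

Definition lattice_translate (nq : nat * Z2SE2 R) : SE2 R :=
  (Z2_SE2 (e nq.1) * coset_section nq.2)%g.

Lemma measurable_lattice_translate : measurable_fun setT lattice_translate.
Proof.
apply: measurable_SE2_mulg; last first.
  exact: (measurableT_comp (@measurable_coset_section R) measurable_snd).
by apply: (measurableT_comp (f := fun n : nat => Z2_SE2 (e n))).
Qed.

(* Hence sums over the lattice and integrals over the quotient and the group are
   all related by Fubini's theorem. *)
Lemma haar_lattice_translate (E : set (SE2 R)) : measurable E ->
  haar E = (@counting nat R \x quotient_finite mu_haar)%E (lattice_translate @^-1` E).
Proof.
move=> mE; have [e' e'e ee'] := be.
transitivity (\sum_(n <oo) haar (E `&` SE2_cell (e n)))%E.
  rewrite -measure_semi_bigcup//.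
  - congr (haar _); apply/seteqP; split=> [g Eg|g [n _ []]//].
    by exists (e' (Num.floor (SE2_x g), Num.floor (SE2_y g))) => //; split=> //; rewrite ee'.
  - by move=> n; apply: measurableI => //; exact: measurable_SE2_cell.
  - move=> i j _ _ [g [[_ [xi yi]] [_ [xj yj]]]].
    by apply: (can_inj e'e); case: (e i) (e j) xi yi xj yj => ? ? [? ?] /= -> -> -> ->.
  - apply: bigcupT_measurable => n; apply: measurableI => //; exact: measurable_SE2_cell.
rewrite /product_measure1 ge0_integral_count//; apply: eq_eseriesr => n _ /=.
rewrite -quotient_measureE//; congr (mu _).
by apply/seteqP; split=> q; rewrite /xsection /= ?inE.
Qed.

End quotient_measure.

(** * Unfolding the convolution *)

Section fubini_complements.
Context d1 d2 (T1 : measurableType d1) (T2 : measurableType d2) (R : realType).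
Variable m1 : {sigma_finite_measure set T1 -> \bar R}.
Variable m2 : {sigma_finite_measure set T2 -> \bar R}.
Implicit Types f : T1 * T2 -> R[i].

Lemma measurable_ge0_integral1 (f : T1 * T2 -> \bar R) : measurable_fun setT f ->
  (forall z, 0 <= f z)%E -> measurable_fun setT (fun x => \int[m2]_y f (x, y))%E.
Proof. by move=> mf f0; exact: (measurable_fun_fubini_tonelli_F f mf f0). Qed.

Lemma Cintegrable_Cintegral1 f : Cintegrable (m1 \x m2)%E f ->
  Cintegrable m1 (fun x => Cintegral m2 setT (fun y => f (x, y))).
Proof.
have H (h : T1 * T2 -> \bar R) : (m1 \x m2)%E.-integrable setT h ->
    m1.-integrable setT (fun x => (fine (\int[m2]_y h (x, y))%E)%:E).
  move=> /integrable_fubini_F iF; have mF := measurable_int _ iF.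
  apply: le_integrable iF => //.
    apply/measurable_EFinP; apply: (measurableT_comp (fine_measurable measurableT)).
    exact: mF.
  by move=> x _; rewrite /fubini_F; case: (integral _ _ _) => //= *; rewrite normr0 leey.
by move=> [/H i1 /H i2]; split.
Qed.

End fubini_complements.

Lemma Cintegrable_swap d1 d2 (T1 : measurableType d1) (T2 : measurableType d2)
    (R : realType) (m1 : {sigma_finite_measure set T1 -> \bar R})
    (m2 : {sigma_finite_measure set T2 -> \bar R}) (f : T1 * T2 -> R[i]) :
  Cintegrable (m1 \x m2)%E f -> Cintegrable (m2 \x m1)%E (fun yx => f (yx.2, yx.1)).
Proof.
move=> if_; have mf := Cintegrable_measurable if_.
apply/Cintegrable12P; last exact/(Cintegrable21P _ _ mf).
by apply: (Cmeasurable_comp mf); exact: measurable_fun_pair.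
Qed.

Lemma Cintegrable_Cintegral2 d1 d2 (T1 : measurableType d1) (T2 : measurableType d2)
    (R : realType) (m1 : {sigma_finite_measure set T1 -> \bar R})
    (m2 : {sigma_finite_measure set T2 -> \bar R}) (f : T1 * T2 -> R[i]) :
  Cintegrable (m1 \x m2)%E f ->
  Cintegrable m2 (fun y => Cintegral m1 setT (fun x => f (x, y))).
Proof. by move=> /Cintegrable_swap/Cintegrable_Cintegral1. Qed.

(** If e enumerates the index type, so does [s \o e], and [Csum_counting] holds for every
    enumeration. *)
Lemma Csum_reindex (R : realType) (I : choiceType) (e : nat -> I) (s : I -> I)
    (a : I -> R[i]) : bijective e -> bijective s -> Csum (fun i => a (s i)) = Csum a.
Proof.
move=> be bs; rewrite (Csum_counting be) (@Csum_counting _ _ (s \o e))//.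
exact: bij_comp.
Qed.

(** Integrability is asked of the product because Fubini's theorem provides it for almost every
    slice. It passes to f unless z = 0, when both sides vanish. *)
Lemma Cintegral_mulr d (T : measurableType d) (R : realType)
    (mu : {measure set T -> \bar R}) (f : T -> R[i]) (z : R[i]) :
  Cintegrable mu (fun x => f x * z) ->
  Cintegral mu setT (fun x => f x * z) = Cintegral mu setT f * z.
Proof.
have [->|z0] := eqVneq z 0 => iz.
  rewrite mulr0 (_ : (fun x => _) = fun=> 0); last by apply/funext => x; rewrite mulr0.
  by rewrite /Cintegral !Rintegral_cst// mul0r.
have if_ : Cintegrable mu f.
  rewrite (_ : f = fun x => z^-1 * (f x * z)); first exact: CintegrableZ.
  by apply/funext => x; rewrite mulrCA mulVf ?mulr1.
by rewrite mulrC -CintegralZ//; apply: eq_Cintegral => x; rewrite mulrC.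
Qed.

Section haar_integral.
Context (R : realType).
Local Notation lam := (haar_sfinite R).

Let measurable_mulgl (h : SE2 R) : measurable_fun setT (fun g => (h * g)%g).
Proof. by apply: measurable_SE2_mulg => //; exact: measurable_cst. Qed.

Lemma Cintegral_haar_mulg (h : SE2 R) (f : SE2 R -> R[i]) : Cmeasurable f ->
  Cintegral lam setT (fun g => f (h * g)%g) = Cintegral lam setT f.
Proof.
move=> mf; apply/esym; apply: (Cintegral_pushforward (measurable_mulgl h) mf).
by move=> A mA; exact/esym/haar_left_invariant.
Qed.

Lemma ge0_integral_haar_mulg (h : SE2 R) (f : SE2 R -> \bar R) : measurable_fun setT f ->
  (\int[lam]_g f (h * g)%g = \int[lam]_g f g)%E.
Proof.
move=> mf; rewrite -(integral_pushforwardT _ (measurable_mulgl h) mf).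
by apply: eq_measure_integral => A mA _; exact: haar_left_invariant.
Qed.

Lemma Cmeasurable_mulgl (h : SE2 R) (f : SE2 R -> R[i]) : Cmeasurable f ->
  Cmeasurable (fun g => f (h * g)%g).
Proof. by move=> mf; exact: (Cmeasurable_comp mf (measurable_mulgl h)). Qed.

End haar_integral.

Section convolution.
Context (R : realType) (mu : {measure set (Z2SE2 R) -> \bar R})
  (mu_haar : quotient_haar mu) (e : nat -> int * int) (be : bijective e).
Local Notation C := R[i].
Local Notation Z2_SE2 := (Z2_SE2 R).
Local Notation haar := (@haar R).
Local Notation lam := (haar_sfinite R).
Local Notation normcM := ComplexField.Normc.normcM.
Let nu : {sigma_finite_measure set (Z2SE2 R) -> \bar R} := quotient_finite mu_haar.
Let cnt : {sigma_finite_measure set nat -> \bar R} := @counting nat R.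
Let tr n (g : SE2 R) : SE2 R := (Z2_SE2 (e n) * g)%g.
Let m := lattice_translate (R := R) e.

Let mm : measurable_fun setT m. Proof. exact: measurable_lattice_translate. Qed.

Let haarm E : measurable E -> lam E = (cnt \x nu)%E (m @^-1` E).
Proof. by move=> mE; exact: haar_lattice_translate. Qed.

Lemma Cintegrable_unfold (H : SE2 R -> C) : Cintegrable lam H ->
  Cintegrable (cnt \x nu)%E (fun nq => H (m nq)).
Proof.
move=> /CintegrableP[mH Hoo]; apply/CintegrableP; split; first exact: (Cmeasurable_comp mH mm).
have mn : measurable_fun setT (fun g => (normc (H g))%:E).
  by apply/measurable_EFinP; exact: measurable_normc.
rewrite -(integral_pushforwardT _ mm mn); apply: le_lt_trans Hoo.
by rewrite le_eqVlt; apply/orP; left; apply/eqP; apply: eq_measure_integral => A mA _; exact/esym/haarm.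
Qed.

(** Weil's formula again, now with lattice sums taken from the measurable section. *)
Lemma Cintegral_unfold (H : SE2 R -> C) : Cintegrable lam H ->
  Cintegral lam setT H =
  Cintegral nu setT (fun q => Cintegral cnt setT (fun n => H (tr n (coset_section q)))).
Proof.
move=> iH; rewrite (Cintegral_pushforward mm (Cintegrable_measurable iH) haarm).
by rewrite -(Cintegral21 (Cintegrable_unfold iH)).
Qed.

Lemma bijective_Z2_add (c : int * int) :
  bijective (fun i : int * int => (i.1 + c.1, i.2 + c.2)).
Proof.
by exists (fun i : int * int => (i.1 - c.1, i.2 - c.2)) => -[i j]; rewrite /= ?addrK ?subrK.
Qed.

(** h and [repr (coset h)] differ by a lattice element, which reindexes the sum. This holds at every
    h, divergent sums included. *)
Lemma periodize_coset (f : SE2 R -> C) h :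
  periodize f (coset h) = Cintegral cnt setT (fun n => f (tr n h)).
Proof.
have /esym/eqP/eq_cosetP[c hE] := reprcosetK (coset h).
rewrite /periodize -(Csum_counting be (fun c => f (Z2_SE2 c * h)%g)).
rewrite -[RHS](Csum_reindex _ be (bijective_Z2_add c)).
by congr Csum; apply/funext => i; rewrite hE mulgA -Z2_SE2D.
Qed.

Section kernel.
Variables (f1 f2 : SE2 R -> C).
Hypotheses (if1 : Cintegrable lam f1) (if2 : Cintegrable lam f2).

Let mf1 := Cintegrable_measurable if1.
Let mf2 := Cintegrable_measurable if2.

Let p1 (h : SE2 R) : C := periodize f1 (coset h).

Let mp1 : Cmeasurable p1.
Proof.
rewrite (_ : p1 = fun h => Cintegral cnt setT (fun n => f1 (tr n h))); last first.
  by apply/funext => h; exact: periodize_coset.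
apply: (Cmeasurable_Cintegral cnt (f := fun hn : SE2 R * nat => f1 (tr hn.2 hn.1))).
apply: (Cmeasurable_comp mf1); apply: measurable_SE2_mulg => //.
by apply: (measurableT_comp (f := fun n : nat => Z2_SE2 (e n))).
Qed.

Let mconv d (T : measurableType d) (a : T -> SE2 R) (b : T -> SE2 R) (k : SE2 R -> C) :
  measurable_fun setT a -> measurable_fun setT b -> Cmeasurable k ->
  Cmeasurable (fun t => k (a t) * f2 ((a t)^-1 * b t)%g).
Proof.
move=> ma mb mk; apply: CmeasurableM; first exact: (Cmeasurable_comp mk ma).
apply: (Cmeasurable_comp mf2); apply: measurable_SE2_mulg => //.
exact: measurable_SE2_invg.
Qed.

(** Replaces [repr q] by the measurable representative: the lattice element between them is absorbed
    by left invariance, as p1 is invariant under the lattice. *)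
Let coset_conv_section q : coset_conv (periodize f1) f2 q =
  Cintegral lam setT (fun h => p1 h * f2 (h^-1 * coset_section q)%g).
Proof.
rewrite /coset_section /SE2_reduce; set c := (X in Z2_SE2 X).
pose k h := p1 h * f2 (h^-1 * (Z2_SE2 c * repr q))%g.
have mk : Cmeasurable k.
  by apply: mconv => //; exact: measurable_cst.
rewrite -[RHS](Cintegral_haar_mulg (Z2_SE2 c) mk); apply: eq_Cintegral => h.
by rewrite /k /p1 coset_Z2 invgM -mulgA (mulgA _ (Z2_SE2 c)) mulVg mul1g.
Qed.

Let W0 (hg : SE2 R * SE2 R) : C := f1 hg.1 * f2 (hg.1^-1 * hg.2)%g.

Let mW0 : Cmeasurable W0.
Proof. by apply: mconv. Qed.

Let W0norm h : (\int[lam]_g (normc (W0 (h, g)))%:E =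
  (normc (f1 h))%:E * \int[lam]_g (normc (f2 g))%:E)%E.
Proof.
have mn : measurable_fun setT (fun g => (normc (f2 g))%:E).
  by apply/measurable_EFinP; exact: measurable_normc.
rewrite (eq_integral (fun g => (normc (f1 h))%:E * (normc (f2 (h^-1 * g)%g))%:E)%E); last first.
  by move=> g _; rewrite /W0 /= normcM EFinM.
rewrite ge0_integralZl//; first last.
- by rewrite lee_fin normc_ge0.
- by move=> g _; rewrite lee_fin normc_ge0.
- apply: (measurableT_comp mn); apply: measurable_SE2_mulg => //; exact: measurable_cst.
by congr (_ * _)%E; exact: (ge0_integral_haar_mulg h^-1%g mn).
Qed.

Let iW0 : Cintegrable (lam \x lam)%E W0.
Proof.
apply/(Cintegrable12P _ _ mW0); under eq_integral do rewrite W0norm.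
have /CintegrableP[_ oo1] := if1; have /CintegrableP[_ oo2] := if2.
rewrite ge0_integralZr//; first last.
- by apply: integral_ge0 => g _; rewrite lee_fin normc_ge0.
- by move=> h _; rewrite lee_fin normc_ge0.
- by apply/measurable_EFinP; exact: measurable_normc.
by rewrite lte_mul_pinfty ?ge0_fin_numE ?integral_ge0// => g _; rewrite lee_fin normc_ge0.
Qed.

Let H0 g : C := Cintegral lam setT (fun h => W0 (h, g)).

Let iH0 : Cintegrable lam H0.
Proof. exact: Cintegrable_Cintegral2. Qed.

(* H0 is the convolution f1 * f2 on SE(2), and Fubini's theorem, which makes its
   periodization the convolution on the quotient, applies at almost every coset. *)
Let conv_unfold : {ae nu, forall q, Cintegrable cnt (fun n => H0 (tr n (coset_section q))) /\
  coset_conv (periodize f1) f2 q = Cintegral cnt setT (fun n => H0 (tr n (coset_section q)))}.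
Proof.
(* L is the convolution of |f1| and |f2| on the group and S, below, its periodization. S has a
   finite integral, and the exchanges are legitimate wherever it is finite. *)
pose L g := (\int[lam]_h (normc (W0 (h, g)))%:E)%E.
have mnW : measurable_fun setT (fun z => (normc (W0 z))%:E).
  by apply/measurable_EFinP; exact: measurable_normc.
have mL : measurable_fun setT L.
  apply: (measurable_ge0_integral1 lam (f := fun gh => (normc (W0 (gh.2, gh.1)))%:E)).
    by apply: (measurableT_comp mnW); exact: measurable_fun_pair.
  by move=> z; rewrite lee_fin normc_ge0.
have L0 g : (0 <= L g)%E by apply: integral_ge0 => h _; rewrite lee_fin normc_ge0.
have Loo : (\int[lam]_g L g < +oo)%E by exact/(Cintegrable21P lam lam mW0).
pose S q := (\int[cnt]_n L (tr n (coset_section q)))%E.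
have mS : measurable_fun setT S.
  apply: (measurable_ge0_integral1 cnt (f := fun qn => L (m (qn.2, qn.1)))) => //.
  by apply: (measurableT_comp mL); apply: (measurableT_comp mm); exact: measurable_fun_pair.
have S0 q : (0 <= S q)%E by apply: integral_ge0 => n _.
have Soo : (\int[nu]_q S q < +oo)%E.
  rewrite -(fubini_tonelli2 (m1 := cnt) (m2 := nu) (fun nq => L (m nq)) (measurableT_comp mL mm) (fun nq => L0 _)).
  rewrite -(integral_pushforwardT _ mm mL); apply: le_lt_trans Loo.
  by rewrite le_eqVlt; apply/orP; left; apply/eqP; apply: eq_measure_integral => A mA _; exact/esym/haarm.
have iS : nu.-integrable setT S.
  by apply/integrableP; split=> //; under eq_integral do rewrite gee0_abs//.
have := integrable_ae measurableT iS; apply: filterS => q /(_ Logic.I) Sq.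
set sg := coset_section q.
have mtr (h : nat * SE2 R -> SE2 R) : measurable_fun setT h ->
    measurable_fun setT (fun nh => tr nh.1 (h nh)).
  move=> mh; apply: measurable_SE2_mulg => //.
  by apply: (measurableT_comp (f := fun n : nat => Z2_SE2 (e n))).
pose Phi (nh : nat * SE2 R) := W0 (nh.2, tr nh.1 sg).
have mPhi : Cmeasurable Phi.
  apply: (Cmeasurable_comp mW0); apply: measurable_fun_pair => //.
  by apply: (mtr (fun=> sg)); exact: measurable_cst.
have iPhi : Cintegrable (cnt \x lam)%E Phi.
  by apply/(Cintegrable12P _ _ mPhi); move: Sq; rewrite ge0_fin_numE.
(* Phi after the substitution of [tr n h] for h: the lattice element leaves f2 and enters f1, where
   the sum over n becomes the periodization. *)
pose Phi' (nh : nat * SE2 R) := f1 (tr nh.1 nh.2) * f2 (nh.2^-1 * sg)%g.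
have PhiE n h : Phi' (n, h) = Phi (n, tr n h).
  by rewrite /Phi' /Phi /W0 /= /tr invgM (mulgA (_ * _)%g) mulgVK.
have mPhi' : Cmeasurable Phi'.
  apply: CmeasurableM; first by apply: (Cmeasurable_comp mf1); exact: mtr.
  apply: (Cmeasurable_comp mf2); apply: measurable_SE2_mulg; last exact: measurable_cst.
  exact: measurable_SE2_invg.
have mPhin n : Cmeasurable (fun h => Phi (n, h)).
  by apply: (Cmeasurable_comp mPhi); exact: measurable_fun_pair.
have iPhi' : Cintegrable (cnt \x lam)%E Phi'.
  apply: (proj2 (Cintegrable12P cnt lam mPhi')).
  apply: le_lt_trans (proj1 (Cintegrable12P cnt lam mPhi) iPhi).
  rewrite le_eqVlt; apply/orP; left; apply/eqP; apply: eq_integral => n _.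
  have mn : measurable_fun setT (fun h => (normc (Phi (n, h)))%:E).
    by apply/measurable_EFinP; exact: measurable_normc.
  rewrite -(ge0_integral_haar_mulg (Z2_SE2 (e n)) mn).
  by apply: eq_integral => h _; rewrite PhiE.
split; first exact: (Cintegrable_Cintegral1 iPhi).
rewrite coset_conv_section.
transitivity (Cintegral lam setT (fun h => Cintegral cnt setT (fun n => Phi' (n, h)))).
  apply: ae_eq_Cintegral.
  - by apply: mconv => //; exact: measurable_cst.
  - by apply: (Cintegrable_measurable (mu := lam)); exact: Cintegrable_Cintegral2 iPhi'.
  - have := ae_Cintegrable2 iPhi'; apply: filterS => h ih.
    by rewrite /Phi' /= Cintegral_mulr// /p1 periodize_coset.
rewrite -(CFubini iPhi'); apply: eq_Cintegral => n.
transitivity (Cintegral lam setT (fun h => Phi (n, tr n h))).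
  by apply: eq_Cintegral => h; exact: PhiE.
exact: (Cintegral_haar_mulg (Z2_SE2 (e n)) (mPhin n)).
Qed.

(** P, which will be the conjugate of [psi_], is constant along lattice orbits and so passes in and
    out of lattice sums; its bound K preserves integrability. *)
Lemma coset_conv_integral (P : Z2SE2 R -> C) (K : R) :
  Cmeasurable (fun g => P (coset g)) -> (forall q, normc (P q) <= K) ->
  Cintegral nu setT (fun q => coset_conv (periodize f1) f2 q * P q) =
  Cintegral lam setT (fun h => f1 h *
    Cintegral lam setT (fun g => f2 g * P (coset (h * g)%g))).
Proof.
move=> mP PK.
have K0 : 0 <= K by exact: le_trans (normc_ge0 _) (PK (coset 1%g)).
have bnd d (T : measurableType d) (rho : {measure set T -> \bar R}) (u v : T -> C) :
    Cintegrable rho u -> Cmeasurable v -> (forall t, normc (v t) <= K) ->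
    Cintegrable rho (fun t => u t * v t).
  move=> /CintegrableP[mu_ uoo] mv vK; apply/CintegrableP; split; first exact: CmeasurableM.
  apply: (@le_lt_trans _ _ (\int[rho]_t ((normc (u t))%:E * K%:E))%E).
    apply: ge0_le_integral => //=.
    - by move=> t _; rewrite lee_fin normc_ge0.
    - by apply/measurable_EFinP; apply: measurable_normc; exact: CmeasurableM.
    - by apply: emeasurable_funM => //; apply/measurable_EFinP; exact: measurable_normc.
    - by move=> t _; rewrite -EFinM lee_fin normcM ler_wpM2l ?normc_ge0.
  rewrite ge0_integralZr//; first last.
  - by move=> t _; rewrite lee_fin normc_ge0.
  - by apply/measurable_EFinP; exact: measurable_normc.
  by rewrite muleC lte_mul_pinfty.
have mPq : Cmeasurable P.
  have := Cmeasurable_comp mP (@measurable_coset_section R).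
  by under eq_fun do rewrite coset_sectionP.
pose W (hg : SE2 R * SE2 R) := W0 hg * P (coset hg.2).
have iW : Cintegrable (lam \x lam)%E W.
  by apply: bnd => //; exact: (Cmeasurable_comp mP measurable_snd).
have mconvq : Cmeasurable (coset_conv (periodize f1) f2).
  rewrite (_ : coset_conv _ _ = fun q => Cintegral lam setT (fun h => p1 h * f2 (h^-1 * coset_section q)%g)); last first.
    by apply/funext => q; exact: coset_conv_section.
  apply: (Cmeasurable_Cintegral lam (f := fun qh : Z2SE2 R * SE2 R =>
    p1 qh.2 * f2 (qh.2^-1 * coset_section qh.1)%g)).
  by apply: mconv => //; exact: (measurableT_comp (@measurable_coset_section R) measurable_fst).
have iHP : Cintegrable lam (fun g => H0 g * P (coset g)) by exact: bnd.
transitivity (Cintegral lam setT (fun g => H0 g * P (coset g))).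
  rewrite (Cintegral_unfold iHP); apply: ae_eq_Cintegral.
  - exact: CmeasurableM.
  - have := Cintegrable_Cintegral2 (Cintegrable_unfold iHP).
    exact: Cintegrable_measurable.
  - apply: filterS conv_unfold => q [iq ->].
    have -> : (fun n => H0 (tr n (coset_section q)) * P (coset (tr n (coset_section q)))) =
        fun n => H0 (tr n (coset_section q)) * P q.
      by apply/funext => n; rewrite /tr coset_Z2 coset_sectionP.
    rewrite -Cintegral_mulr//.
    by under eq_fun do rewrite mulrC; exact: CintegrableZ.
transitivity (Cintegral lam setT (fun g => Cintegral lam setT (fun h => W (h, g)))).
  apply: ae_eq_Cintegral.
  - exact: Cintegrable_measurable iHP.
  - by apply: (Cintegrable_measurable (mu := lam)); exact: Cintegrable_Cintegral2 iW.
  - have := ae_Cintegrable2 iW; apply: filterS => g ig.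
    by rewrite /W /= Cintegral_mulr.
rewrite -(CFubini iW); apply: eq_Cintegral => h.
have mPh : Cmeasurable (fun g => P (coset (h * g)%g)) by exact: (Cmeasurable_mulgl h mP).
have iP2 : Cintegrable lam (fun g => f2 g * P (coset (h * g)%g)).
  by apply: bnd.
rewrite -CintegralZ//.
have mWh : Cmeasurable (fun g => W (h, g)).
  apply: (Cmeasurable_comp (Cintegrable_measurable iW)); exact: measurable_fun_pair.
(* The substitution of h g for g frees f2 from h. *)
rewrite -(Cintegral_haar_mulg h mWh); apply: eq_Cintegral => g.
by rewrite /W /W0 /= mulgA mulVg mul1g mulrA.
Qed.

End kernel.

End convolution.

Lemma numconjE (R : realType) (z : R[i]) : Num.conj z = conjc z.
Proof. by []. Qed.

(** * Matrix coefficients of the Fourier transform *)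

(** Links the closed interval in [S1_dot] to the half-open arc; they differ by a null endpoint. *)
Lemma Cintegral_closed_arc (R : realType) (f : measurableTypeR R -> R[i]) : Cmeasurable f ->
  Cintegral (@lebesgue_measure R) `[0, 2 * pi]%classic f = Cintegral (arc_sfinite R) setT f.
Proof.
move=> [mf1 mf2].
have H (h : measurableTypeR R -> R) : measurable_fun setT h ->
    \int[@lebesgue_measure R]_(x in `[0, 2 * pi]%classic) h x = \int[arc_sfinite R]_x h x.
  move=> mh; have mh' : measurable_fun setT (EFin \o h) by exact/measurable_EFinP.
  rewrite /Rintegral -integral_itv_bndo_bndc; last exact: measurable_funTS.
  congr fine; rewrite (integralE lebesgue_measure) (integralE (arc_sfinite R)); congr (_ - _)%E; apply/esym.
  - exact: (ge0_integral_arc (measurable_funepos mh')).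
  - exact: (ge0_integral_arc (measurable_funeneg mh')).
by rewrite /Cintegral !H.
Qed.

Section polar_coordinates.
Context (R : realType).
Implicit Types g h : SE2 R.

Lemma expi_mod2pi (t : R) : exists2 s : R, 0 <= s < 2 * pi & expi s = expi t.
Proof.
exists (t - (Num.floor (t / (2 * pi)))%:~R * (2 * pi)); last first.
  by rewrite expiD expiN expi2pi invr1 mulr1.
have /andP[ka ak] := real_floor_itv (num_real (t / (2 * pi))).
apply/andP; split; first by rewrite subr_ge0 -ler_pdivlMr ?pi2_gt0.
by rewrite ltrBlDr -[X in X + _]mul1r -mulrDl addrC -intrD1 -ltr_pdivrMr ?pi2_gt0.
Qed.

(** The default case of [xget] is excluded by exhibiting an angle, the residue modulo 2 pi of
    [circle_arg]. *)
Lemma polar_phiP (x y : R) : polar_rho x y != 0 ->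
  x = polar_rho x y * cos (polar_phi x y) /\ y = polar_rho x y * sin (polar_phi x y).
Proof.
move=> r0; rewrite /polar_phi; case: xgetP => [t _ [_ ? ?]//|].
set r := polar_rho x y in r0 *.
have cs : (x / r) ^+ 2 + (y / r) ^+ 2 = 1.
  rewrite !expr_div_n -mulrDl -[X in X / _]sqr_sqrtr ?addr_ge0 ?sqr_ge0//.
  by rewrite divff// expf_neq0.
have [cE sE] := circle_argP cs.
have [t t2 tE] := expi_mod2pi (circle_arg (x / r) (y / r)).
have ctE : cos t = x / r by rewrite -cE; case: tE.
have stE : sin t = y / r by rewrite -sE; case: tE.
move=> /(_ t) []; split=> //.
- by rewrite ctE mulrC divfK.
- by rewrite stE mulrC divfK.
Qed.

Lemma cos_SE2_arg g : cos (SE2_arg g) = SE2_cos g.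
Proof. exact: (circle_argP (SE2_cos2Dsin2 g)).1. Qed.

Lemma sin_SE2_arg g : sin (SE2_arg g) = SE2_sin g.
Proof. exact: (circle_argP (SE2_cos2Dsin2 g)).2. Qed.

Lemma expi_intM (k : int) (a b : R) : expi a = expi b -> expi (k%:~R * a) = expi (k%:~R * b).
Proof. by rewrite !expi_int => ->. Qed.

Lemma expi_SE2_argM (k : int) g h :
  expi (k%:~R * SE2_arg (g * h)%g) = expi (k%:~R * SE2_arg g) * expi (k%:~R * SE2_arg h).
Proof.
transitivity (expi (k%:~R * (SE2_arg g + SE2_arg h))); last by rewrite mulrDr expiD.
apply: expi_intM; rewrite /expi cos_SE2_arg sin_SE2_arg SE2_cosM SE2_sinM cosD sinD.
by rewrite !cos_SE2_arg !sin_SE2_arg.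
Qed.

Lemma expi_SE2_angle (k : int) g :
  expi (k%:~R * SE2_angle g) = expi (k%:~R * SE2_arg g).
Proof.
apply: expi_intM.
by rewrite -(polar_phi_expi (SE2_arg g)) cos_SE2_arg sin_SE2_arg.
Qed.

Lemma measurable_SE2_arg : measurable_fun setT (@SE2_arg R : SE2 R -> R).
Proof. exact: (measurable_circle_arg (@measurable_SE2_cos R) (@measurable_SE2_sin R)). Qed.

Lemma psi_coset (k1 k2 k3 : int) g : psi_ (k1, k2, k3) (coset g) =
  (Num.sqrt (2 * pi))%:C * expi (2 * pi * (k1%:~R * SE2_x g + k2%:~R * SE2_y g))
  * expi (k3%:~R * SE2_arg g) :> R[i].
Proof. by rewrite -{1}(SE2_argK g) psi_E. Qed.

Lemma S1_rot_pt g (a : R) : S1_rot g.2 (S1_pt a) = S1_pt (a + SE2_arg g).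
Proof.
apply: val_inj; apply/matrixP => i j; rewrite ord1 /S1_rot /S1_pt /= !mxE.
have [A11 A01 _] := SO2_entries g.2.
rewrite sum_ord2 !mxE /= cosD sinD cos_SE2_arg sin_SE2_arg.
have [-> | ->] : i = 0 \/ i = 1.
  by case: i => -[|[|//]] ?; [left|right]; exact: val_inj.
- by rewrite /= A01 /SE2_cos /SE2_sin; ring.
- by rewrite /= A11 /SE2_cos /SE2_sin; ring.
Qed.

(** Inverting g turns the rotation of the circle into a shift by the angle of g. The substitution b
    = a + theta undoes it, at the cost of the factor exp(i m theta) from the conjugate of the m-th
    basis vector. *)
Lemma S1_dot_U_rep (p : R) g (n m : int) :
  S1_dot (U_rep p (g^-1)%g (S1_basis n)) (S1_basis m) =
  ((2 * pi)^-1)%:C * (expi (m%:~R * SE2_arg g) * Cintegral (arc_sfinite R) setT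
    (fun b => expi (- p * (SE2_x g * cos b + SE2_y g * sin b)) *
              expi ((n - m)%:~R * b))).
Proof.
rewrite /S1_dot; congr (_ * _).
pose G (b : measurableTypeR R) := expi (- p * (SE2_x g * cos b + SE2_y g * sin b)) *
              expi ((n - m)%:~R * b).
have mG : Cmeasurable G.
  apply: CmeasurableM; last exact: Cmeasurable_expiM.
  apply: Cmeasurable_expi.
  have mc : measurable_fun setT (cos : measurableTypeR R -> R).
    by apply: continuous_measurable_fun; exact: continuous_cos.
  have ms : measurable_fun setT (sin : measurableTypeR R -> R).
    by apply: continuous_measurable_fun; exact: continuous_sin.
  apply: measurable_funM; first exact: measurable_cst.
  by apply: measurable_funD; apply: measurable_funM => //; exact: measurable_cst.
have Gp b : G (b + 2 * pi) = G b.
  by rewrite /G expi_period mulr_natl cosD2pi sinD2pi.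
have mGs : Cmeasurable (fun a : measurableTypeR R => G (a + SE2_arg g)).
  by apply: (Cmeasurable_comp mG); exact: measurable_translation.
have iG : Cintegrable (arc_sfinite R) (fun a : measurableTypeR R => G (a + SE2_arg g)).
  apply: (@Cintegrable_bounded _ _ _ (@arc_measure R) _ 1) => // a.
  by rewrite /G ComplexField.Normc.normcM !normc_expi mulr1.
rewrite -/G -(Cintegral_arc_shift (SE2_arg g) mG Gp) -CintegralZ//.
rewrite -Cintegral_closed_arc; last by apply: CmeasurableM => //; exact: Cmeasurable_cst.
rewrite (_ : (fun a => _) = fun a : measurableTypeR R => expi (m%:~R * SE2_arg g) * G (a + SE2_arg g))//.
apply/funext => a; rewrite /U_rep.
rewrite (_ : SO2_inv (g^-1)%g.2 = g.2); last exact: (invgK g.2).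
rewrite S1_rot_pt !S1_basisE numconjE conj_expi /G mulrCA -!expiD; congr expi.
have -> : dotv (S1_vec (S1_pt a)) (g^-1)%g.1 = cos a * SE2_x (g^-1)%g + sin a * SE2_y (g^-1)%g.
  by rewrite /dotv mxE sum_ord2 ![_^T _ _]mxE /S1_vec /= ![vec2 _ _ _ _]mxE.
rewrite SE2_xV SE2_yV cosD sinD cos_SE2_arg sin_SE2_arg intrB; ring.
Qed.

End polar_coordinates.

(** * The plane Fourier transform on circles *)

Section radial_transform.
Context (R : realType).
Local Notation C := R[i].
Local Notation mR := (measurableTypeR R).
Local Notation lam := (haar_sfinite R).
Local Notation arc := (arc_sfinite R).
Local Notation normcM := ComplexField.Normc.normcM.

Let phase (p a : R) (g : SE2 R) : R := - p * (SE2_x g * cos a + SE2_y g * sin a).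

Let measurable_phase p a : measurable_fun setT (phase p a).
Proof.
apply: measurable_funM; first exact: measurable_cst.
apply: measurable_funD; apply: measurable_funM; try exact: measurable_cst.
- exact: measurable_SE2_x.
- exact: measurable_SE2_y.
Qed.

Let continuous_phase p g : continuous (fun a => phase p a g).
Proof.
move=> a; apply: cvgM; first exact: cvg_cst.
apply: cvgD; apply: cvgM; try exact: cvg_cst.
- exact: continuous_cos.
- exact: continuous_sin.
Qed.

(** Up to normalization, the Fourier transform on the plane, at the frequency of polar coordinates
    (p, a), of the m-th angular component of f. *)
Definition radial_transform (f : SE2 R -> C) (p : R) (m : int) (a : R) : C :=
  Cintegral lam setT (fun g => f g * expi (m%:~R * SE2_arg g) *
    expi (- p * (SE2_x g * cos a + SE2_y g * sin a))).

Variables (f : SE2 R -> C) (p : R) (m : int).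
Hypothesis if_ : Cintegrable lam f.

Lemma Cmeasurable_expi_arg (k : int) : Cmeasurable (fun g : SE2 R => expi (k%:~R * SE2_arg g)).
Proof.
apply: Cmeasurable_expi; apply: measurable_funM; first exact: measurable_cst.
exact: measurable_SE2_arg.
Qed.

Lemma Cintegrable_mul_expi_arg (k : int) :
  Cintegrable lam (fun g => f g * expi (k%:~R * SE2_arg g)).
Proof.
apply: (Cintegrable_mul_expi (th := fun=> fun g => k%:~R * SE2_arg g) if_ _ 0) => _.
apply: measurable_funM; first exact: measurable_cst.
exact: measurable_SE2_arg.
Qed.

Lemma Cintegrable_radial (a : R) : Cintegrable lam (fun g => f g * expi (m%:~R * SE2_arg g) *
    expi (- p * (SE2_x g * cos a + SE2_y g * sin a))).
Proof. exact: (Cintegrable_mul_expi (Cintegrable_mul_expi_arg m) (measurable_phase p) a). Qed.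

Lemma Ccontinuous_radial : Ccontinuous (radial_transform f p m).
Proof.
exact: (Ccontinuous_Cintegral (Cintegrable_mul_expi_arg m) (measurable_phase p) (@continuous_phase p)).
Qed.

Lemma radial_period a : radial_transform f p m (a + 2 * pi) = radial_transform f p m a.
Proof. by rewrite /radial_transform mulr_natl cosD2pi sinD2pi. Qed.

(** Fubini's theorem on the group times the circle: the integrand has modulus |f| and the circle has
    finite measure. *)
Lemma fourier_coefE (n : int) : fourier_coef f p n m = ((2 * pi)^-1)%:C *
  Cintegral arc setT (fun b => radial_transform f p m b * expi (- ((m - n)%:~R * b))).
Proof.
pose X (gb : SE2 R * mR) := f gb.1 * expi (m%:~R * SE2_arg gb.1) *
  expi (phase p gb.2 gb.1) * expi (- ((m - n)%:~R * gb.2)).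
have mX : Cmeasurable X.
  apply: CmeasurableM; [apply: CmeasurableM; [apply: CmeasurableM|]|].
  - exact: (Cmeasurable_comp (Cintegrable_measurable if_) measurable_fst).
  - exact: (Cmeasurable_comp (Cmeasurable_expi_arg m) measurable_fst).
  - apply: Cmeasurable_expi; apply: measurable_funM; first exact: measurable_cst.
    have mc : measurable_fun setT (cos : mR -> R).
      by apply: continuous_measurable_fun; exact: continuous_cos.
    have ms : measurable_fun setT (sin : mR -> R).
      by apply: continuous_measurable_fun; exact: continuous_sin.
    apply: measurable_funD; apply: measurable_funM.
    + exact: (measurableT_comp (@measurable_SE2_x R) measurable_fst).
    + exact: (measurableT_comp mc measurable_snd).
    + exact: (measurableT_comp (@measurable_SE2_y R) measurable_fst).
    + exact: (measurableT_comp ms measurable_snd).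
  - apply: Cmeasurable_expi; apply: measurable_funN.
    by apply: measurable_funM; [exact: measurable_cst|exact: measurable_snd].
have nX g b : normc (X (g, b)) = normc (f g) by rewrite /X !normcM !normc_expi !mulr1.
have foo : (\int[lam]_g \int[arc]_b (normc (X (g, b)))%:E < +oo)%E.
  rewrite (eq_integral (fun g => (normc (f g))%:E * (2 * pi)%:E)%E); last first.
    move=> g _; rewrite (eq_integral (fun=> (normc (f g))%:E)); last by move=> b _; rewrite nX.
    by rewrite integral_cst// [X in (_ * X)%E](_ : _ = (2 * pi)%:E)//; exact: arcT.
  have /CintegrableP[mf fo] := if_.
  rewrite ge0_integralZr//; first last.
  - by rewrite lee_fin ltW// pi2_gt0.
  - by move=> g _; rewrite lee_fin normc_ge0.
  - by apply/measurable_EFinP; exact: measurable_normc.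
  by rewrite muleC lte_mul_pinfty// lee_fin ltW// pi2_gt0.
have iX := proj2 (Cintegrable12P lam arc mX) foo.
transitivity (Cintegral lam setT (fun g => ((2 * pi)^-1)%:C * Cintegral arc setT (fun b => X (g, b)))).
  apply: eq_Cintegral => g; rewrite S1_dot_U_rep mulrCA; congr (_ * _).
  rewrite mulrA -CintegralZ.
    apply: eq_Cintegral => b; rewrite /X /phase /= mulrA; congr (_ * expi _).
    by rewrite -mulNr -mulrNz opprB.
  apply: (@Cintegrable_bounded _ _ _ (@arc_measure R) _ 1) => [|b]; last first.
    by rewrite normcM !normc_expi mulr1.
  apply: CmeasurableM; last exact: Cmeasurable_expiM.
  apply: Cmeasurable_expi; apply: continuous_measurable_fun.
  exact: (@continuous_phase p g).
rewrite CintegralZ; last exact: (Cintegrable_Cintegral1 iX).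
congr (_ * _); rewrite (CFubini iX); apply: eq_Cintegral => b.
rewrite -Cintegral_mulr//.
under eq_fun do rewrite mulrC; apply: CintegrableZ; exact: Cintegrable_radial.
Qed.

Lemma radial_fourier_series :
  (\esum_(n in [set: int]) (normc (fourier_coef f p n m))%:E < +oo)%E ->
  forall a, radial_transform f p m a =
    Csum (fun n : int => fourier_coef f p n m * expi ((m - n)%:~R * a)).
Proof.
move=> coo a.
have [e be] := int_enum.
(* The matrix coefficient of index n belongs to the frequency m - n, so the series is reindexed by
   this involution. *)
have bm : bijective (fun j : int => m - j) by exists (fun j : int => m - j) => j; rewrite subKr.
have [M FM] := Cintegral_mul_expi_bounded (Cintegrable_mul_expi_arg m) (measurable_phase p).
rewrite (@fourier_inversion _ (radial_transform f p m) M (fun j => fourier_coef f p (m - j) m)).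
- rewrite -[RHS](Csum_reindex _ be bm); congr Csum; apply/funext => j.
  by rewrite subKr.
- exact: Ccontinuous_radial.
- exact: FM.
- exact: radial_period.
- by move=> j; rewrite fourier_coefE subKr.
- have n0 j : (0 <= (normc (fourier_coef f p j m))%:E)%E by rewrite lee_fin normc_ge0.
  have E1 := esum_counting be (a := fun j => (normc (fourier_coef f p (m - j) m))%:E) (fun j => n0 _).
  have E2 := esum_counting (bij_comp bm be) (a := fun n => (normc (fourier_coef f p n m))%:E) n0.
  by rewrite E2 in coo; rewrite E1; exact: coo.
Qed.

End radial_transform.

Section admissible.
Context (R : realType).

(** One real bound for all p and m: the double series needs it at every m at once. *)
Lemma admissible_bound (f : SE2 R -> R[i]) : admissible f ->
  exists B : R, forall (p : R) (m : int), 0 < p ->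
    (\esum_(n in [set: int]) (normc (fourier_coef f p n m))%:E <= B%:E)%E.
Proof.
move=> [_]; set S := ereal_sup _ => Soo.
have H (p : R) (m : int) : 0 < p ->
    (\esum_(n in [set: int]) (normc (fourier_coef f p n m))%:E <= S)%E.
  move=> p0; apply: (@le_trans _ _ (fourier_beta f m)).
    by apply: le_esum => n _; apply: ereal_sup_ubound; exists p.
  by apply: ereal_sup_ubound; exists m.
case: S Soo H => [B|//|] _ H; first by exists B.
(* The value -oo of the supremum is impossible, since it would bound a sum of nonnegative terms. *)
exists 0 => p m p0; have := H p m p0; rewrite leeNy_eq => /eqP E.
have : (0 <= \esum_(n in [set: int]) (normc (fourier_coef f p n m))%:E)%E.
  by apply: esum_ge0 => n _; rewrite lee_fin normc_ge0.
by rewrite E.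
Qed.

End admissible.

Lemma conjcM (R : realType) (z w : R[i]) : conjc (z * w) = conjc z * conjc w.
Proof.
case: z w => a b [x y]; apply/eqP; rewrite eq_complex /=; apply/andP.
by split; apply/eqP; ring.
Qed.

(** * Fourier coefficients of the convolution *)

Lemma measurable_nat_pair (A : set (nat * nat)) : measurable A.
Proof.
rewrite (_ : A = \bigcup_i ([set i] `*` [set j | A (i, j)])).
  by apply: bigcupT_measurable => i; exact: measurableX.
apply/seteqP; split=> [[i j] Aij|[i j] [k _ [/= -> //]]].
by exists i.
Qed.

Section convolution_coefficients.
Context (R : realType) (mu : {measure set (Z2SE2 R) -> \bar R})
  (mu_haar : quotient_haar mu) (f1 f2 : SE2 R -> R[i]).
Local Notation C := R[i].
Local Notation lam := (haar_sfinite R).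
Local Notation normcM := ComplexField.Normc.normcM.
Let cnt : {sigma_finite_measure set nat -> \bar R} := @counting nat R.
Let s : C := (Num.sqrt (2 * pi))%:C.
Hypotheses (if1 : Cintegrable lam f1) (if2 : Cintegrable lam f2).

Lemma conj_psi_coset (k1 k2 k3 : int) (g : SE2 R) :
  conjc (psi_ (k1, k2, k3) (coset g)) =
  s * expi (- (2 * pi * (k1%:~R * SE2_x g + k2%:~R * SE2_y g)))
  * expi ((- k3)%:~R * SE2_arg g).
Proof.
rewrite psi_coset !conjcM !conj_expi mulrNz mulNr.
by congr (_ * _ * _); rewrite /s /= oppr0.
Qed.

Lemma coset_dot_conv (k1 k2 k3 : int) :
  coset_dot mu (coset_conv (periodize f1) f2) (psi_ (k1, k2, k3)) =
  Cintegral lam setT (fun h => f1 h * Cintegral lam setT (fun g => f2 g *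
    (s * expi (- (2 * pi * (k1%:~R * SE2_x (h * g)%g + k2%:~R * SE2_y (h * g)%g)))
     * expi ((- k3)%:~R * SE2_arg (h * g)%g)))).
Proof.
have [e be] := int2_enum.
pose P q := conjc (psi_ (k1, k2, k3) q : R[i]).
transitivity (Cintegral (quotient_finite mu_haar) setT
  (fun q => coset_conv (periodize f1) f2 q * P q)); first by [].
rewrite (@coset_conv_integral _ _ mu_haar _ be _ _ if1 if2 P (normc s)).
- apply: eq_Cintegral => h; congr (_ * _); apply: eq_Cintegral => g.
  by rewrite /P conj_psi_coset.
- under eq_fun do rewrite /P conj_psi_coset.
  apply: CmeasurableM; last exact: Cmeasurable_expi_arg.
  apply: CmeasurableM; first exact: Cmeasurable_cst.
  apply: Cmeasurable_expi; apply: measurable_funN; apply: measurable_funM; first exact: measurable_cst.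
  apply: measurable_funD; apply: measurable_funM; try exact: measurable_cst.
  + exact: measurable_SE2_x.
  + exact: measurable_SE2_y.
- move=> q; rewrite -(coset_sectionP q) /P conj_psi_coset !normcM !normc_expi !mulr1.
  by [].
Qed.

(** At zero frequency the conjugate of [psi_] is a constant times a character of the angle, which
    separates the two integrals. *)
Lemma coset_dot_conv_theta (k3 : int) :
  coset_dot mu (coset_conv (periodize f1) f2) (psi_ (0, 0, k3)) =
  s * fourier_theta f1 k3 * fourier_theta f2 k3.
Proof.
have thE (f : SE2 R -> C) : fourier_theta f k3 =
    Cintegral lam setT (fun g => f g * expi ((- k3)%:~R * SE2_arg g)).
  by apply: eq_Cintegral => g; rewrite -expi_SE2_angle mulrNz mulNr.
have i1 := Cintegrable_mul_expi_arg if1 (- k3).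
have i2 := Cintegrable_mul_expi_arg if2 (- k3).
rewrite coset_dot_conv !thE.
transitivity (Cintegral lam setT (fun h => (s * Cintegral lam setT (fun g => f2 g * expi ((- k3)%:~R * SE2_arg g)))
   * (f1 h * expi ((- k3)%:~R * SE2_arg h)))).
  apply: eq_Cintegral => h.
  rewrite (_ : (fun g => _) = fun g => (s * expi ((- k3)%:~R * SE2_arg h)) * (f2 g * expi ((- k3)%:~R * SE2_arg g))); last first.
    apply/funext => g; rewrite expi_SE2_argM mulr0z !mul0r addr0 mulr0 oppr0 expi0; ring.
  by rewrite CintegralZ//; ring.
by rewrite CintegralZ//; ring.
Qed.

(** * The double series at nonzero frequencies *)

Section nonzero_frequency.
Variables (k1 k2 k3 : int).
Let rho := polar_rho (k1%:~R : R) k2%:~R.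
Let phi := polar_phi (k1%:~R : R) k2%:~R.
Let p := 2 * pi * rho.
Hypothesis rho0 : rho != 0.

Let inner (h : SE2 R) : Cintegral lam setT (fun g => f2 g *
    (s * expi (- (2 * pi * (k1%:~R * SE2_x (h * g)%g + k2%:~R * SE2_y (h * g)%g)))
     * expi ((- k3)%:~R * SE2_arg (h * g)%g))) =
  s * expi (- p * (SE2_x h * cos phi + SE2_y h * sin phi)) * expi ((- k3)%:~R * SE2_arg h)
  * radial_transform f2 p (- k3) (phi - SE2_arg h).
Proof.
have [k1E k2E] := polar_phiP rho0.
(* The scalar product of u_phi with x_h + R_h x_g is that of u_phi with x_h plus that of u_(phi -
   theta_h) with x_g. *)
have key (a b r cp sp ch sh xh yh xg yg : R) : a = r * cp -> b = r * sp ->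
    - (2 * pi * (a * (xh + (ch * xg - sh * yg)) + b * (yh + (sh * xg + ch * yg)))) =
    - (2 * pi * r) * (xh * cp + yh * sp) +
    - (2 * pi * r) * (xg * (cp * ch + sp * sh) + yg * (sp * ch - cp * sh)).
  by move=> -> ->; ring.
rewrite /radial_transform -CintegralZ; last exact: Cintegrable_radial.
apply: eq_Cintegral => g; rewrite expi_SE2_argM.
rewrite (_ : expi (- (2 * pi * _)) = expi (- p * (SE2_x h * cos phi + SE2_y h * sin phi)) *
  expi (- p * (SE2_x g * cos (phi - SE2_arg h) + SE2_y g * sin (phi - SE2_arg h)))); last first.
  rewrite -expiD; congr expi; rewrite SE2_xM SE2_yM cosB sinB cos_SE2_arg sin_SE2_arg.
  exact: key.
ring.
Qed.

Let c (n m : int) : C := expi (- (n%:~R * phi)) * fourier_coef f1 p n m *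
  fourier_coef f2 p m (- k3).

Variables (B1 B2 : R).
Hypotheses
  (f1B : forall m, (\esum_(n in [set: int]) (normc (fourier_coef f1 p n m))%:E <= B1%:E)%E)
  (f2B : forall m, (\esum_(n in [set: int]) (normc (fourier_coef f2 p n m))%:E <= B2%:E)%E).

Variables (e : nat -> int) (be : bijective e).

Let a1 m n := fourier_coef f1 p (e n) m.
Let b2 n := fourier_coef f2 p (e n) (- k3).

Let int_coef (f : SE2 R -> C) m : (\int[cnt]_n (normc (fourier_coef f p (e n) m))%:E =
  \esum_(n in [set: int]) (normc (fourier_coef f p n m))%:E)%E.
Proof.
have n0 j : (0 <= (normc (fourier_coef f p j m))%:E)%E by rewrite lee_fin normc_ge0.
by rewrite (esum_counting be n0).
Qed.

Let ia1 m : Cintegrable cnt (a1 m).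
Proof.
by apply/CintegrableP; split=> //; rewrite int_coef (le_lt_trans (f1B m))// ltry.
Qed.

Let ib2 : Cintegrable cnt b2.
Proof.
by apply/CintegrableP; split=> //; rewrite int_coef (le_lt_trans (f2B _))// ltry.
Qed.

Let Y (nm : nat * nat) : C := c (e nm.1) (e nm.2).

Let normY n m : normc (Y (n, m)) = normc (a1 (e m) n) * normc (b2 m).
Proof. by rewrite /Y /c !normcM normc_expi mul1r. Qed.

Let mY : Cmeasurable Y.
Proof. by split=> _ A mA; rewrite setTI; exact: measurable_nat_pair. Qed.

(** For fixed m, the sum over n is at most B1 |b2 m|, and b2 is summable. The uniformity of B1 in m
    is what the supremum in [admissible] provides. *)
Let iY : Cintegrable (cnt \x cnt)%E Y.
Proof.
apply: (proj2 (Cintegrable21P cnt cnt mY)).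
have B10 : 0 <= B1.
  rewrite -lee_fin; apply: le_trans (f1B 0).
  by apply: esum_ge0 => n _; rewrite lee_fin normc_ge0.
apply: (@le_lt_trans _ _ (\int[cnt]_m (B1%:E * (normc (b2 m))%:E))%E).
  apply: ge0_le_integral => //.
  - by move=> m _; apply: integral_ge0 => n _; rewrite lee_fin normc_ge0.
  - move=> m _; rewrite (eq_integral (fun n => (normc (a1 (e m) n))%:E * (normc (b2 m))%:E)%E); last first.
      by move=> n _; rewrite normY.
    rewrite ge0_integralZr//; first last.
    + by rewrite lee_fin normc_ge0.
    + by move=> n _; rewrite lee_fin normc_ge0.
    by rewrite lee_wpmul2r ?lee_fin ?normc_ge0// int_coef.
rewrite ge0_integralZl//; last by move=> m _; rewrite lee_fin normc_ge0.
have /CintegrableP[_ boo] := ib2.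
by rewrite lte_mul_pinfty.
Qed.

Lemma summable_convolution_coef :
  summable [set: int * int] (fun nm => (normc (c nm.1 nm.2))%:E).
Proof.
rewrite /summable.
rewrite (_ : [set: int * int] = [set: int] `*`` (fun=> [set: int])); last first.
  by apply/seteqP; split.
rewrite (eq_esum (b := fun nm : int * int => (normc (c nm.1 nm.2))%:E)); last first.
  by move=> nm _; rewrite gee0_abs// lee_fin normc_ge0.
rewrite -(esum_esum (a := fun n m => (normc (c n m))%:E)); last first.
  by move=> n m; rewrite lee_fin normc_ge0.
have c0 n m : (0 <= (normc (c n m))%:E)%E by rewrite lee_fin normc_ge0.
rewrite (esum_counting be) => [|n]; last by apply: esum_ge0.
rewrite (eq_integral (fun n => \int[cnt]_m (normc (Y (n, m)))%:E)%E).
  exact: (proj1 (Cintegrable12P cnt cnt mY) iY).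
by move=> n _; rewrite (esum_counting be).
Qed.

Lemma coset_dot_conv_series :
  coset_dot mu (coset_conv (periodize f1) f2) (psi_ (k1, k2, k3)) =
  s * expi (- (k3%:~R * phi)) * Csum (fun n => Csum (fun m => c n m)).
Proof.
rewrite coset_dot_conv.
pose E h := f1 h * expi (- p * (SE2_x h * cos phi + SE2_y h * sin phi)).
pose Fm (m : int) h := f1 h * expi (m%:~R * SE2_arg h) *
  expi (- p * (SE2_x h * cos phi + SE2_y h * sin phi)).
have iFm m : Cintegrable lam (Fm m) by exact: Cintegrable_radial.
(* The part of the n-th term of the series of F2 at phi - theta_h that does not depend on h. *)
pose w n := s * b2 n * expi ((- k3 - e n)%:~R * phi).
have iw : Cintegrable cnt w.
  apply/CintegrableP; split=> //.
  have /CintegrableP[_] := CintegrableZ s ib2; congr (_ < _)%E.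
  by apply: eq_integral => n _; rewrite /w !normcM normc_expi mulr1.
pose X (hn : SE2 R * nat) := w hn.2 * Fm (e hn.2) hn.1.
have nX h n : normc (X (h, n)) = normc (f1 h) * normc (w n).
  by rewrite /X /Fm !normcM !normc_expi !mulr1 mulrC.
have mX : Cmeasurable X.
  have mexp : measurable_fun setT (fun hn : SE2 R * nat => (e hn.2)%:~R * SE2_arg hn.1).
    apply: measurable_funM; last exact: (measurableT_comp (@measurable_SE2_arg R) measurable_fst).
    by apply: (measurableT_comp (f := fun n : nat => (e n)%:~R : R)).
  apply: CmeasurableM; first exact: (Cmeasurable_comp (Cintegrable_measurable iw) measurable_snd).
  apply: CmeasurableM.
    apply: CmeasurableM; last exact: Cmeasurable_expi.
    exact: (Cmeasurable_comp (Cintegrable_measurable if1) measurable_fst).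
  apply: Cmeasurable_expi; apply: measurable_funM; first exact: measurable_cst.
  apply: measurable_funD; apply: measurable_funM; try exact: measurable_cst.
  - exact: (measurableT_comp (@measurable_SE2_x R) measurable_fst).
  - exact: (measurableT_comp (@measurable_SE2_y R) measurable_fst).
have /CintegrableP[mf1 f1oo] := if1; have /CintegrableP[_ woo] := iw.
have nf1 : measurable_fun setT (fun h => (normc (f1 h))%:E).
  by apply/measurable_EFinP; exact: measurable_normc.
have iX : Cintegrable (lam \x cnt)%E X.
  apply: (proj2 (Cintegrable12P lam cnt mX)).
  rewrite (eq_integral (fun h => (normc (f1 h))%:E * \int[cnt]_n (normc (w n))%:E)%E); last first.
    move=> h _; rewrite -ge0_integralZl//; first by apply: eq_integral => n _; rewrite nX.
    - by move=> n _; rewrite lee_fin normc_ge0.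
    - by rewrite lee_fin normc_ge0.
  have w0 : (0 <= \int[cnt]_n (normc (w n))%:E)%E.
    by apply: integral_ge0 => n _; rewrite lee_fin normc_ge0.
  rewrite ge0_integralZr//; last by move=> h _; rewrite lee_fin normc_ge0.
  rewrite lte_mul_pinfty ?ge0_fin_numE//.
  - by apply: integral_ge0 => h _; rewrite lee_fin normc_ge0.
  - by apply: integral_ge0 => h _; rewrite lee_fin normc_ge0.
have coef_lty (f : SE2 R -> C) m B :
    (\esum_(n in [set: int]) (normc (fourier_coef f p n m))%:E <= B%:E)%E ->
    (\esum_(n in [set: int]) (normc (fourier_coef f p n m))%:E < +oo)%E.
  by move=> fB; rewrite (le_lt_trans fB)// ltry.
have iexp (a : nat -> C) (k : nat -> R) (t : R) : Cintegrable cnt a ->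
    Cintegrable cnt (fun n => a n * expi (k n * t)).
  by move=> ia; apply: (Cintegrable_mul_expi (th := fun t n => k n * t) ia).
transitivity (Cintegral lam setT (fun h => Cintegral cnt setT (fun n => X (h, n)))).
  apply: eq_Cintegral => h; rewrite inner.
  rewrite (radial_fourier_series if2 (coef_lty _ _ _ (f2B (- k3)))) (Csum_counting be).
  rewrite mulrA -CintegralZ; last exact: iexp.
  apply: eq_Cintegral => n; rewrite /X /w /Fm /=.
  (* The phases in theta_h reduce to exp(i m theta_h) with m = [e n], as required by [Fm]. *)
  rewrite [(- k3 - e n)%:~R * (phi - _)]mulrBr expiD.
  have -> : expi (- ((- k3 - e n)%:~R * SE2_arg h)) =
      expi ((e n)%:~R * SE2_arg h) * expi (k3%:~R * SE2_arg h).
    by rewrite -expiD; congr expi; rewrite intrB mulrNz; ring.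
  have e1 : expi ((- k3)%:~R * SE2_arg h) * expi (k3%:~R * SE2_arg h) = 1.
    by rewrite -expiD mulrNz mulNr addNr expi0.
  rewrite -[RHS]mulr1 -e1 /b2; ring.
rewrite (CFubini iX).
transitivity (Cintegral cnt setT (fun m => s * expi (- (k3%:~R * phi)) *
    Cintegral cnt setT (fun n => Y (n, m)))).
  apply: eq_Cintegral => m.
  pose v n := a1 (e m) n * expi (- (e n)%:~R * phi).
  have iv : Cintegrable cnt v := iexp (a1 (e m)) (fun n => - (e n)%:~R) phi (ia1 (e m)).
  transitivity (w m * (expi ((e m)%:~R * phi) * Cintegral cnt setT v)).
    rewrite -(CintegralZ (expi _) iv).
    rewrite /X /= (CintegralZ _ (iFm _)); congr (_ * _).
    (* The integral over h is itself a radial transform, at the angle phi, and is expanded in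
       turn. *)
    rewrite -[LHS]/(radial_transform f1 p (e m) phi).
    rewrite (radial_fourier_series if1 (coef_lty _ _ _ (f1B (e m)))) (Csum_counting be).
    apply: eq_Cintegral => n; rewrite /v intrB mulrBl expiD mulNr -/(a1 (e m) n).
    by move: (expi _) (expi _) (a1 _ _) => x y z; ring.
  have -> : Cintegral cnt setT (fun n => Y (n, m)) = b2 m * Cintegral cnt setT v.
    rewrite -(CintegralZ _ iv); apply: eq_Cintegral => n.
    have -> : Y (n, m) = expi (- ((e n)%:~R * phi)) * a1 (e m) n * b2 m by [].
    by rewrite /v mulNr; move: (expi _) (a1 _ _) (b2 _) => x y z; ring.
  rewrite /w intrB mulrBl expiD mulrNz mulNr.
  (* The phases in m phi from the two expansions cancel, leaving exp(-i k3 phi). *)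
  have e1 : expi (- ((e m)%:~R * phi)) * expi ((e m)%:~R * phi) = 1.
    by rewrite -expiD addNr expi0.
  rewrite -[RHS]mulr1 -e1.
  move: (expi _) (expi _) (expi _) (b2 m) (Cintegral _ _ _) => x y z t u; ring.
rewrite CintegralZ; last exact: Cintegrable_Cintegral2 iY.
rewrite -(CFubini iY) (Csum_counting be); congr (_ * _).
by apply: eq_Cintegral => n; rewrite (Csum_counting be).
Qed.

End nonzero_frequency.
End convolution_coefficients.

Theorem theorem6p6 (R : realType) (mu : {measure set (Z2SE2 R) -> \bar R})
    (mu_haar : quotient_haar mu) (f1 f2 : SE2 R -> R[i])
    (f1_L1 : in_L (haar R) 1 f1) (f1_L2 : in_L (haar R) 2 f1)
    (f2_L1 : in_L (haar R) 1 f2) (f2_L2 : in_L (haar R) 2 f2)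
    (f1_adm : admissible f1) (f2_adm : admissible f2)
    (pf1_L2 : in_L mu 2 (periodize f1)) (k1 k2 k3 : int) :
  let rho := polar_rho (k1%:~R : R) k2%:~R in
  let phi := polar_phi (k1%:~R : R) k2%:~R in
  (rho != 0 ->
    let c (n m : int) : R[i] :=
      expi (- (n%:~R * phi)) * fourier_coef f1 (2 * pi * rho) n m
      * fourier_coef f2 (2 * pi * rho) m (- k3) in
    summable [set: int * int] (fun nm => (normc (c nm.1 nm.2))%:E) /\
    coset_dot mu (coset_conv (periodize f1) f2) (psi_ (k1, k2, k3)) =
      (Num.sqrt (2 * pi))%:C * expi (- (k3%:~R * phi))
      * Csum (fun n => Csum (fun m => c n m))) /\
  (rho = 0 ->
    coset_dot mu (coset_conv (periodize f1) f2) (psi_ (k1, k2, k3)) =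
      (Num.sqrt (2 * pi))%:C * fourier_theta f1 k3 * fourier_theta f2 k3).
Proof.
move=> rho phi.
have if1 : Cintegrable (haar_sfinite R) f1 := proj1 (in_L1_integrable _ _) f1_L1.
have if2 : Cintegrable (haar_sfinite R) f2 := proj1 (in_L1_integrable _ _) f2_L1.
split=> [rho_neq0 c|rho_eq0].
(* Admissibility controls the coefficients at positive p only. *)
- have p0 : 0 < 2 * pi * rho.
    by rewrite mulr_gt0 ?pi2_gt0// lt_neqAle eq_sym rho_neq0 sqrtr_ge0.
  have [B1 f1B] := admissible_bound f1_adm.
  have [B2 f2B] := admissible_bound f2_adm.
  have [e be] := int_enum.
  split.
  + exact: (summable_convolution_coef k3 (fun m => f1B _ m p0) (fun m => f2B _ m p0) be).
  + exact: (coset_dot_conv_series mu_haar if1 if2 k3 rho_neq0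
      (fun m => f1B _ m p0) (fun m => f2B _ m p0) be).
- move/eqP: rho_eq0; rewrite sqrtr_eq0 => le0.
  have : k1%:~R ^+ 2 + k2%:~R ^+ 2 == 0 :> R.
    by rewrite eq_le le0 addr_ge0 ?sqr_ge0.
  rewrite paddr_eq0 ?sqr_ge0// !sqrf_eq0 !intr_eq0 => /andP[/eqP -> /eqP ->].
  exact: coset_dot_conv_theta.
Qed.
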